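(* Let $d\ge 1$, $p,q\ge 1$, $\tau>0$, $c>0$ and $W^\circ\in\mathcal W^d$ be fixed, and let $F_\infty>0$. There exists a positive constant $\mathfrak K_1$ that depends only on $F_\infty$, $W^\circ$, $p$, $q$ and $\tau$ such that, for every density function $f:[0,1]^d\to\mathbb R$ with $\|f\|_\infty\le F_\infty$ and every $n\ge 2$, $$R_n^{(p,q)}(\hat f^{\mathrm{ani}},f)\le \mathfrak K_1\inf_{\ell\in\mathcal L_{\mathrm{ani}}}\left\{\big\|\mathbf E_f^n\hat f_\ell^{\mathrm{ani}}-f\big\|_p+\max_{\ell'\in\mathcal L_{\mathrm{ani}}}\big\|\mathbf E_f^n\hat f_{\ell'}^{\mathrm{ani}}-\mathbf E_f^n\hat f_{\ell\wedge\ell'}^{\mathrm{ani}}\big\|_p+\frac{1}{(nV_{h(\ell)})^{1/2}}\right\}.$$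
   Context: Setting. $\Delta_d=[0,1]^d$, $\Delta_1=[0,1]$, $\mathbb N=\{0,1,2,\dots\}$. One observes i.i.d. random variables $X_1,\dots,X_n$ with density $f$ on $\Delta_d$; $\mathbf E_f^n$ is the corresponding expectation. $\|g\|_p=(\int_{\Delta_d}|g(t)|^p\,dt)^{1/p}$. For an estimator $\tilde f$ (a measurable map $\Delta_d^n\to\mathbb L_p(\Delta_d)$) the risk is $R_n^{(p,q)}(\tilde f,f)=(\mathbf E_f^n\|\tilde f-f\|_p^q)^{1/q}$. The dimension $d$ and the constant $c>0$ are fixed throughout. Kernels. $\mathcal W$ is the set of functions $W:\mathbb R\to\mathbb R$ that are bounded on $\Delta_1$, vanish outside $\Delta_1$, and satisfy $\int_0^1W(u)\,du=1$. For $W=(W_1,\dots,W_d)\in\mathcal W^d$, $\|W\|_r$ denotes the $\mathbb L_r(\Delta_d)$-norm of $u\mapsto\prod_iW_i(u_i)$. For $h\in(0,1/2)^d$, $V_h=\prod_{i=1}^dh_i$, $$\mathcal K_{W,h}(t,x)=\prod_{i=1}^d\frac1{h_i}W_i\Big(\sigma(t_i)\frac{t_i-x_i}{h_i}\Big),\qquad \sigma=2\mathbf I_{(1/2,1)}-1,\qquad \tilde f_{W,h}(t)=\frac1n\sum_{j=1}^n\mathcal K_{W,h}(t,X_j),\quad t,x\in\Delta_d.$$ Bandwidths. $\mathcal H_n=\{h\in(0,h_n^*]^d: nV_h\ge(\log n)^c\}$ with $h_n^*=\exp(-\sqrt{\log n})$. For $\ell\in\mathbb N^d$, $h(\ell)=(e^{-\ell_1},\dots,e^{-\ell_d})$;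 $\mathcal L_{\mathrm{ani}}=\{\ell\in\mathbb N^d: h(\ell)\in\mathcal H_n\}$. For the fixed $W^\circ\in\mathcal W^d$ put $W(\ell)=W^\circ$ and $\hat f_\ell=\hat f_\ell^{\mathrm{ani}}=\tilde f_{W^\circ,h(\ell)}$. $\ell\wedge\ell'$ is the coordinatewise minimum. Selection rule (with $\mathcal L=\mathcal L_{\mathrm{ani}}$). For $\varepsilon\in\{0,1\}^d$ let $\Delta_{d,\varepsilon}=\prod_{i=1}^d(\frac{\varepsilon_i}2,\frac{1+\varepsilon_i}2)$, $$\hat\Lambda_\varepsilon(W,h,p)=\sqrt{V_h}\Big(\int_{\Delta_{d,\varepsilon}}\Big(\frac1n\sum_{j=1}^n\mathcal K_{W,h}^2(t,X_j)\Big)^{p/2}dt\Big)^{1/p},$$ $\hat\Gamma_\varepsilon(W,h,p)=2^{-\frac{d(2-p)}{2p}}\|W\|_2$ if $1\le p\le2$, and $\hat\Gamma_\varepsilon(W,h,p)=C_p^*(\hat\Lambda_\varepsilon(W,h,p)+2\|W\|_p)$ if $p>2$, where $C_p^*=14.7\,p/\log p$. Put $$\hat M_p(\ell)=\frac1{\sqrt{nV_{h(\ell)}}}\sum_{\varepsilon\in\{0,1\}^d}\hat\Gamma_\varepsilon(W(\ell),h(\ell),p),\qquad \hat M_p(\ell,\ell')=\hat M_p(\ell')+\hat M_p(\ell\wedge\ell'),$$ $$\hat B_p(\ell)=\max_{\ell'\in\mathcal L}\big\{\|\hat f_{\ell\wedge\ell'}-\hat f_{\ell'}\|_p-(1+\tau)\hat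 M_p(\ell,\ell')\big\}_+,\qquad \hat\ell\in\operatorname*{arg\,min}_{\ell\in\mathcal L}\big(\hat B_p(\ell)+(1+\tau)\hat M_p(\ell)\big),$$ with $x_+=\max(x,0)$. The final estimator is $\hat f^{\mathrm{ani}}=\hat f_{\hat\ell}$. (If $\mathcal L_{\mathrm{ani}}$ is empty, the infimum over it is $+\infty$ by convention and nothing is asserted.) *)

(* Defs.v *)
From HB Require Import structures.
From mathcomp Require Import all_boot all_order all_algebra.
From mathcomp Require Import all_classical all_reals all_analysis.

Set Implicit Arguments.
Unset Strict Implicit.
Unset Printing Implicit Defensive.

Import Order.TTheory GRing.Theory Num.Theory.
Import numFieldNormedType.Exports.

Local Open Scope classical_set_scope.
Local Open Scope ring_scope.

Section lebesgue_cons.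
Local Open Scope ereal_scope.
Context (R : realType) (d : nat).
Variable m : {sigma_finite_measure set (d.-tuple R) -> \bar R}.

Definition tcons (x : R * d.-tuple R) : d.+1.-tuple R := [tuple of x.1 :: x.2].

Lemma measurable_tcons : measurable_fun setT tcons.
Proof. exact: (measurable_cons measurable_fst measurable_snd). Qed.

Definition lebesgue_cons : set (d.+1.-tuple R) -> \bar R :=
  pushforward (@lebesgue_measure R \x m) tcons.

Let lebesgue_cons0 : lebesgue_cons set0 = 0.
Proof. by rewrite /lebesgue_cons /pushforward preimage_set0 measure0. Qed.

Let lebesgue_cons_ge0 A : 0 <= lebesgue_cons A.
Proof. by rewrite /lebesgue_cons /pushforward measure_ge0. Qed.

Let lebesgue_cons_sigma_additive : semi_sigma_additive lebesgue_cons.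
Proof.
move=> F mF tF mUF; rewrite /lebesgue_cons /pushforward preimage_bigcup.
apply: measure_semi_sigma_additive.
- by move=> n; rewrite -[X in measurable X]setTI; exact: measurable_tcons.
- apply/trivIsetP => /= i j _ _ ij; rewrite -preimage_setI.
  by move/trivIsetP : tF => /(_ _ _ _ _ ij) ->//; rewrite preimage_set0.
- by rewrite -preimage_bigcup -[X in measurable X]setTI; exact: measurable_tcons.
Qed.

HB.instance Definition _ := isMeasure.Build _ _ _ lebesgue_cons
  lebesgue_cons0 lebesgue_cons_ge0 lebesgue_cons_sigma_additive.

Let lebesgue_cons_sigma_finite : sigma_finite setT lebesgue_cons.
Proof.
have /sigma_finiteP[F [UF ndF Foo]] := sigma_finiteT (@lebesgue_measure R).
have /sigma_finiteP[G [UG ndG Goo]] := sigma_finiteT m.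
pose uncons (t : d.+1.-tuple R) : R * d.-tuple R :=
  (tnth t ord0, [tuple of behead t]).
have muncons : measurable_fun setT uncons.
  apply: measurable_fun_pair; first exact: measurable_tnth.
  exact: measurable_behead.
have tconsK : cancel tcons uncons.
  by case=> a b; rewrite /uncons /=; congr pair; apply: val_inj.
exists (fun k => uncons @^-1` (F k `*` G k)).
  apply/esym; rewrite -subTset => t _.
  have : [set: R] (tnth t ord0) by [].
  have : [set: d.-tuple R] [tuple of behead t] by [].
  rewrite {1}UF {1}UG => -[k _ Gk] [j _ Fj].
  exists (maxn j k) => //; split => /=.
    by move: Fj; exact/subsetPset/ndF/leq_maxl.
  by move: Gk; exact/subsetPset/ndG/leq_maxr.
move=> k; have [mF Fk] := Foo k; have [mG Gk] := Goo k; split.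
  by rewrite -[X in measurable X]setTI; apply: muncons => //; exact: measurableX.
rewrite /lebesgue_cons /pushforward -comp_preimage.
rewrite (_ : uncons \o tcons = id); last by apply/funext => x; exact: tconsK.
by rewrite preimage_id product_measure1E// lte_mul_pinfty// ge0_fin_numE.
Qed.

HB.instance Definition _ := Measure_isSigmaFinite.Build _ _ _ lebesgue_cons
  lebesgue_cons_sigma_finite.

End lebesgue_cons.

Section lebesgue_tuple.
Context (R : realType).

(* Lebesgue measure on the Borel sets of R^d, as an iterated product. *)
Fixpoint lebesgue_tuple (d : nat) :
    {sigma_finite_measure set (d.-tuple R) -> \bar R} :=
  match d return {sigma_finite_measure set (d.-tuple R) -> \bar R} with
  | 0 => dirac ([tuple] : 0.-tuple R)
  | d'.+1 => lebesgue_cons (lebesgue_tuple d')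
  end.

Lemma measurable_box d (A : 'I_d -> set R) :
  (forall i, measurable (A i)) ->
  measurable [set t : d.-tuple R | forall i, A i (tnth t i)].
Proof.
move=> mA.
rewrite (_ : [set _ | _] =
  \bigcap_(i in [set: 'I_d]) ((fun t : d.-tuple R => tnth t i) @^-1` A i)).
  apply: (@fin_bigcap_measurable _ (d.-tuple R) 'I_d setT) => [|i _].
    exact: finite_finset.
  by rewrite -[X in measurable X]setTI; exact: measurable_tnth.
by apply/seteqP; split => [t tA i _|t tA i]; exact: tA.
Qed.

Lemma lebesgue_tuple_box d (A : 'I_d -> set R) :
  (forall i, measurable (A i)) ->
  lebesgue_tuple d [set t | forall i, A i (tnth t i)] =
  (\prod_(i < d) lebesgue_measure (A i))%E.
Proof.
elim: d A => [|d IH] A mA.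
  by rewrite big_ord0 /= diracE mem_set//= => -[].
rewrite big_ord_recl -IH; last by move=> i; exact: mA.
rewrite -product_measure1E; first last.
  exact: (@measurable_box d (fun i => A (lift ord0 i)) (fun i => mA _)).
  exact: (mA ord0).
apply: (congr1 (@lebesgue_measure R \x lebesgue_tuple d)%E).
apply/seteqP; split => [[a t] /= tA|[a t] /= [Aa tA] i].
  split; first exact: (tA ord0).
  by move=> i; have := tA (lift ord0 i); rewrite tnthS.
by case: (unliftP ord0 i) => [j ->|-> //]; rewrite tnthS.
Qed.

End lebesgue_tuple.

Section unit_cube.
Context (R : realType) (d : nat).

Definition cube : set (d.-tuple R) :=
  [set t | forall i, tnth t i \in `[0, 1]%R].

Lemma measurable_cube : measurable cube.
Proof. by apply: (@measurable_box R d (fun=> `[0, 1]%classic)) => i. Qed.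

Definition cube_measure : {measure set (d.-tuple R) -> \bar R} :=
  mrestr (lebesgue_tuple R d) measurable_cube.

Definition subcube (e : {ffun 'I_d -> bool}) : set (d.-tuple R) :=
  [set t | forall i, tnth t i \in `](e i)%:R / 2, (1 + (e i)%:R) / 2[%R].

Definition norm_cube (p : R) (g : d.-tuple R -> \bar R) : \bar R :=
  'N[cube_measure]_(p%:E)[g].

(* A density is represented by a function on R^d of which only the values on
   the cube matter. *)
Definition density (f : d.-tuple R -> R) : Prop :=
  [/\ measurable_fun setT f, forall t, cube t -> 0 <= f t &
      (\int[lebesgue_tuple R d]_(t in cube) (f t)%:E = 1)%E].

(* Taking [A j = setT] for some of the [j] in the last clause gives the product
   rule for every subfamily, i.e. mutual independence. *)
Definition iid_sample (n : nat) (disp : measure_display)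
    (T : measurableType disp) (P : probability T R)
    (f : d.-tuple R -> R) (X : 'I_n -> T -> d.-tuple R) : Prop :=
  [/\ forall j, measurable_fun setT (X j),
      forall j w, cube (X j w),
      forall j A, measurable A ->
        P (X j @^-1` A) =
        (\int[lebesgue_tuple R d]_(t in A `&` cube) (f t)%:E)%E &
      forall A : 'I_n -> set (d.-tuple R), (forall j, measurable (A j)) ->
        P [set w | forall j, A j (X j w)] =
        (\prod_(j < n) P (X j @^-1` A j))%E].

End unit_cube.

Section estimators.
Context (R : realType) (d n : nat).
Implicit Types (W : 'I_d -> R -> R) (h t u : d.-tuple R) (p c tau : R).
Implicit Types (x : n.-tuple (d.-tuple R)) (l : d.-tuple nat).

Definition kernel_class (w : R -> R) : Prop :=
  [/\ measurable_fun setT w,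
      exists M : R, forall u : R, u \in `[0, 1]%R -> `|w u| <= M,
      forall u : R, u \notin `[0, 1]%R -> w u = 0 &
      (\int[lebesgue_measure]_(u in `[0%R, 1%R]%classic) (w u)%:E = 1)%E].

Definition norm_kernel (r : R) W : \bar R :=
  norm_cube r (fun u => (\prod_(i < d) W i (tnth u i))%:E).

Definition vol h : R := \prod_(i < d) tnth h i.

(* The sign makes the support of [kern W h t] stay inside the cube: the kernel
   looks backward in coordinate [i] when [t_i > 1/2] and forward otherwise. *)
Definition sigma (s : R) : R := 2 * \1_(`]2^-1, 1[%classic) s - 1.

Definition kern W h t u : R :=
  \prod_(i < d) ((tnth h i)^-1 *
    W i (sigma (tnth t i) * ((tnth t i - tnth u i) / tnth h i))).

Definition kernel_estimator W h x t : R :=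
  n%:R^-1 * \sum_(j < n) kern W h t (tnth x j).

Definition hmax : R := expR (- Num.sqrt (ln n%:R)).

Definition bandwidths c : set (d.-tuple R) :=
  [set h | (forall i, tnth h i \in `]0, hmax]%R) /\
           ln n%:R `^ c <= n%:R * vol h].

(* The bandwidth vector h(l), on an exponential grid. *)
Definition hexp l : d.-tuple R := [tuple expR (- (tnth l i)%:R) | i < d].

Definition Lani c : set (d.-tuple nat) := [set l | bandwidths c (hexp l)].

Definition imin l l' : d.-tuple nat :=
  [tuple minn (tnth l i) (tnth l' i) | i < d].

Definition fhat W l x : d.-tuple R -> R := kernel_estimator W (hexp l) x.

Local Open Scope ereal_scope.

Definition Lambda_hat x (e : {ffun 'I_d -> bool}) W h p : \bar R :=
  (Num.sqrt (vol h))%:E *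
  (\int[lebesgue_tuple R d]_(t in @subcube R d e)
     ((n%:R^-1 * \sum_(j < n) kern W h t (tnth x j) ^+ 2) `^ (p / 2))%R%:E)
  `^ p^-1.

(* The constant 14.7 p / log p of Rosenthal's inequality. *)
Definition Cstar p : R := (147 / 10 * p / ln p)%R.

Definition Gamma_hat x (e : {ffun 'I_d -> bool}) W h p : \bar R :=
  if (p <= 2)%R then
    (2 `^ (- (d%:R * (2 - p) / (2 * p))))%R%:E * norm_kernel 2 W
  else (Cstar p)%:E * (Lambda_hat x e W h p + 2%:E * norm_kernel p W).

Definition M_hat W p x l : \bar R :=
  ((Num.sqrt (n%:R * vol (hexp l)))^-1)%R%:E *
  \sum_(e : {ffun 'I_d -> bool}) Gamma_hat x e W (hexp l) p.

Definition M_hat2 W p x l l' : \bar R :=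
  M_hat W p x l' + M_hat W p x (imin l l').

(* The maximum over the finite set of multi-indices is a supremum in [\bar R];
   likewise in [oracle] below. *)
Definition B_hat c tau W p x l : \bar R :=
  ereal_sup [set maxe
      (norm_cube p (fun t => (fhat W (imin l l') x t - fhat W l' x t)%R%:E)
       - (1 + tau)%R%:E * M_hat2 W p x l l') 0
    | l' in Lani c].

Definition criterion c tau W p x l : \bar R :=
  B_hat c tau W p x l + (1 + tau)%R%:E * M_hat W p x l.

Definition argmin_set c tau W p x : set (d.-tuple nat) :=
  [set l | Lani c l /\ forall l', Lani c l' ->
    criterion c tau W p x l <= criterion c tau W p x l'].

Definition data_cube : set (n.-tuple (d.-tuple R)) :=
  [set x | forall j, @cube R d (tnth x j)].

(* Any measurable choice of a minimizer (ties are allowed); measurability is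
   what makes the selected estimator a measurable function of the data. Only
   the values of [lhat] on the cube of the data space matter. *)
Definition selection_rule c tau W p
    (lhat : n.-tuple (d.-tuple R) -> d.-tuple nat) : Prop :=
  measurable_fun data_cube lhat /\
  forall x, data_cube x -> argmin_set c tau W p x (lhat x).

Context (disp : measure_display) (T : measurableType disp).
Variables (P : probability T R) (X : 'I_n -> T -> d.-tuple R).

Definition data (w : T) : n.-tuple (d.-tuple R) := [tuple X j w | j < n].

Definition risk p q (ftilde : n.-tuple (d.-tuple R) -> d.-tuple R -> R)
    (f : d.-tuple R -> R) : \bar R :=
  (\int[P]_w
     norm_cube p (fun t => (ftilde (data w) t - f t)%R%:E) `^ q) `^ q^-1.

Definition mean_fhat W l t : \bar R := 'E_P[fun w => fhat W l (data w) t].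

Definition oracle c W p (f : d.-tuple R -> R) l : \bar R :=
  norm_cube p (fun t => mean_fhat W l t - (f t)%:E) +
  ereal_sup [set norm_cube p
      (fun t => mean_fhat W l' t - mean_fhat W (imin l l') t)
    | l' in Lani c] +
  ((Num.sqrt (n%:R * vol (hexp l)))^-1)%R%:E.

End estimators.

(* Main.v *)
Require Import Defs.
From HB Require Import structures.
From mathcomp Require Import all_boot all_order all_algebra.
From mathcomp Require Import all_classical all_reals all_analysis.
From mathcomp Require Import measurable_realfun ess_sup_inf.
From mathcomp Require Import ring lra.

Set Implicit Arguments.
Unset Strict Implicit.
Unset Printing Implicit Defensive.

Import Order.TTheory GRing.Theory Num.Theory.
Import numFieldNormedType.Exports.

Local Open Scope classical_set_scope.
Local Open Scope ring_scope.

(* Let h = h(l) and let m_l be the mean of fhat_l. Everything rests on the event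
   that, for every l in the grid, the stochastic error |fhat_l - m_l|_p is at most
   (1 + tau) M_hat(l), while M_hat(l) is at most a constant times (n V_h)^(-1/2).
   On it the Goldenshluger-Lepski comparison of lhat with l through min(l, lhat)
   is deterministic and yields the oracle inequality; off it a crude bound of
   order n suffices, because the complement has probability O(n^-b) for every b.

   To control the event for one l, both |fhat_l - m_l|_p^p and the integral behind
   Lambda_hat are of the form Phi(x) = \int u(t, x)^s dt with u(t, .) normalized so
   as to have a bounded exponential moment. Changing one observation moves
   \int |u| by O(V / sqrt(n V)), since a kernel lives on a box of volume O(V), so
   McDiarmid's inequality for a truncation of Phi at height O(log n) makes Phi
   concentrate around its mean up to an arbitrarily small constant, thanks to
   V <= exp(-sqrt(log n)). What is left is a comparison of means: the variance
   bound for p <= 2; for p > 2 the bound by (4 sqrt p)^p times the mean of the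
   empirical quantity, from Chernoff's exponential moment and Jensen's inequality,
   and 4 sqrt p is less than 14.7 p / log p. *)

(** McDiarmid's inequality leaves an additive error, so each comparison needs a margin bounded away
    from zero. It comes from the normalization of the kernels: integral one forces [||W||_p >= 1].
    For [p <= 2] the tolerated error is [tau] times the variance bound; for [p > 2] it fits inside
    the term [2 ||W||_p] of [Gamma_hat]. The density enters the probabilistic estimates only through
    the mass of boxes, [mu (box h t) <= B * vol h], which makes all constants uniform in [f] and
    [n]. There is no maximal inequality over the grid: each index is treated alone and the grid has
    [O(n^d)] points, so the failure probability must beat any prescribed power of [n]. Conversely
    the oracle never falls below [1/n], so a failure probability of order [n^(-2q)] against a crude
    loss of order [n^q] is harmless. Exponential moments come with ranges for their parameter; they
    are met because [n V >= (ln 2)^c], except for one moment bound that needs [n V] above a constant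
    and hence [n] large. *)

(** * Inequalities for exponentials and real powers *)

Section real_inequalities.
Context {R : realType}.
Implicit Types x y a m s : R.

(** From [1 - x <= exp (- x)] one gets [exp x <= 1 / (1 - x)], and [(1 - x) (1 + x + 2 x^2) = 1 +
    x^2 (1 - 2 x)] is at least one on this range. It serves Bernstein-type bounds, where only an
    upper bound on the variable is needed. *)
Lemma expR_le_quad x : x <= 1 / 2 -> expR x <= 1 + x + 2 * x ^+ 2.
Proof.
move=> x2; have := expR_ge1Dx (- x); rewrite expRN => h.
have x1 : 0 < 1 - x by lra.
have e0 := expR_gt0 x.
have : expR x <= (1 - x)^-1.
  by rewrite -[leLHS]invrK lef_pV2 ?posrE ?invr_gt0//.
move/le_trans; apply; rewrite -div1r ler_pdivrMr//.
have := sqr_ge0 x => x20.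
nra.
Qed.

(** Valid for every real [x]: beyond [1/2] the term [2 x^2] already exceeds [x]. Averaged over a
    centred variable, the linear term disappears and a sub-Gaussian bound remains. *)
Lemma expR_le_id x : expR x <= x + expR (2 * x ^+ 2).
Proof.
have [x2|x2] := leP x (1 / 2).
  have := expR_le_quad x2; have := expR_ge1Dx (2 * x ^+ 2); lra.
have : expR x <= expR (2 * x ^+ 2) by rewrite ler_expR; nra.
lra.
Qed.

Lemma powR_bernoulli s x : 1 <= s -> 0 <= x -> 1 + s * (x - 1) <= x `^ s.
Proof.
move=> s1; rewrite le_eqVlt => /predU1P[<-|x0].
  rewrite powR0; last by rewrite gt_eqF// (lt_le_trans ltr01).
  lra.
have s0 : 0 < s by rewrite (lt_le_trans ltr01).
rewrite /powR gt_eqF//.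
(* convexity of exp: x = exp(ln x) at the barycentre of [s * ln x] and [0] *)
have h1 := expR_ge1Dx (s * ln x - ln x).
have h2 := expR_ge1Dx (- ln x).
rewrite expRD in h1; move: h1 h2; rewrite !expRN lnK ?posrE// => h1 h2.
have h1' : (1 + (s * ln x - ln x)) * x <= expR (s * ln x) by rewrite -ler_pdivlMr.
have h2' : x - x * ln x <= 1.
  have := ler_wpM2r (ltW x0) h2; rewrite mulVf ?gt_eqF//; lra.
suff : 0 <= (s - 1) * (1 - x + x * ln x) by nra.
by rewrite mulr_ge0//; lra.
Qed.

Lemma powR_tangent s a m : 1 <= s -> 0 <= a -> 0 <= m ->
  m `^ s + s * m `^ (s - 1) * (a - m) <= a `^ s.
Proof.
move=> s1 a0; rewrite le_eqVlt => /predU1P[<-|m0].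
  rewrite powR0 ?gt_eqF ?(lt_le_trans ltr01)// add0r subr0.
  (* At [m = 0] the slope is [0 ^ (s - 1)], which is [1] and not [0] when [s = 1]. *)
  have [->|sn1] := eqVneq s 1; first by rewrite subrr powRr0 powRr1// !mul1r.
  by rewrite powR0 ?subr_eq0// mulr0 mul0r powR_ge0.
have q0 : 0 <= a / m by rewrite divr_ge0// ltW.
have := powR_bernoulli s1 q0.
have ms0 : 0 < m `^ s by rewrite powR_gt0.
have am : a = m * (a / m) by rewrite mulrC divfK// gt_eqF.
have -> : a `^ s = m `^ s * (a / m) `^ s by rewrite {1}am powRM// ltW.
move=> h; have := ler_wpM2l (ltW ms0) h; apply: le_trans.
rewrite le_eqVlt; apply/orP; left; apply/eqP.
have -> : m `^ s = m `^ (s - 1) * m.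
  by rewrite [RHS]mulrC mulr_powRB1// ?ltW// (lt_le_trans ltr01).
field; by rewrite gt_eqF.
Qed.

Lemma powR_lipschitz s a b : 1 <= s -> 0 <= b -> b <= a ->
  a `^ s - b `^ s <= s * a `^ (s - 1) * (a - b).
Proof.
move=> s1 b0 ba; have := powR_tangent s1 b0 (le_trans b0 ba); nra.
Qed.

(** This is [1 + z <= exp z] at [z = lam y / s - 1], raised to the power [s]; equality holds at
    [y = s / lam]. It trades a moment for an exponential moment without losing the constant. *)
Lemma powR_le_expR s lam y : 0 < s -> 0 < lam -> 0 <= y ->
  y `^ s <= (s / lam) `^ s * expR (lam * y - s).
Proof.
move=> s0 lam0 y0.
have sl : 0 < s / lam by rewrite divr_gt0.
have : y <= (s / lam) * expR (lam * y / s - 1).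
  have := expR_ge1Dx (lam * y / s - 1); rewrite addrC subrK => h.
  have := ler_wpM2l (ltW sl) h; apply: le_trans.
  by rewrite le_eqVlt; apply/orP; left; apply/eqP; field; rewrite !gt_eqF.
move=> h; have := @ge0_ler_powR R s (ltW s0) _ _ _ _ h.
rewrite !nnegrE y0 mulr_ge0 ?expR_ge0 ?(ltW sl)// => /(_ isT isT)/le_trans; apply.
rewrite powRM ?expR_ge0 ?(ltW sl)// -expRM ler_wpM2l ?powR_ge0// ler_expR.
by rewrite le_eqVlt; apply/orP; left; apply/eqP; field; rewrite !gt_eqF.
Qed.

Lemma powR_expRN_bounded s : 0 <= s ->
  exists2 C : R, 0 < C & forall y, 0 <= y -> y `^ s * expR (- y) <= C.
Proof.
move=> s0; exists ((s + 1) `^ (s + 1) + 1) => [|y y0].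
  by rewrite ltr_wpDl ?powR_ge0.
have [y1|y1] := leP y 1.
  apply: (@le_trans _ _ 1); last by rewrite lerDr powR_ge0.
  rewrite -[leRHS]mulr1 ler_pM ?powR_ge0 ?expR_ge0//.
    have -> : 1 = 1 `^ s :> R by rewrite powR1.
    by apply: ge0_ler_powR; rewrite ?nnegrE.
  by rewrite expR_le1 oppr_le0.
(* [powR_le_expR] wants a positive exponent and [s] may vanish; above [1] raising the exponent only
   increases the power. *)
have s1 : 0 < s + 1 by lra.
have := powR_le_expR s1 ltr01 y0; rewrite divr1 mul1r => h.
apply: (@le_trans _ _ (y `^ (s + 1) * expR (- y))).
  by rewrite ler_wpM2r ?expR_ge0// ler_powR ?ltW//; lra.
have := ler_wpM2r (expR_ge0 (- y)) h => /le_trans; apply.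
rewrite -mulrA -expRD.
apply: (@le_trans _ _ ((s + 1) `^ (s + 1))); last by lra.
rewrite ler_piMr ?powR_ge0// expR_le1; lra.
Qed.

(** Each [z] among [x], [y] satisfies [z^s = z * z^(s-1) <= z * (x + y)^(s-1)]; the two bounds are
    added. *)
Lemma powR_addr_le s x y : 1 <= s -> 0 <= x -> 0 <= y ->
  x `^ s + y `^ s <= (x + y) `^ s.
Proof.
move=> s1 x0 y0; have [xy0|xyn0] := eqVneq (x + y) 0.
  have -> : x = 0 by lra.
  have -> : y = 0 by lra.
  by rewrite addr0 powR0 ?addr0// gt_eqF// (lt_le_trans ltr01).
have xy : 0 < x + y by rewrite lt0r xyn0 addr_ge0.
have H z : 0 <= z -> z <= x + y -> z `^ s <= z * (x + y) `^ (s - 1).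
  move=> z0 zxy; have [->|zn0] := eqVneq z 0.
    by rewrite mul0r powR0// gt_eqF// (lt_le_trans ltr01).
  rewrite -mulr_powRB1// ?(lt_le_trans ltr01)//.
  by rewrite ler_wpM2l//; apply: ge0_ler_powR; rewrite ?nnegrE ?subr_ge0// ltW.
have hx : x `^ s <= x * (x + y) `^ (s - 1) by apply: H => //; lra.
have hy : y `^ s <= y * (x + y) `^ (s - 1) by apply: H => //; lra.
rewrite (le_trans (lerD hx hy))// -mulrDl.
by rewrite mulr_powRB1// ?ltW// (lt_le_trans ltr01).
Qed.

End real_inequalities.

(** * Independent sampling *)

Section integral_complements.
Context d (T : measurableType d) (R : realType).
Implicit Types mu : {measure set T -> \bar R}.

(* No measurability is assumed: the integral of a nonnegative function is a
   supremum over the simple functions below it. *)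
Lemma ge0_le_integral_nonmeasurable mu (D : set T) (f g : T -> \bar R) :
  (forall x, D x -> 0 <= f x)%E -> (forall x, D x -> f x <= g x)%E ->
  (\int[mu]_(x in D) f x <= \int[mu]_(x in D) g x)%E.
Proof.
move=> f0 fg; rewrite !ge0_integralE//; last first.
  by move=> x Dx; exact: le_trans (f0 _ Dx) (fg _ Dx).
apply: ereal_sup_le => _ /= [h hf <-]; exists h => //.
move=> x; apply: (le_trans (hf x)); rewrite !patchE.
by case: ifPn => // /[!inE]; exact: fg.
Qed.

Lemma bounded_integrable mu (f : T -> R) (M : R) :
  (mu setT < +oo)%E -> measurable_fun setT f -> (forall x, `|f x| <= M) ->
  mu.-integrable setT (EFin \o f).
Proof.
move=> mufin mf fM; apply: measurable_bounded_integrable => //.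
by exists M; split; [exact: num_real|move=> x Mx y _; exact: le_trans (fM y) (ltW Mx)].
Qed.

Lemma EFin_Rintegral mu (f : T -> R) (M : R) :
  (mu setT < +oo)%E -> measurable_fun setT f -> (forall x, `|f x| <= M) ->
  (\int[mu]_x f x)%:E = (\int[mu]_x (f x)%:E)%E.
Proof.
move=> mufin mf fM; rewrite /Rintegral fineK//.
by apply: integrable_fin_num => //; exact: (bounded_integrable _ _ fM).
Qed.

Lemma integral_probability_cst (P : probability T R) (c : \bar R) :
  (\int[P]__ c)%E = c.
Proof.
rewrite (integral_cst P measurableT c) -[RHS]mule1; congr (_ * _)%E.
exact: probability_setT.
Qed.

Lemma Rintegral_probability_cst (P : probability T R) (c : R) :
  \int[P]__ c = c.
Proof. by rewrite /Rintegral (integral_probability_cst P c%:E). Qed.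

End integral_complements.

Section iid_law.
Context d (T : measurableType d) (R : realType).
Implicit Types (mu : probability T R).

(** A property of a law rather than a constructed product measure, so that it applies directly to
    the image law of a sample given on an abstract probability space. *)
Definition iid_law mu n (Q : probability (n.-tuple T) R) : Prop :=
  forall A : 'I_n -> set T, (forall j, measurable (A j)) ->
  Q [set x | forall j, A j (tnth x j)] = (\prod_(j < n) mu (A j))%E.

Lemma measurable_tuple_box n (A : 'I_n -> set T) :
  (forall j, measurable (A j)) ->
  measurable [set x : n.-tuple T | forall j, A j (tnth x j)].
Proof.
move=> mA.
rewrite (_ : [set _ | _] =
  \bigcap_(i in [set: 'I_n]) ((fun t : n.-tuple T => tnth t i) @^-1` A i)).
  apply: (@fin_bigcap_measurable _ (n.-tuple T) 'I_n setT) => [|i _].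
    exact: finite_finset.
  by rewrite -[X in measurable X]setTI; exact: measurable_tnth.
by apply/seteqP; split => [t tA i _|t tA i]; exact: tA.
Qed.

Definition tuple_cons n (x : T * n.-tuple T) : n.+1.-tuple T :=
  [tuple of x.1 :: x.2].

Lemma measurable_tuple_cons n : measurable_fun setT (@tuple_cons n).
Proof. exact: (measurable_cons measurable_fst measurable_snd). Qed.

HB.instance Definition _ n := isMeasurableFun.Build _ _ _ _ (@tuple_cons n)
  (@measurable_tuple_cons n).

Definition tuple_tail n (x : n.+1.-tuple T) : n.-tuple T :=
  [tuple of behead x].

Lemma measurable_tuple_tail n : measurable_fun setT (@tuple_tail n).
Proof. exact: measurable_behead. Qed.

HB.instance Definition _ n := isMeasurableFun.Build _ _ _ _ (@tuple_tail n)
  (@measurable_tuple_tail n).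

Definition tail_law n (Q : probability (n.+1.-tuple T) R) :
  probability (n.-tuple T) R := distribution Q (@tuple_tail n).

Lemma tnth_tuple_tail n (x : n.+1.-tuple T) j :
  tnth (@tuple_tail n x) j = tnth x (lift ord0 j).
Proof.
by case/tupleP: x => a y; rewrite tnthS; congr tnth; exact: val_inj.
Qed.

Lemma iid_law_tail mu n (Q : probability (n.+1.-tuple T) R) :
  iid_law mu Q -> iid_law mu (tail_law Q).
Proof.
move=> QL A mA; rewrite /tail_law /= /distribution /pushforward.
pose B (j : 'I_n.+1) := if unlift ord0 j is Some i then A i else setT.
have mB j : measurable (B j) by rewrite /B; case: unliftP.
have := QL B mB; rewrite big_ord_recl {2}/B unlift_none probability_setT mul1e.
under [in RHS]eq_bigr do rewrite /B liftK.
move=> <-; congr (Q _); apply/seteqP; split => x /= h j.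
  rewrite /B; case: unliftP => // i ->.
  by have := h i; rewrite tnth_tuple_tail.
by rewrite tnth_tuple_tail; have := h (lift ord0 j); rewrite /B liftK.
Qed.

(** Boxes form a pi-system that generates the sigma-algebra of tuples, so [Q] is the image of the
    product of [mu] with the tail law, and Tonelli's theorem applies. All later uses of independence
    are inductions on [n] through this lemma. *)
Lemma iid_law_split mu n (Q : probability (n.+1.-tuple T) R)
    (F : n.+1.-tuple T -> \bar R) :
  iid_law mu Q -> measurable_fun [set: n.+1.-tuple T] F -> (forall x, 0 <= F x)%E ->
  (\int[Q]_x F x =
   \int[tail_law Q]_y \int[mu]_x F (tuple_cons (x, y)))%E.
Proof.
move=> QL mF F0.
pose m' : probability (n.+1.-tuple T) R :=
  distribution (mu \x tail_law Q)%E (@tuple_cons n).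
have Qm' A : measurable A -> A `<=` setT -> Q A = m' A.
  move=> mA _.
  pose G := [set [set x : n.+1.-tuple T | forall j, B j (tnth x j)] |
    B in [set B : 'I_n.+1 -> set T | forall j, measurable (B j)]].
  apply: (measure_unique G (fun=> setT)) mA => //.
  (* The sigma-algebra of tuples is generated by coordinate preimages, each of which is a box with a
     single nontrivial side. *)
  - apply/seteqP; split.
      rewrite -[X in X `<=` _]/(g_sigma_preimage
        (fun i (x : n.+1.-tuple T) => tnth x i)) /g_sigma_preimage.
      apply: smallest_sub; first exact: smallest_sigma_algebra.
      rewrite -bigcup_seq => _ [/= i _ [B mB <-]]; apply: sub_sigma_algebra.
      rewrite setTI; exists (fun j => if j == i then B else setT) => //=.
        by move=> j; case: ifP.
      apply/seteqP; split => x /=; first by move=> /(_ i); rewrite eqxx.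
      by move=> Bx j; case: eqP => // ->.
    apply: smallest_sub; first exact: sigma_algebra_measurable.
    by move=> _ [B mB <-]; exact: measurable_tuple_box.
  - move=> _ _ [B mB <-] [C mC <-]; exists (fun j => B j `&` C j) => /=.
      by move=> j; exact: measurableI.
    by apply/seteqP; split => x /= => [h|[h1 h2] j]; split => // j; have [] := h j.
  - move=> _; exists (fun=> setT) => //=; exact/seteqP.
  - by rewrite bigcup_const//; exists 0%N.
  - move=> _ [B mB <-]; transitivity (\prod_(j < n.+1) mu (B j))%E; first exact: QL.
    rewrite /m' /= /distribution /pushforward.
    rewrite big_ord_recl -(iid_law_tail QL); last by move=> j; exact: mB.
    rewrite -product_measure1E//; last first.
      by apply: (measurable_tuple_box (A := fun j => B (lift ord0 j))) => j; exact: mB.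
    congr (product_measure1 _ _ _); apply/seteqP; split => [[a y]|[a y]] /=.
      move=> [Ba By] j; case: (unliftP ord0 j) => [i ->|-> //].
      by rewrite tnthS; exact: By.
    move=> h; split; first exact: (h ord0).
    by move=> j; have := h (lift ord0 j); rewrite tnthS.
  - by move=> _; exact: le_lt_trans (probability_le1 Q measurableT) (ltry 1).
rewrite (eq_measure_integral m')// ge0_integral_pushforward//.
rewrite preimage_setT (fubini_tonelli2 (F \o @tuple_cons n))//.
  by apply: measurableT_comp => //; exact: measurable_tuple_cons.
by move=> x; exact: F0.
Qed.

Lemma iid_law_prod mu n (Q : probability (n.-tuple T) R) (g : 'I_n -> T -> R) :
  iid_law mu Q -> (forall j, measurable_fun setT (g j)) ->
  (forall j x, 0 <= g j x) ->
  (\int[Q]_x (\prod_(j < n) g j (tnth x j))%:E =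
   \prod_(j < n) \int[mu]_x (g j x)%:E)%E.
Proof.
elim: n Q g => [|n IH] Q g QL mg g0.
  under eq_integral do rewrite big_ord0.
  by rewrite big_ord0 integral_probability_cst.
have mprod k (h : 'I_k -> T -> R) : (forall j, measurable_fun setT (h j)) ->
    measurable_fun setT (fun x : k.-tuple T => \prod_(j < k) h j (tnth x j)).
  move=> mh; apply: measurable_prod => j _; apply: measurableT_comp => //.
  exact: measurable_tnth.
rewrite (iid_law_split QL); last 2 first.
- by apply/measurable_EFinP; exact: mprod.
- by move=> x; rewrite lee_fin prodr_ge0.
transitivity (\int[tail_law Q]_y ((\int[mu]_x (g ord0 x)%:E) *
    (\prod_(j < n) g (lift ord0 j) (tnth y j))%:E))%E.
  apply: eq_integral => y _; rewrite -ge0_integralZr//.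
  - apply: eq_integral => x _; rewrite big_ord_recl EFinM; congr (_ * _%:E)%E.
    by apply: eq_bigr => j _; rewrite tnthS.
  - by apply/measurable_EFinP; exact: mg.
  - by move=> x _; rewrite lee_fin.
  - by rewrite lee_fin prodr_ge0.
rewrite ge0_integralZl//; last 3 first.
- by apply/measurable_EFinP; apply: (mprod n (fun j => g (lift ord0 j))).
- by move=> y _; rewrite lee_fin prodr_ge0.
- by apply: integral_ge0 => x _; rewrite lee_fin.
by rewrite big_ord_recl (IH _ (fun j => g (lift ord0 j)))//; exact: iid_law_tail.
Qed.

Lemma iid_law_prod1 mu n (Q : probability (n.-tuple T) R) (g : T -> R) :
  iid_law mu Q -> measurable_fun setT g -> (forall x, 0 <= g x) ->
  (\int[Q]_x (\prod_(j < n) g (tnth x j))%:E = (\int[mu]_x (g x)%:E) ^+ n)%E.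
Proof.
move=> QL mg g0; rewrite (iid_law_prod (g := fun=> g) QL)//.
by elim: n {Q QL} => [|n IH]; rewrite ?big_ord0// big_ord_recl IH expeS.
Qed.

End iid_law.

Section mgf.
Context d (T : measurableType d) (R : realType).
Implicit Types (P : probability T R).

Lemma probability_lty P : (P setT < +oo)%E.
Proof. exact: le_lt_trans (probability_le1 P measurableT) (ltry 1). Qed.

Lemma mgf_le P (X : T -> R) (M : R) : measurable_fun setT X ->
  (forall x, `|X x| <= M) -> (forall x, X x <= 1 / 2) ->
  (\int[P]_x (expR (X x))%:E <=
   (expR (\int[P]_x X x + 2 * \int[P]_x (X x ^+ 2)))%:E)%E.
Proof.
move=> mX XM X2.
have mX2 : measurable_fun setT (fun x => X x ^+ 2) by exact: measurable_funX.
have X2M x : `|X x ^+ 2| <= M ^+ 2.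
  by rewrite normrX lerXn2r ?nnegrE// (le_trans (normr_ge0 (X x))).
have iX := bounded_integrable (probability_lty P) mX XM.
have iX2 := bounded_integrable (probability_lty P) mX2 X2M.
apply: (@le_trans _ _ (\int[P]_x (1 + (X x)%:E + 2%:E * (X x ^+ 2)%:E)))%E.
  apply: ge0_le_integral_nonmeasurable => x _; first by rewrite lee_fin expR_ge0.
  by rewrite -EFinM -!EFinD lee_fin; exact: expR_le_quad.
rewrite integralD//=; last 2 first.
- by apply: integrableD => //; exact: finite_measure_integrable_cst.
- exact: integrableZl.
rewrite integralD//=; last exact: finite_measure_integrable_cst.
rewrite integral_probability_cst integralZl//.
rewrite -(EFin_Rintegral (probability_lty P) mX XM).
rewrite -(EFin_Rintegral (probability_lty P) mX2 X2M).
rewrite -EFinM -!EFinD lee_fin -addrA; exact: expR_ge1Dx.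
Qed.

(** Hoeffding's lemma with the cruder constant [2]. Since [X x - m] is the average of [X x - X y]
    over [y], it is at most [D] in modulus; [expR_le_id] is then integrated for the centred
    variable. *)
Lemma mgf_oscillation P (X : T -> R) (M D lam : R) : measurable_fun setT X ->
  (forall x, `|X x| <= M) -> (forall x y, `|X x - X y| <= D) ->
  (\int[P]_x (expR (lam * X x))%:E <=
   (expR (lam * \int[P]_x X x + 2 * (lam * D) ^+ 2))%:E)%E.
Proof.
move=> mX XM XD.
have iX := bounded_integrable (probability_lty P) mX XM.
set m := \int[P]_x X x.
have Xm x : `|X x - m| <= D.
  have -> : X x - m = \int[P]_y (X x - X y).
    rewrite RintegralB//; last exact: finite_measure_integrable_cst.
    by rewrite Rintegral_probability_cst.
  have mXx : measurable_fun setT (fun y => X x - X y) by exact: measurable_funB.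
  have iXx := bounded_integrable (probability_lty P) mXx (XD x).
  apply: (le_trans (le_normr_Rintegral _ iXx)) => //.
  apply: (@le_trans _ _ (\int[P]_y D)).
    apply: le_Rintegral => //; last exact: finite_measure_integrable_cst.
    exact: (integrable_norm iXx).
  by rewrite Rintegral_probability_cst.
apply: (@le_trans _ _ (\int[P]_x ((expR (lam * m))%:E *
    ((- (lam * m) + expR (2 * (lam * D) ^+ 2))%:E + lam%:E * (X x)%:E))))%E.
  apply: ge0_le_integral_nonmeasurable => x _; first by rewrite lee_fin expR_ge0.
  rewrite -[(lam%:E * _)%E]EFinM -EFinD -EFinM lee_fin.
  have -> : lam * X x = lam * m + lam * (X x - m) by ring.
  rewrite expRD ler_wpM2l ?expR_ge0//; apply: (le_trans (expR_le_id _)).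
  rewrite [leLHS](_ : _ = - (lam * m) + expR (2 * (lam * (X x - m)) ^+ 2) + lam * X x); last by ring.
  rewrite [X in _ <= _ + X](_ : _ = lam * X x); last by ring.
  rewrite lerD2r lerD2l ler_expR ler_pM2l// !exprMn ler_wpM2l ?sqr_ge0//.
  by rewrite -real_normK ?num_real// lerXn2r ?nnegrE// (le_trans _ (Xm x)).
rewrite integralZl//; last first.
  by apply: integrableD => //; [exact: finite_measure_integrable_cst|exact: integrableZl].
rewrite integralD//; [|exact: finite_measure_integrable_cst|exact: integrableZl].
rewrite integral_probability_cst integralZl//.
rewrite -(EFin_Rintegral (probability_lty P) mX XM) -/m -[(lam%:E * _)%E]EFinM -EFinD -EFinM.
by rewrite lee_fin expRD ler_wpM2l ?expR_ge0// addrAC addNr add0r.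
Qed.

End mgf.

Section mcdiarmid.
Context d (T : measurableType d) (R : realType).
Implicit Types (mu : probability T R).

Lemma measurable_tuple_cons_l n (y : n.-tuple T) :
  measurable_fun setT (fun x => tuple_cons (x, y)).
Proof.
by apply: (measurableT_comp (@measurable_tuple_cons _ T n)); exact: measurable_pair2.
Qed.

Lemma measurable_integral_head mu n (F : n.+1.-tuple T -> R) :
  measurable_fun [set: n.+1.-tuple T] F -> (forall x, 0 <= F x) ->
  measurable_fun [set: n.-tuple T] (fun y => \int[mu]_x F (tuple_cons (x, y))).
Proof.
move=> mF F0; apply: (measurableT_comp (fine_measurable measurableT)) => //.
apply: (measurable_fun_fubini_tonelli_G (m1 := mu)
  (fun z => (F (tuple_cons z))%:E)) => //.
  apply/measurable_EFinP; exact: measurableT_comp.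
by move=> z; rewrite lee_fin.
Qed.

Lemma Rintegral_iid_law_split mu n (Q : probability (n.+1.-tuple T) R)
    (F : n.+1.-tuple T -> R) (M : R) :
  iid_law mu Q -> measurable_fun [set: n.+1.-tuple T] F ->
  (forall x, 0 <= F x <= M) ->
  \int[Q]_x F x = \int[tail_law Q]_y \int[mu]_x F (tuple_cons (x, y)).
Proof.
move=> QL mF FM.
have F0 x : 0 <= F x by have /andP[] := FM x.
have FM' x : `|F x| <= M by rewrite ger0_norm//; have /andP[] := FM x.
rewrite /Rintegral; congr fine.
rewrite (iid_law_split QL) => [||x]; [|exact/measurable_EFinP|by rewrite lee_fin].
apply: eq_integral => y _.
rewrite -/(Rintegral _ _ _) (EFin_Rintegral (probability_lty mu) _ (M := M))//.
by apply: measurableT_comp => //; exact: measurable_tuple_cons_l.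
Qed.

Definition bounded_difference n (F : n.-tuple T -> R) (D : R) :=
  forall (x y : n.-tuple T) (i : 'I_n),
  (forall j, j != i -> tnth x j = tnth y j) -> `|F x - F y| <= D.

(** Induction replaces the martingale argument. For a fixed tail, [F] oscillates by at most [D] in
    its first coordinate, so integrating that coordinate out costs one factor [exp (2 (lam D)^2)];
    the partial mean keeps both the range and the difference constant of [F]. *)
Lemma mcdiarmid_mgf mu n (Q : probability (n.-tuple T) R)
    (F : n.-tuple T -> R) (M D lam : R) :
  iid_law mu Q -> measurable_fun [set: n.-tuple T] F ->
  (forall x, 0 <= F x <= M) -> bounded_difference F D ->
  (\int[Q]_x (expR (lam * F x))%:E <=
   (expR (lam * \int[Q]_x F x + n%:R * (2 * (lam * D) ^+ 2)))%:E)%E.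
Proof.
elim: n Q F => [|n IH] Q F QL mF FM FD.
  have -> : F = fun=> F [tuple] by apply/funext => x; rewrite tuple0.
  by rewrite Rintegral_probability_cst integral_probability_cst mul0r addr0.
have F0 x : 0 <= F x by have /andP[] := FM x.
have FM' x : `|F x| <= M by rewrite ger0_norm//; have /andP[] := FM x.
have mFl y : measurable_fun setT (fun x => F (tuple_cons (x, y))).
  by apply: measurableT_comp => //; exact: measurable_tuple_cons_l.
pose g (y : n.-tuple T) := \int[mu]_x F (tuple_cons (x, y)).
have ig y := bounded_integrable (probability_lty mu) (mFl y) (fun x => FM' _).
have mg : measurable_fun [set: n.-tuple T] g by exact: measurable_integral_head.
have g0M y : 0 <= g y <= M.
  apply/andP; split; first exact: Rintegral_ge0.
  rewrite -[leRHS](Rintegral_probability_cst mu).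
  apply: le_Rintegral => //; first exact: finite_measure_integrable_cst.
  by move=> x _; have /andP[] := FM (tuple_cons (x, y)).
have gD : bounded_difference g D.
  move=> y z i yz; rewrite /g -RintegralB//.
  have mB : measurable_fun setT
      (fun x => F (tuple_cons (x, y)) - F (tuple_cons (x, z))).
    exact: measurable_funB.
  have BD x : `|F (tuple_cons (x, y)) - F (tuple_cons (x, z))| <= D.
    apply: (FD _ _ (lift ord0 i)) => j.
    by case: (unliftP ord0 j) => [k ->|-> //]; rewrite !tnthS => ki; apply: yz;
      apply: contra ki => /eqP ->.
  have iB := bounded_integrable (probability_lty mu) mB BD.
  apply: (le_trans (le_normr_Rintegral _ iB)) => //.
  rewrite -[leRHS](Rintegral_probability_cst mu).
  apply: le_Rintegral => //; last exact: finite_measure_integrable_cst.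
  exact: (integrable_norm iB).
have mexpF : measurable_fun [set: n.+1.-tuple T] (fun x => expR (lam * F x)).
  by apply: measurableT_comp => //; exact: measurable_funM.
rewrite (iid_law_split QL) => [||x]; [|exact/measurable_EFinP|by rewrite lee_fin expR_ge0].
apply: (@le_trans _ _ (\int[tail_law Q]_y
    ((expR (2 * (lam * D) ^+ 2))%:E * (expR (lam * g y))%:E)))%E.
  apply: ge0_le_integral_nonmeasurable => y _.
    by apply: integral_ge0 => x _; rewrite lee_fin expR_ge0.
  rewrite -EFinM -expRD addrC.
  have FMy x : `|F (tuple_cons (x, y))| <= M by exact: FM'.
  apply: (@mgf_oscillation _ _ _ mu _ M D lam (mFl y) FMy) => x x'.
  apply: (FD _ _ ord0) => j; case: (unliftP ord0 j) => [k -> _|->]; last by rewrite eqxx.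
  by rewrite !tnthS.
rewrite ge0_integralZl//; last first.
  by apply/measurable_EFinP; apply: measurableT_comp => //; exact: measurable_funM.
rewrite (Rintegral_iid_law_split QL mF FM).
apply: (@le_trans _ _ ((expR (2 * (lam * D) ^+ 2))%:E *
    (expR (lam * \int[tail_law Q]_x g x + n%:R * (2 * (lam * D) ^+ 2)))%:E))%E.
  by apply: lee_wpmul2l; rewrite ?lee_fin ?expR_ge0//; apply: IH => //; exact: iid_law_tail.
by rewrite -EFinM lee_fin -expRD ler_expR -natr1; lra.
Qed.

Lemma iid_second_moment mu n (Q : probability (n.-tuple T) R)
    (Y : T -> R) (M : R) :
  iid_law mu Q -> measurable_fun setT Y -> (forall x, `|Y x| <= M) ->
  \int[mu]_x Y x = 0 ->
  (\int[Q]_x ((\sum_(j < n) Y (tnth x j)) ^+ 2)%:E =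
   n%:R%:E * \int[mu]_x (Y x ^+ 2)%:E)%E.
Proof.
move=> + mY YM Y0.
have mY2 : measurable_fun setT (fun x => Y x ^+ 2) by exact: measurable_funX.
have Y2M x : `|Y x ^+ 2| <= M ^+ 2.
  by rewrite normrX lerXn2r ?nnegrE// (le_trans (normr_ge0 (Y x))).
have iY := bounded_integrable (probability_lty mu) mY YM.
have iY2 := bounded_integrable (probability_lty mu) mY2 Y2M.
have EY2 := EFin_Rintegral (probability_lty mu) mY2 Y2M.
have msum k : measurable_fun [set: k.-tuple T] (fun x => \sum_(j < k) Y (tnth x j)).
  apply: measurable_sum => j; apply: measurableT_comp => //.
  exact: measurable_tnth.
elim: n Q => [|n IH] Q QL.
  under eq_integral do rewrite big_ord0 expr0n.
  by rewrite integral_probability_cst mul0e.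
rewrite (iid_law_split QL); last 2 first.
- by apply/measurable_EFinP; exact: (measurable_funX 2 (msum n.+1)).
- by move=> x; rewrite lee_fin sqr_ge0.
transitivity (\int[tail_law Q]_y ((\int[mu]_x (Y x ^+ 2))%:E +
    ((\sum_(j < n) Y (tnth y j)) ^+ 2)%:E))%E.
  apply: eq_integral => y _; set s := \sum_(j < n) _.
  transitivity (\int[mu]_x ((Y x ^+ 2)%:E + (2 * s)%:E * (Y x)%:E + (s ^+ 2)%:E))%E.
    apply: eq_integral => x _; rewrite big_ord_recl /=.
    rewrite [X in (Y _ + X)%R](_ : _ = s); last by apply: eq_bigr => j _; rewrite tnthS.
    by rewrite -EFinM -!EFinD; congr EFin; rewrite (_ : tnth _ ord0 = x)//; ring.
  rewrite integralD//=; last 2 first.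
  - by apply: integrableD => //; exact: integrableZl.
  - exact: finite_measure_integrable_cst.
  rewrite integralD//=; last exact: integrableZl.
  rewrite integral_probability_cst integralZl//.
  rewrite -(EFin_Rintegral (probability_lty mu) mY YM) Y0 mule0 adde0.
  by rewrite -EY2.
rewrite ge0_integralD//=; last 3 first.
- by move=> x _; rewrite lee_fin; apply: Rintegral_ge0 => ? _; exact: sqr_ge0.
- by move=> x _; rewrite lee_fin sqr_ge0.
- by apply/measurable_EFinP; exact: (measurable_funX 2 (msum n)).
rewrite integral_probability_cst (IH _ (iid_law_tail QL)) EY2.
by rewrite -natr1 EFinD muleDl// ?mul1e 1?addeC//; rewrite -EY2.
Qed.

End mcdiarmid.

(** * Concentration of integrals of powers *)

Section ler_powRl.
Context {R : realType}.

Lemma ler_powRl (s x y : R) : 0 <= s -> 0 <= x -> x <= y -> x `^ s <= y `^ s.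
Proof.
move=> s0 x0 xy; apply: ge0_ler_powR => //; rewrite nnegrE//.
exact: le_trans xy.
Qed.

End ler_powRl.

Section fubini_bounded.
Context d1 d2 (S : measurableType d1) (T : measurableType d2) (R : realType).
Variables (nu : probability S R) (Q : probability T R).
Variables (u : S * T -> R) (M : R).
Hypothesis mu : measurable_fun setT u.
Hypothesis uM : forall z, 0 <= u z <= M.

Let u0 z : 0 <= u z. Proof. by have /andP[] := uM z. Qed.
Let nuM z : `|u z| <= M. Proof. by rewrite ger0_norm//; have /andP[] := uM z. Qed.

Lemma measurable_section_l x : measurable_fun setT (fun t => u (t, x)).
Proof. by apply: measurableT_comp => //; exact: measurable_pair2. Qed.

Lemma measurable_section_r t : measurable_fun setT (fun x => u (t, x)).
Proof. by apply: measurableT_comp => //; exact: measurable_pair1. Qed.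

Lemma EFin_Rintegral_l x :
  ((\int[nu]_t u (t, x))%:E = \int[nu]_t (u (t, x))%:E)%E.
Proof.
by apply: (EFin_Rintegral (probability_lty nu) (measurable_section_l x) (M := M)).
Qed.

Lemma measurable_Rintegral_l : measurable_fun setT (fun x => \int[nu]_t u (t, x)).
Proof.
apply: (measurableT_comp (fine_measurable measurableT)) => //.
apply: (measurable_fun_fubini_tonelli_G (m1 := nu) (EFin \o u)) => //.
exact/measurable_EFinP.
Qed.

Lemma Rintegral_l_itv x : 0 <= \int[nu]_t u (t, x) <= M.
Proof.
apply/andP; split; first exact: Rintegral_ge0.
rewrite -[leRHS](Rintegral_probability_cst nu).
apply: le_Rintegral => //; last by move=> t _; have /andP[] := uM (t, x).
  exact: (bounded_integrable (probability_lty nu) (measurable_section_l x) (M := M)).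
exact: finite_measure_integrable_cst.
Qed.

Lemma Rintegral_fubini_E :
  ((\int[Q]_x \int[nu]_t u (t, x))%:E = \int[nu]_t \int[Q]_x (u (t, x))%:E)%E.
Proof.
rewrite (EFin_Rintegral (probability_lty Q) measurable_Rintegral_l (M := M)); last first.
  move=> x; have /andP[h1 h2] := Rintegral_l_itv x; by rewrite ger0_norm.
under eq_integral do rewrite EFin_Rintegral_l.
apply/esym; apply: (fubini_tonelli (m1 := nu) (m2 := Q) (EFin \o u)) => //.
exact/measurable_EFinP.
Qed.

End fubini_bounded.

Section chernoff.
Context d (T : measurableType d) (R : realType) (P : probability T R).

Lemma markov_ge (Y : T -> R) (a : R) : 0 < a -> measurable_fun setT Y ->
  (forall x, 0 <= Y x) ->
  (P [set x | (a <= Y x)%R] <= (a^-1)%:E * \int[P]_x (Y x)%:E)%E.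
Proof.
move=> a0 mY Y0.
have := @le_integral_abse _ _ _ P setT measurableT (EFin \o Y) a.
move=> /(_ ((measurable_EFinP setT Y).2 mY) a0) h.
rewrite lee_pdivlMl//; apply: (le_trans _ (le_trans h _)).
  rewrite lee_wpmul2l ?lee_fin ?(ltW a0)// setTI.
  by rewrite (_ : [set x | (a <= Y x)%R] = [set x | (a%:E <= `|(EFin \o Y) x|)%E])//;
    apply/seteqP; split => x /=; rewrite lee_fin ger0_norm.
by rewrite (eq_integral (EFin \o Y))// => x _ /=; rewrite ger0_norm.
Qed.

Lemma measurable_ge (Y : T -> R) (a : R) : measurable_fun setT Y ->
  measurable [set x | a <= Y x].
Proof.
move=> mY; rewrite (_ : [set _ | _] = Y @^-1` `[a, +oo[%classic).
  by rewrite -[X in measurable X]setTI; exact: mY.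
by apply/seteqP; split => x /=; rewrite in_itv/= andbT.
Qed.

End chernoff.

Section concentration.
Context {R : realType}.

Definition trunc_powR (A s v : R) : R := Num.min v A `^ s.

Lemma trunc_powR_lipschitz (A s v w : R) : 1 <= s -> 0 <= A ->
  0 <= v -> 0 <= w ->
  `|trunc_powR A s v - trunc_powR A s w| <= s * A `^ (s - 1) * `|v - w|.
Proof.
move=> s1 A0.
wlog : v w / w <= v => [H v0 w0|wv v0 w0].
  have [wv|vw] := leP w v; first exact: H.
  by rewrite distrC [in leRHS]distrC; apply: H => //; exact: ltW.
have m0 z : 0 <= z -> 0 <= Num.min z A by move=> z0; rewrite le_min z0.
have mwv : Num.min w A <= Num.min v A.
  by rewrite le_min !ge_min wv lexx !orbT.
have s0 : 0 <= s by lra.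
rewrite /trunc_powR ger0_norm; last first.
  by rewrite subr_ge0; apply: ge0_ler_powR => //; rewrite nnegrE m0.
apply: (le_trans (powR_lipschitz s1 (m0 _ w0) mwv)).
rewrite ger0_norm ?subr_ge0// ler_pM ?mulr_ge0 ?powR_ge0 ?subr_ge0//.
  rewrite ler_wpM2l//; apply: ge0_ler_powR; rewrite ?subr_ge0// ?nnegrE ?m0//.
  by rewrite ge_min lexx orbT.
rewrite lerBlDr.
have [wA|Aw] := leP w A; last first.
  have : Num.min v A <= A by rewrite ge_min lexx orbT.
  by move: wv => /[swap]; lra.
have : Num.min v A <= v by rewrite ge_min lexx.
lra.
Qed.

(** Above the level [A], [powR_le_expR] with parameter [1/2] bounds [v^s] by [(2 s)^s exp (v / 2)],
    and [v / 2 <= v - A / 2] there. *)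
Lemma trunc_powR_rest (A s v : R) : 1 <= s -> 0 <= A -> 0 <= v ->
  0 <= v `^ s - trunc_powR A s v <=
    (2 * s) `^ s * (expR v * expR (- (A / 2))).
Proof.
move=> s1 A0 v0; have s0 : 0 < s by lra.
have c0 : 0 <= (2 * s) `^ s * (expR v * expR (- (A / 2))).
  by rewrite mulr_ge0 ?powR_ge0// mulr_ge0 ?expR_ge0.
rewrite /trunc_powR; have [vA|Av] := leP v A; first by rewrite subrr lexx.
apply/andP; split.
  by rewrite subr_ge0 ge0_ler_powR// ?nnegrE// ltW.
apply: (@le_trans _ _ (v `^ s)); first by rewrite gerBl powR_ge0.
have h2 : 0 < 1 / 2 :> R by lra.
have := powR_le_expR s0 h2 v0; move=> /le_trans; apply.
rewrite [s / _](_ : _ = 2 * s); last by field.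
rewrite ler_wpM2l ?powR_ge0// -expRD ler_expR; lra.
Qed.

(* [x |-> \int[nu]_t u (t, x) ^ s] is split at the level [u = 2 b ln n]: the
   truncated part has bounded differences, so McDiarmid's inequality applies,
   and the rest is controlled through Markov's inequality by the exponential
   moment. The last hypothesis makes [n D ^ 2] smaller than any power of
   [(ln n)^-1], which absorbs the Lipschitz constant of the truncated power. *)
Lemma local_concentration (s delta b C0 : R) :
  1 <= s -> 0 < delta -> 0 < b -> 0 < C0 ->
  exists2 C : R, 0 < C &
  forall (n : nat), (2 <= n)%N ->
  forall d1 d2 (S : measurableType d1) (T : measurableType d2)
    (nu : probability S R) (mu : probability T R)
    (Q : probability (n.-tuple T) R) (u : S * n.-tuple T -> R) (M D : R),
  iid_law mu Q -> measurable_fun setT u -> (forall z, 0 <= u z <= M) ->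
  (forall t, (\int[Q]_x (expR (u (t, x)))%:E <= C0%:E)%E) ->
  (forall (x y : n.-tuple T) (i : 'I_n),
    (forall j, j != i -> tnth x j = tnth y j) ->
    \int[nu]_t `|u (t, x) - u (t, y)| <= D) ->
  n%:R * D ^+ 2 <= C0 * expR (- Num.sqrt (ln n%:R)) ->
  exists Bad : set (n.-tuple T),
    [/\ measurable Bad, (Q Bad <= (C * expR (- b * ln n%:R))%:E)%E &
      forall x, ~ Bad x ->
        `|\int[nu]_t (u (t, x) `^ s) -
          \int[Q]_y \int[nu]_t (u (t, y) `^ s)| <= delta].
Proof.
move=> s1 delta0 b0 C00.
have s0 : 0 < s by lra.
have [C4 C40 hC4] := @powR_expRN_bounded R (4 * s) ltac:(lra).
(* [C2] bounds McDiarmid's exponent [n * 2 (lam DF)^2], and [C3] the mean of the part above the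
   truncation up to [n^(-b)]. The witness adds four events: both tails of the truncated part, and
   two events for the rest, one for its value and one for its mean. *)
pose C2 := 9 / 2 * s ^+ 2 / delta ^+ 2 * (C0 * (2 * b) `^ (2 * s) * C4).
pose C3 := (2 * s) `^ s * C0.
exists (2 * expR C2 + 6 / delta * C3).
  by rewrite ltr_wpDr ?mulr_gt0 ?expR_gt0// !mulr_ge0 ?invr_ge0 ?powR_ge0 ?ltW.
move=> n n2 d1 d2 S T nu mu Q u M D QL mu' uM umgf uD nD.
have u0 z : 0 <= u z by have /andP[] := uM z.
have [x0 _] : exists x : n.-tuple T, True.
  apply: contrapT => /forallNP h.
  have : Q setT = 0%E.
    by rewrite (_ : setT = set0) ?measure0//; apply/seteqP; split => // x _; apply: (h x).
  by move/eqP; rewrite (probability_setT Q) onee_eq0.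
have [t0 _] : exists t : S, True.
  apply: contrapT => /forallNP h.
  have : nu setT = 0%E.
    by rewrite (_ : setT = set0) ?measure0//; apply/seteqP; split => // x _; apply: (h x).
  by move/eqP; rewrite (probability_setT nu) onee_eq0.
have M0 : 0 <= M by have /andP[] := uM (t0, x0); exact: le_trans.
pose L : R := ln n%:R.
have L0 : 0 < L by rewrite ln_gt0// ltr1n.
(* At this level [exp (- A / 2) = n^(-b)]. *)
pose A := 2 * b * L.
have A0 : 0 < A by rewrite /A !mulr_gt0.
pose phi := trunc_powR A s.
have mpowR : measurable_fun setT (fun v : R => v `^ s) by exact: measurable_powR.
have mphi : measurable_fun setT phi.
  apply: (measurableT_comp mpowR).
  by apply: measurable_minr => //; exact: measurable_cst.
pose uf z := phi (u z).
have muf : measurable_fun setT uf by exact: measurableT_comp.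
pose ug z := u z `^ s - uf z.
have mus : measurable_fun setT (fun z => u z `^ s).
  exact: (measurableT_comp mpowR).
have mug : measurable_fun setT ug by exact: measurable_funB.
have usM z : 0 <= u z `^ s <= M `^ s.
  by rewrite powR_ge0/= ler_powRl ?(ltW s0)//; have /andP[] := uM z.
have ufM z : 0 <= uf z <= A `^ s.
  by rewrite powR_ge0/= ler_powRl ?(ltW s0) ?ge_min ?lexx ?orbT// le_min u0 ltW.
have ugR z := trunc_powR_rest s1 (ltW A0) (u0 z).
have ugM z : 0 <= ug z <= M `^ s.
  have /andP[h1 _] := ugR z; rewrite h1/=.
  have /andP[_ h2] := usM z; have /andP[h3 _] := ufM z.
  by rewrite /ug; lra.
pose F x := \int[nu]_t uf (t, x).
pose G x := \int[nu]_t ug (t, x).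
have mF : measurable_fun setT F := measurable_Rintegral_l nu muf ufM.
have mG : measurable_fun setT G := measurable_Rintegral_l nu mug ugM.
have FM x : 0 <= F x <= A `^ s := Rintegral_l_itv nu muf ufM x.
have GM x : 0 <= G x <= M `^ s := Rintegral_l_itv nu mug ugM x.
have IE x : \int[nu]_t (u (t, x) `^ s) = F x + G x.
  rewrite /F /G -RintegralD//.
  - by apply: eq_Rintegral => t _; rewrite /ug addrC subrK.
  - apply: (bounded_integrable (probability_lty nu) (M := A `^ s)).
      exact: measurable_section_l.
    by move=> t; rewrite ger0_norm; have /andP[] := ufM (t, x).
  - apply: (bounded_integrable (probability_lty nu) (M := M `^ s)).
      exact: measurable_section_l.
    by move=> t; rewrite ger0_norm; have /andP[] := ugM (t, x).
have iF : Q.-integrable setT (EFin \o F).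
  apply: (bounded_integrable (probability_lty Q) mF (M := A `^ s)).
  by move=> t; rewrite ger0_norm; have /andP[] := FM t.
have iG : Q.-integrable setT (EFin \o G).
  apply: (bounded_integrable (probability_lty Q) mG (M := M `^ s)).
  by move=> t; rewrite ger0_norm; have /andP[] := GM t.
set EF := \int[Q]_y F y; set EG := \int[Q]_y G y.
have EIE : \int[Q]_y \int[nu]_t (u (t, y) `^ s) = EF + EG.
  by rewrite -RintegralD//; apply: eq_Rintegral => y _; exact: IE.
have EG_le : EG <= C3 * expR (- b * L).
  rewrite -lee_fin (Rintegral_fubini_E nu Q mug ugM).
  rewrite -[leRHS](integral_probability_cst nu).
  apply: ge0_le_integral_nonmeasurable => t _.
    by apply: integral_ge0 => x _; rewrite lee_fin; have /andP[] := ugM (t, x).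
  apply: (@le_trans _ _ (\int[Q]_x
      (((2 * s) `^ s * expR (- (A / 2)))%:E * (expR (u (t, x)))%:E)))%E.
    apply: ge0_le_integral_nonmeasurable => x _.
      by rewrite lee_fin; have /andP[] := ugM (t, x).
    rewrite -EFinM lee_fin -mulrA [X in _ * X]mulrC.
    by have /andP[] := ugR (t, x).
  rewrite ge0_integralZl//; last 2 first.
  - apply/measurable_EFinP; apply: measurableT_comp => //.
    exact: measurable_section_r.
  - by rewrite lee_fin mulr_ge0 ?powR_ge0 ?expR_ge0.
  apply: (le_trans (lee_wpmul2l _ (umgf t))).
    by rewrite lee_fin mulr_ge0 ?powR_ge0 ?expR_ge0.
  rewrite -EFinM lee_fin /C3 [A / 2](_ : _ = b * L); last by rewrite /A; field.
  by rewrite mulNr mulrAC.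
pose DF := s * A `^ (s - 1) * D.
have FD : bounded_difference F DF.
  move=> x y i xy; rewrite /F.
  have iuf z : nu.-integrable setT (EFin \o (fun t => uf (t, z))).
    apply: (bounded_integrable (probability_lty nu) (M := A `^ s)).
      exact: measurable_section_l.
    by move=> t; rewrite ger0_norm; have /andP[] := ufM (t, z).
  have iu z : nu.-integrable setT (EFin \o (fun t => u (t, z))).
    apply: (bounded_integrable (probability_lty nu) (M := M)).
      exact: measurable_section_l.
    by move=> t; rewrite ger0_norm; have /andP[] := uM (t, z).
  rewrite -RintegralB//.
  have iB : nu.-integrable setT (EFin \o (fun t => uf (t, x) - uf (t, y))).
    by rewrite (_ : _ \o _ = ((EFin \o (fun t => uf (t, x))) \-
      (EFin \o (fun t => uf (t, y))))%E)//; exact: integrableB.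
  have iBu : nu.-integrable setT (EFin \o (fun t => `|u (t, x) - u (t, y)|)).
    apply: (@integrable_norm _ _ _ nu setT (fun t => u (t, x) - u (t, y))).
    by rewrite (_ : _ \o _ = ((EFin \o (fun t => u (t, x))) \-
      (EFin \o (fun t => u (t, y))))%E)//; exact: integrableB.
  apply: (le_trans (le_normr_Rintegral measurableT iB)).
  apply: (@le_trans _ _ (\int[nu]_t (s * A `^ (s - 1) * `|u (t, x) - u (t, y)|))).
    apply: le_Rintegral => //.
    - exact: (integrable_norm iB).
    - exact: (integrableZl measurableT (s * A `^ (s - 1)) iBu).
    - by move=> t _; exact: trunc_powR_lipschitz (ltW A0) _ _.
  rewrite RintegralZl//.
  by apply: ler_wpM2l; [rewrite mulr_ge0 ?powR_ge0 ?(ltW s0)|exact: uD xy].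
(* Chernoff's exponent [lam * (delta / 3)] then equals [b ln n]. *)
pose lam := 3 * b * L / delta.
have lamDF : n%:R * (2 * (lam * DF) ^+ 2) <= C2.
  (* In terms of [y = sqrt (ln n)] the squared Lipschitz factor is of order [y^(4 s)], while the
     hypothesis on [n D^2] supplies [exp (- y)]. *)
  pose y := Num.sqrt L.
  have y0 : 0 <= y by rewrite sqrtr_ge0.
  have yL : y ^+ 2 = L by rewrite sqr_sqrtr// ltW.
  have -> : n%:R * (2 * (lam * DF) ^+ 2) = 9 / 2 * s ^+ 2 / delta ^+ 2 *
      ((A * A `^ (s - 1)) ^+ 2 * (n%:R * D ^+ 2)).
    by rewrite /lam /DF /A; field; rewrite gt_eqF.
  have s'0 : 0 <= 9 / 2 * s ^+ 2 / delta ^+ 2.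
    by apply: divr_ge0; rewrite ?sqr_ge0//; apply: mulr_ge0; rewrite ?sqr_ge0//; lra.
  apply: ler_wpM2l => //.
  rewrite mulr_powRB1 ?(ltW A0)//.
  have -> : (A `^ s) ^+ 2 = (2 * b) `^ (2 * s) * y `^ (4 * s).
    rewrite -powR_mulrn ?powR_ge0// -powRrM mulrC.
    have b20 : 0 <= 2 * b by lra.
    rewrite /A -yL powRM ?sqr_ge0//; congr (_ * _).
    rewrite -powR_mulrn// -powRrM; congr (_ `^ _); by rewrite mulrA -natrM.
  apply: (@le_trans _ _ ((2 * b) `^ (2 * s) * y `^ (4 * s) * (C0 * expR (- y)))).
    by apply: ler_wpM2l => //; rewrite mulr_ge0 ?powR_ge0.
  have -> : (2 * b) `^ (2 * s) * y `^ (4 * s) * (C0 * expR (- y)) =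
     C0 * (2 * b) `^ (2 * s) * (y `^ (4 * s) * expR (- y)) by ring.
  by apply: ler_wpM2l; [rewrite mulr_ge0 ?powR_ge0 ?(ltW C00)|exact: hC4].
pose eps := expR (- b * L).
have eps0 : 0 < eps by exact: expR_gt0.
have tailF (sg : R) : `|sg| = 1 ->
    (Q [set x | (expR (lam * (delta / 3)) <= expR (sg * lam * (F x - EF)))%R] <=
      (expR C2 * eps)%:E)%E.
  move=> sg1.
  have mE : measurable_fun setT (fun x => expR (sg * lam * (F x - EF))).
    apply: measurableT_comp => //; apply: measurable_funM => //.
    exact: measurable_funB.
  apply: (le_trans (markov_ge Q (expR_gt0 _) mE (fun=> expR_ge0 _))).
  apply: (@le_trans _ _ ((expR (lam * (delta / 3)))^-1%:E *
     ((expR (- (sg * lam * EF)))%:E * \int[Q]_x (expR (sg * lam * F x))%:E)))%E.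
    apply: lee_wpmul2l; first by rewrite lee_fin invr_ge0 expR_ge0.
    rewrite -ge0_integralZl//; last first.
      apply/measurable_EFinP; apply: measurableT_comp => //.
      exact: measurable_funM.
    rewrite le_eqVlt; apply/orP; left; apply/eqP; apply: eq_integral => x _.
    by rewrite -EFinM -expRD; congr (expR _)%:E; ring.
  have := mcdiarmid_mgf (sg * lam) QL mF FM FD; rewrite -/EF => h.
  have h2 := @lee_wpmul2l _ (expR (- (sg * lam * EF)))%:E _ _ _ h.
  have h3 := @lee_wpmul2l _ ((expR (lam * (delta / 3)))^-1)%:E _ _ _ (h2 _).
  apply: (le_trans (h3 _ _)); rewrite ?lee_fin ?invr_ge0 ?expR_ge0//.
  rewrite /eps -expRN -!expRD ler_expR.
  have -> : lam * (delta / 3) = b * L by rewrite /lam; field; rewrite gt_eqF.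
  have -> : (sg * lam * DF) ^+ 2 = (lam * DF) ^+ 2.
    by rewrite -mulrA exprMn -(real_normK (num_real sg)) sg1 expr1n mul1r.
  move: lamDF; rewrite mulNr; lra.
have delta30 : 0 < delta / 3 by lra.
pose B1 := [set x | (expR (lam * (delta / 3)) <= expR (1 * lam * (F x - EF)))%R].
pose B2 := [set x | (expR (lam * (delta / 3)) <= expR (- 1 * lam * (F x - EF)))%R].
pose B3 := [set x | (delta / 3 <= G x)%R].
(* A deterministic event, all or nothing: if the mean of the rest reaches [delta / 3], then [n^(-b)]
   is not small and the claimed bound already exceeds one. *)
pose B4 : set (n.-tuple T) := if delta / 3 <= EG then setT else set0.
have lam0 : 0 < lam by rewrite /lam divr_gt0// !mulr_gt0.
have mB12 (sg : R) : measurable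
    [set x | (expR (lam * (delta / 3)) <= expR (sg * lam * (F x - EF)))%R].
  apply: measurable_ge; apply: measurableT_comp => //; apply: measurable_funM => //.
  exact: measurable_funB.
have mB3 : measurable B3 by exact: measurable_ge.
have mB4 : measurable B4 by rewrite /B4; case: ifP.
have EG0 : 0 <= EG by apply: Rintegral_ge0 => x _; have /andP[] := GM x.
have QB3 : (Q B3 <= (3 / delta * (C3 * eps))%:E)%E.
  have h := markov_ge Q delta30 mG (fun x => (andP (GM x)).1).
  apply: (le_trans h); rewrite -(EFin_Rintegral (probability_lty Q) mG (M := M `^ s)).
    by rewrite -EFinM lee_fin invf_div ler_wpM2l// divr_ge0// ltW.
  by move=> x; rewrite ger0_norm; have /andP[] := GM x.
have QB4 : (Q B4 <= (3 / delta * (C3 * eps))%:E)%E.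
  rewrite /B4; case: ifPn => [h|_]; last first.
    by rewrite measure0 lee_fin !mulr_ge0 ?invr_ge0 ?powR_ge0 ?(ltW C00) ?(ltW delta0) ?(ltW eps0).
  apply: (le_trans (probability_le1 Q measurableT)); rewrite lee_fin.
  rewrite -(@ler_pM2l _ (delta / 3))// mulr1 mulrA.
  have -> : delta / 3 * (3 / delta) = 1 by field; rewrite gt_eqF.
  by rewrite mul1r (le_trans h).
exists (B1 `|` B2 `|` B3 `|` B4); split.
- by do 3 (apply: measurableU => //); exact: mB12.
- have QU (X Y : set (n.-tuple T)) (x y : R) : measurable X -> measurable Y ->
      (Q X <= x%:E)%E -> (Q Y <= y%:E)%E -> (Q (X `|` Y) <= (x + y)%:E)%E.
    move=> mX mY hX hY; apply: (le_trans (measureU2 _ _ _)) => //.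
    by rewrite EFinD leeD.
  have := QU _ _ _ _ _ _ (QU _ _ _ _ _ _ (QU _ _ _ _ _ _ (tailF 1 _) (tailF (-1) _)) QB3) QB4.
  rewrite normrN normr1 => /(_ _ _ _ _ _ _ erefl erefl) h.
  apply: (le_trans (h _ _ _ _ _ _)) => //; try exact: mB12.
  + by do 2 (apply: measurableU => //); exact: mB12.
  + by apply: measurableU; exact: mB12.
  + rewrite lee_fin -/eps -/L le_eqVlt; apply/orP; left; apply/eqP.
    by field; rewrite gt_eqF.
- move=> x /not_orP[/not_orP[/not_orP[nB1 nB2] nB3] nB4].
  rewrite IE EIE.
  have h1 : F x - EF < delta / 3.
    move: nB1 => /negP; rewrite -ltNge ltr_expR mul1r ltr_pM2l//.
  have h2 : - (F x - EF) < delta / 3.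
    by move: nB2 => /negP; rewrite -ltNge ltr_expR mulN1r mulNr -mulrN ltr_pM2l.
  have h3 : G x < delta / 3 by move: nB3 => /negP; rewrite -ltNge.
  have h4 : EG < delta / 3.
    by rewrite ltNge; apply/negP => h; apply: nB4; rewrite /B4 h.
  have /andP[h5 _] := GM x.
  rewrite ler_norml; apply/andP; split; lra.
Qed.

End concentration.

(** * The unit cube *)

Section cube_integral.
Context {R : realType} {d : nat}.
Local Notation leb := (lebesgue_tuple R d).
Local Notation cube := (@cube R d).

Lemma ge0_integral_mrestr d' (T : measurableType d')
    (mu : {measure set T -> \bar R}) (D : set T) (mD : measurable D)
    (g : T -> \bar R) : measurable_fun setT g -> (forall x, 0 <= g x)%E ->
  (\int[mrestr mu mD]_x g x = \int[mu]_(x in D) g x)%E.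
Proof.
move=> mg g0; rewrite -(setvU D) setUC.
rewrite ge0_integral_setU//; last 3 first.
- exact: measurableC.
- exact: measurable_funTS.
- by apply/disj_set2P; rewrite setICr.
rewrite [X in (_ + X)%E](eq_measure_integral mzero); last first.
  move=> A mA AD; transitivity (mu (A `&` D)) => //.
  rewrite (_ : A `&` D = set0) ?measure0//.
  by apply/seteqP; split => // x [/AD].
rewrite integral_measure_zero adde0; apply: eq_measure_integral => A mA AD.
by transitivity (mu (A `&` D)); rewrite // setIidl.
Qed.

Lemma ge0_integral_cube (g : d.-tuple R -> \bar R) :
  measurable_fun [set: d.-tuple R] g -> (forall x, 0 <= g x)%E ->
  (\int[cube_measure R d]_x g x = \int[leb]_(x in cube) g x)%E.
Proof. exact: ge0_integral_mrestr. Qed.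

Lemma cube_measureT : cube_measure R d setT = 1%E.
Proof.
rewrite /cube_measure /= /mrestr setTI.
rewrite (lebesgue_tuple_box (A := fun=> `[0%R, 1%R]%classic))//.
by rewrite big1// => i _; rewrite lebesgue_measure_itv/= lte_fin ltr01 oppr0 adde0.
Qed.

(** A second name for [cube_measure], on which the probability structure required by the
    concentration lemmas and by Jensen's inequality is declared. *)
Definition cube_law : set (d.-tuple R) -> \bar R := cube_measure R d.

HB.instance Definition _ := Measure.copy cube_law (cube_measure R d).

HB.instance Definition _ :=
  Measure_isProbability.Build _ _ _ cube_law cube_measureT.

Definition cube_prob : probability (d.-tuple R) R := cube_law.

Lemma cube_probE (g : d.-tuple R -> \bar R) :
  (\int[cube_prob]_x g x = \int[cube_measure R d]_x g x)%E.
Proof. by []. Qed.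

End cube_integral.

Section lebesgue_tuple_prod.
Context {R : realType}.

Lemma ge0_integral_lebesgue_tupleS d (F : d.+1.-tuple R -> \bar R) :
  measurable_fun [set: d.+1.-tuple R] F -> (forall x, 0 <= F x)%E ->
  (\int[lebesgue_tuple R d.+1]_t F t =
   \int[lebesgue_tuple R d]_y \int[lebesgue_measure]_x F (tcons (x, y)))%E.
Proof.
move=> mF F0.
have F0' : {in [set: d.+1.-tuple R], forall y, 0 <= F y}%E by move=> y _.
pose tc : (measurableTypeR R * d.-tuple R)%type -> d.+1.-tuple R := @tcons R d.
have mtc : measurable_fun setT tc by exact: measurable_tcons.
rewrite [LHS](@ge0_integral_pushforward _ _ _ _ R tc mtc
  (@lebesgue_measure R \x lebesgue_tuple R d)%E setT F measurableT mF F0').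
rewrite preimage_setT (fubini_tonelli2 (F \o tc))//.
  exact: measurableT_comp.
by move=> x; exact: F0.
Qed.

Lemma lebesgue_tuple_prod d (g : 'I_d -> R -> R) :
  (forall i, measurable_fun setT (g i)) -> (forall i x, 0 <= g i x) ->
  (\int[lebesgue_tuple R d]_t (\prod_(i < d) g i (tnth t i))%:E =
   \prod_(i < d) \int[lebesgue_measure]_x (g i x)%:E)%E.
Proof.
elim: d g => [|d IH] g mg g0.
  under eq_integral do rewrite big_ord0.
  by rewrite big_ord0 integral_cst// mul1e; exact: diracT.
have mprod k (h : 'I_k -> R -> R) : (forall j, measurable_fun setT (h j)) ->
    measurable_fun setT (fun x : k.-tuple R => \prod_(j < k) h j (tnth x j)).
  move=> mh; apply: measurable_prod => j _; apply: measurableT_comp => //.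
  exact: measurable_tnth.
rewrite ge0_integral_lebesgue_tupleS; last 2 first.
- by apply/measurable_EFinP; exact: mprod.
- by move=> x; rewrite lee_fin prodr_ge0.
transitivity (\int[lebesgue_tuple R d]_y ((\int[lebesgue_measure]_x (g ord0 x)%:E) *
    (\prod_(j < d) g (lift ord0 j) (tnth y j))%:E))%E.
  apply: eq_integral => y _; rewrite -ge0_integralZr//.
  - apply: eq_integral => x _; rewrite /= big_ord_recl EFinM; congr (_ * _%:E)%E.
    by apply: eq_bigr => j _; rewrite tnthS.
  - by apply/measurable_EFinP; exact: mg.
  - by move=> x _; rewrite lee_fin.
  - by rewrite lee_fin prodr_ge0.
rewrite ge0_integralZl//; last 3 first.
- by apply/measurable_EFinP; apply: (mprod d (fun j => g (lift ord0 j))).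
- by move=> y _; rewrite lee_fin prodr_ge0.
- by apply: integral_ge0 => x _; rewrite lee_fin.
by rewrite big_ord_recl (IH (fun j => g (lift ord0 j))).
Qed.

Lemma cube_prod d (g : 'I_d -> R -> R) :
  (forall i, measurable_fun setT (g i)) -> (forall i x, 0 <= g i x) ->
  (\int[cube_measure R d]_t (\prod_(i < d) g i (tnth t i))%:E =
   \prod_(i < d) \int[lebesgue_measure]_(x in `[0%R, 1%R]) (g i x)%:E)%E.
Proof.
move=> mg g0.
have m01 : measurable (`[0%R, 1%R]%classic : set R) by [].
rewrite ge0_integral_cube; last 2 first.
- apply/measurable_EFinP; apply: measurable_prod => j _; apply: measurableT_comp => //.
  exact: measurable_tnth.
- by move=> x; rewrite lee_fin prodr_ge0.
rewrite integral_mkcond.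
transitivity (\int[lebesgue_tuple R d]_t
  (\prod_(i < d) (\1_(`[0%R, 1%R]%classic) (tnth t i) * g i (tnth t i)))%:E)%E.
  apply: eq_integral => t _; rewrite patchE; case: ifPn => [|tn].
    rewrite inE => tc; congr EFin; apply: eq_bigr => i _.
    by rewrite indicE mem_set ?mul1r//; exact: tc.
  have [i ni] : exists i, ~ tnth t i \in `[0%R, 1%R].
    by apply/existsNP => h; move: tn => /negP; apply; rewrite inE.
  rewrite (bigD1 i)//= indicE memNset ?mul0r ?mul0r//.
rewrite (lebesgue_tuple_prod (g := fun i x => \1_(`[0%R, 1%R]%classic) x * g i x)).
- apply: eq_bigr => i _; rewrite [RHS]integral_mkcond; apply: eq_integral => x _.
  rewrite patchE indicE; case: ifPn => xi; first by rewrite mul1r.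
  by rewrite mul0r.
- by move=> i; apply: measurable_funM => //; exact: measurable_indic.
- by move=> i x; rewrite mulr_ge0.
Qed.

(** By uniqueness of Lebesgue measure: [|a|] times the image of the measure under the affine map
    gives every half-open interval its length. For [a < 0] the preimage is closed on the other side,
    which does not change its measure. *)
Lemma ge0_integral_affine (a b : R) (g : R -> \bar R) : a != 0 ->
  measurable_fun [set: R] g -> (forall x, 0 <= g x)%E ->
  (\int[lebesgue_measure]_x g (a * x + b)%R =
    (`|a|^-1)%:E * \int[lebesgue_measure]_x g x)%E.
Proof.
move=> a0 mg g0.
have a0' : 0 < `|a| by rewrite normr_gt0.
pose phi : measurableTypeR R -> measurableTypeR R := fun x : R => (a * x + b : R).
have mf : measurable_fun setT phi.
  by apply: measurable_funD => //; exact: measurable_funM.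
pose m0 := measure_function_pushforward__canonical__measure_function_Measure
   (@lebesgue_measure R) mf.
pose k : {nonneg R} := NngNum (ltW a0').
have H A : measurable A -> lebesgue_measure A = mscale k m0 A.
  move=> mA; apply: (@lebesgue_measure_unique R (mscale k m0)) => // _ [[u v]] _ <-.
  rewrite /=; have -> : mscale k m0 `]u, v]%classic =
    (k%:num%:E * lebesgue_measure (phi @^-1` `]u, v]%classic))%E by [].
  have [uv|vu] := ltP u v; last first.
    rewrite set_itv_ge ?preimage_set0 ?measure0 ?mule0//.
    by rewrite -leNgt bnd_simp.
  rewrite lebesgue_measure_itv/= lte_fin uv.
  have [an|ap] := ltP a 0.
    rewrite (_ : _ @^-1` _ = `[(v - b) / a, (u - b) / a[%classic); last first.
      apply/seteqP; split => x; rewrite /phi /= !in_itv/= ler_ndivrMr// ltr_ndivlMr// !(mulrC _ a);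
        move=> /andP[h1 h2]; apply/andP; split; lra.
    rewrite lebesgue_measure_itv/= lte_fin ltr_ndivrMr// divfK// ltrD2r uv.
    rewrite -EFinB -EFinB -EFinM ltr0_norm//; congr EFin; field; exact: a0.
  have {}ap : 0 < a by rewrite lt0r a0.
  rewrite (_ : _ @^-1` _ = `](u - b) / a, (v - b) / a]%classic); last first.
    apply/seteqP; split => x; rewrite /phi /= !in_itv/= ltr_pdivrMr// ler_pdivlMr// !(mulrC _ a);
      move=> /andP[h1 h2]; apply/andP; split; lra.
  rewrite lebesgue_measure_itv/= lte_fin ltr_pdivrMr// divfK// ltrD2r uv.
  by rewrite -EFinB -EFinB -EFinM gtr0_norm//; congr EFin; field; exact: a0.
rewrite [X in (_ * X)%E](eq_measure_integral (mscale k m0)); last first.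
  by move=> A mA _; exact: H.
rewrite ge0_integral_mscale// muleA -EFinM mulVf ?gt_eqF// mul1e.
by apply/esym; apply: (ge0_integral_pushforward mf _ measurableT mg).
Qed.

End lebesgue_tuple_prod.

(** * Kernels *)

Section kernel.
Context {R : realType} {d : nat}.
Implicit Types (W : 'I_d -> R -> R) (h t u : d.-tuple R).

Lemma sigmaP (s : R) : sigma s = 1 \/ sigma s = -1.
Proof.
rewrite /sigma indicE; case: (_ \in _); [left|right]; rewrite ?mulr1 ?mulr0; ring.
Qed.

Lemma kernel_bounded W : (forall i, kernel_class (W i)) ->
  exists2 M : R, 1 <= M & forall i x, `|W i x| <= M.
Proof.
move=> kW.
have H i : exists M : R, forall x, `|W i x| <= M.
  have [_ [M hM] h0 _] := kW i; exists (Num.max M 0) => x.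
  have [xi|xi] := boolP (x \in `[0, 1]%R); first by rewrite le_max hM.
  by rewrite h0// normr0 le_max lexx orbT.
have [M hM] := choice H.
exists (1 + \sum_i `|M i|); first by rewrite lerDl sumr_ge0.
move=> i x; apply: (le_trans (hM i x)); apply: (le_trans (ler_norm _)).
rewrite (bigD1 i)//= addrCA lerDl addr_ge0// sumr_ge0//.
Qed.

(** The kernel looks to one side of [t], but to a side that depends on [t]; the box covers both
    sides, so it is symmetric in its two points and serves for integration in either variable. *)
Definition box h u : set (d.-tuple R) :=
  [set t | forall i, `|tnth t i - tnth u i| <= tnth h i].

Lemma boxE h u :
  box h u = [set t | forall i,
    `[tnth u i - tnth h i, tnth u i + tnth h i]%classic (tnth t i)].
Proof.
by apply/seteqP; split => t /= ht i; have := ht i;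
  rewrite in_itv/= ler_distl.
Qed.

Lemma box_sym h t u : box h u t = box h t u.
Proof.
by apply/propext; split => H i; have := H i; rewrite distrC.
Qed.

Lemma measurable_boxh h u : measurable (box h u).
Proof.
rewrite boxE; apply: (measurable_box (A := fun i =>
  `[tnth u i - tnth h i, tnth u i + tnth h i]%classic)) => i; exact: measurable_itv.
Qed.

Lemma vol_gt0 h : (forall i, 0 < tnth h i) -> 0 < vol h.
Proof. by move=> h0; rewrite prodr_gt0. Qed.

Lemma lebesgue_tuple_boxh h u : (forall i, 0 < tnth h i) ->
  lebesgue_tuple R d (box h u) = (2 ^+ d * vol h)%:E.
Proof.
move=> h0; rewrite boxE (lebesgue_tuple_box (A := fun i =>
  `[tnth u i - tnth h i, tnth u i + tnth h i]%classic)); last first.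
  by move=> i; exact: measurable_itv.
have -> : 2 ^+ d * vol h = \prod_(i < d) (2 * tnth h i).
  by rewrite big_split/= prodr_const card_ord.
rewrite -prodEFin; apply: eq_bigr => i _.
rewrite lebesgue_measure_itv/= lte_fin ifT; last by have := h0 i; lra.
by rewrite -EFinB; congr EFin; ring.
Qed.

Lemma cube_measure_boxh h u : (forall i, 0 < tnth h i) ->
  (cube_measure R d (box h u) <= (2 ^+ d * vol h)%:E)%E.
Proof.
move=> h0; rewrite -(lebesgue_tuple_boxh u h0) /cube_measure/= /mrestr.
by apply: le_measure; rewrite ?inE//; [apply: measurableI|];
  do ?[exact: measurable_boxh|exact: measurable_cube].
Qed.

Lemma kern_le W M h t u : (forall i, 0 < tnth h i) -> 0 <= M ->
  (forall i x, `|W i x| <= M) -> `|kern W h t u| <= M ^+ d / vol h.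
Proof.
move=> h0 M0 WM; rewrite /kern normr_prod.
have -> : M ^+ d / vol h = \prod_(i < d) ((tnth h i)^-1 * M).
  by rewrite big_split/= prodr_const card_ord mulrC prodfV.
apply: ler_prod => i _; rewrite normr_ge0 normrM ler_pM//.
by rewrite ger0_norm// invr_ge0 ltW.
Qed.

Lemma kern_support W h t u : (forall i, kernel_class (W i)) ->
  (forall i, 0 < tnth h i) -> ~ box h u t -> kern W h t u = 0.
Proof.
move=> kW h0 /existsNP[i hi]; apply/eqP; rewrite prodf_seq_eq0; apply/hasP.
exists i; rewrite ?mem_index_enum//= mulf_eq0; apply/orP; right; apply/eqP.
have [_ _ h1 _] := kW i; apply: h1; apply/negP; rewrite in_itv/= => hh; apply: hi.
have hi0 := h0 i.
have {hh}: `|sigma (tnth t i) * ((tnth t i - tnth u i) / tnth h i)| <= 1.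
  by rewrite ger0_norm; have /andP[] := hh.
rewrite normrM normf_div (gtr0_norm hi0) mulrA ler_pdivrMr// mul1r.
by case: (sigmaP (tnth t i)) => ->; rewrite ?normrN normr1 mul1r.
Qed.

Lemma kern_box_le W M h t u : (forall i, kernel_class (W i)) ->
  (forall i, 0 < tnth h i) -> 0 <= M -> (forall i x, `|W i x| <= M) ->
  `|kern W h t u| <= M ^+ d / vol h * \1_(box h u) t.
Proof.
move=> kW h0 M0 WM; rewrite indicE; case: (boolP (t \in _)) => [_|tn].
  by rewrite mulr1; exact: kern_le.
rewrite mulr0 kern_support ?normr0//.
by move: tn; rewrite notin_setE.
Qed.

Lemma measurable_sigma : measurable_fun setT (@sigma R).
Proof.
by apply: measurable_funB => //; exact: measurable_funM.
Qed.

Lemma measurable_kern W h disp (S : measurableType disp) (f g : S -> d.-tuple R) :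
  (forall i, kernel_class (W i)) -> measurable_fun setT f ->
  measurable_fun setT g -> measurable_fun setT (fun z => kern W h (f z) (g z)).
Proof.
move=> kW mf mg; apply: measurable_prod => i _; apply: measurable_funM => //.
have [mW _ _ _] := kW i.
have m1 : measurable_fun setT (fun z => tnth (f z) i).
  exact: (measurableT_comp (measurable_tnth i)).
have m2 : measurable_fun setT (fun z => tnth (g z) i).
  exact: (measurableT_comp (measurable_tnth i)).
apply: (measurableT_comp mW); apply: measurable_funM.
  exact: (measurableT_comp measurable_sigma).
by apply: measurable_funM => //; exact: measurable_funB.
Qed.

(** The sign [sigma t] varies with [t], so the integrand is bounded by the sum over both signs, each
    of which is an affine change of variables. The resulting factor [2] per coordinate is recovered
    later from the sum over the [2^d] subcubes in [M_hat]. *)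
Lemma kernel_sq_scaled (w : R -> R) (h x : R) : kernel_class w -> 0 < h ->
  (\int[lebesgue_measure]_(t in `[0%R, 1%R])
      ((h^-1 * w (sigma t * ((t - x) / h))) ^+ 2)%:E <=
   (2 / h)%:E * \int[lebesgue_measure]_(t in `[0%R, 1%R]) (w t ^+ 2)%:E)%E.
Proof.
move=> [mw _ w0 _] h0.
have mw2 : measurable_fun [set: R] (fun t : R => (w t ^+ 2)%:E).
  by apply/measurable_EFinP; exact: measurable_funX.
have w20 (t : R) : (0 <= (w t ^+ 2)%:E)%E by rewrite lee_fin sqr_ge0.
have hn0 : h^-1 != 0 by rewrite invr_neq0// gt_eqF.
have mg (a b : R) : measurable_fun [set: R] (fun t : R => (w (a * t + b) ^+ 2)%:E).
  apply/measurable_EFinP; apply: measurable_funX; apply: (measurableT_comp mw).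
  by apply: measurable_funD => //; exact: measurable_funM.
have I01 : (\int[lebesgue_measure]_(t in `[0%R, 1%R]) (w t ^+ 2)%:E =
    \int[lebesgue_measure]_t (w t ^+ 2)%:E)%E.
  rewrite integral_mkcond; apply: eq_integral => t _; rewrite patchE.
  case: ifPn => //; rewrite notin_setE /= => tn.
  by rewrite w0 ?expr0n//; apply/negP.
rewrite I01.
apply: (@le_trans _ _ (\int[lebesgue_measure]_t
   ((h^-1 ^+ 2)%:E * ((w (h^-1 * t + - (x / h)) ^+ 2)%:E +
     (w (- h^-1 * t + x / h) ^+ 2)%:E))))%E.
  rewrite integral_mkcond; apply: ge0_le_integral_nonmeasurable => t _.
    by rewrite patchE; case: ifPn => // _; rewrite lee_fin sqr_ge0.
  rewrite patchE; case: ifPn => _; last by rewrite mule_ge0 ?lee_fin ?sqr_ge0// addr_ge0 ?sqr_ge0.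
  rewrite -EFinD -EFinM lee_fin exprMn ler_wpM2l ?sqr_ge0//.
  case: (sigmaP t) => ->.
    rewrite mul1r [(t - x) / h](_ : _ = h^-1 * t + - (x / h)); last by ring.
    by rewrite lerDl sqr_ge0.
  rewrite [-1 * _](_ : _ = - h^-1 * t + x / h); last by ring.
  by rewrite lerDr sqr_ge0.
rewrite ge0_integralZl//; last 3 first.
- by apply: emeasurable_funD; exact: mg.
- by move=> t _; rewrite adde_ge0// lee_fin sqr_ge0.
- by rewrite lee_fin sqr_ge0.
rewrite ge0_integralD//; [|exact: mg|exact: mg].
rewrite (ge0_integral_affine _ hn0 mw2 w20).
rewrite (@ge0_integral_affine _ (- h^-1) _ _ _ mw2 w20) ?oppr_eq0//.
rewrite normrN gtr0_norm ?invr_gt0// invrK -ge0_muleDl ?lee_fin ?(ltW h0)//.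
rewrite muleA -EFinD -EFinM; apply: lee_wpmul2r; first exact: integral_ge0.
by rewrite lee_fin le_eqVlt; apply/orP; left; apply/eqP; field; rewrite gt_eqF.
Qed.

Lemma lee_prod_ge0 n (a b : 'I_n -> \bar R) :
  (forall i, 0 <= a i)%E -> (forall i, a i <= b i)%E ->
  (\prod_(i < n) a i <= \prod_(i < n) b i)%E.
Proof.
move=> a0 ab; suff : (0 <= \prod_(i < n) a i <= \prod_(i < n) b i)%E by case/andP.
apply: (big_ind2 (fun x y => 0 <= x <= y)%E) => //.
  by rewrite lee_fin ler01 lexx.
  move=> x1 x2 y1 y2 /andP[x10 x12] /andP[y10 y12].
  by rewrite mule_ge0//= lee_pmul.
by move=> i _; rewrite a0 ab.
Qed.

Definition kernel_sqnorm W : \bar R :=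
  \int[cube_measure R d]_u ((\prod_(i < d) W i (tnth u i)) ^+ 2)%:E.

Lemma kern_sq_integral W h u : (forall i, kernel_class (W i)) ->
  (forall i, 0 < tnth h i) ->
  (\int[cube_measure R d]_t (kern W h t u ^+ 2)%:E <=
   (2 ^+ d / vol h)%:E * kernel_sqnorm W)%E.
Proof.
move=> kW h0; rewrite /kern /kernel_sqnorm.
have mWi i : measurable_fun setT (W i) by have [] := kW i.
under eq_integral do rewrite -prodrXl.
under [X in (_ <= _ * X)%E]eq_integral do rewrite -prodrXl.
pose g i (s : R) := ((tnth h i)^-1 * W i (sigma s * ((s - tnth u i) / tnth h i))) ^+ 2.
rewrite (cube_prod (g := g)); last 2 first.
- move=> i; apply: measurable_funX; apply: measurable_funM => //.
  apply: (measurableT_comp (mWi i)); apply: measurable_funM; first exact: measurable_sigma.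
  by apply: measurable_funM => //; exact: measurable_funB.
- by move=> i s; exact: sqr_ge0.
rewrite (cube_prod (g := fun i s => W i s ^+ 2)); last 2 first.
- by move=> i; exact: measurable_funX.
- by move=> i s; exact: sqr_ge0.
apply: (le_trans (lee_prod_ge0 _ (fun i => kernel_sq_scaled (tnth u i) (kW i) (h0 i)))).
  by move=> i; apply: integral_ge0 => s _; rewrite lee_fin sqr_ge0.
rewrite big_split/= prodEFin big_split/= prodr_const card_ord prodfV.
by rewrite -/(vol h).
Qed.

(** The height [M^d / V] meets a support of measure at most [2^d V], so the bound is free of [h]:
    one observation moves the estimator by [O(1/n)] in the L_1 norm. *)
Lemma kern_abs_integral W M h u : (forall i, kernel_class (W i)) ->
  (forall i, 0 < tnth h i) -> 0 <= M -> (forall i x, `|W i x| <= M) ->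
  (\int[cube_measure R d]_t (`|kern W h t u|)%:E <= (M ^+ d * 2 ^+ d)%:E)%E.
Proof.
move=> kW h0 M0 WM.
have v0 := vol_gt0 h0.
apply: (@le_trans _ _ (\int[cube_measure R d]_t ((M ^+ d / vol h)%:E * (\1_(box h u) t)%:E))%E).
  apply: ge0_le_integral_nonmeasurable => t _; first by rewrite lee_fin.
  by rewrite -EFinM lee_fin; exact: kern_box_le.
rewrite ge0_integralZl//; last 2 first.
- by apply/measurable_EFinP; apply: measurable_indic; exact: measurable_boxh.
- by rewrite lee_fin divr_ge0 ?exprn_ge0 ?(ltW v0).
rewrite integral_indic//; last exact: measurable_boxh.
rewrite setIT; apply: (@le_trans _ _ ((M ^+ d / vol h)%:E * (2 ^+ d * vol h)%:E)%E).
  apply: lee_wpmul2l; first by rewrite lee_fin divr_ge0 ?exprn_ge0 ?(ltW v0).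
  exact: cube_measure_boxh.
by rewrite -EFinM lee_fin le_eqVlt; apply/orP; left; apply/eqP; field; rewrite gt_eqF.
Qed.

(** Here integration is against the law of an observation, and the boundedness of the density is
    expressed by the mass of a box alone. *)
Lemma kern_sq_integral_r W M h t (mu : probability (d.-tuple R) R) (B : R) :
  (forall i, kernel_class (W i)) ->
  (forall i, 0 < tnth h i) -> 0 <= M -> (forall i x, `|W i x| <= M) ->
  (mu (box h t) <= (B * vol h)%:E)%E ->
  (\int[mu]_u (kern W h t u ^+ 2)%:E <= (M ^+ d ^+ 2 * B / vol h)%:E)%E.
Proof.
move=> kW h0 M0 WM muB.
have v0 := vol_gt0 h0.
apply: (@le_trans _ _ (\int[mu]_u (((M ^+ d / vol h) ^+ 2)%:E * (\1_(box h t) u)%:E))%E).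
  apply: ge0_le_integral_nonmeasurable => u _; first by rewrite lee_fin sqr_ge0.
  rewrite -EFinM lee_fin -real_normK ?num_real//.
  have h1 : `|kern W h t u| <= M ^+ d / vol h * \1_(box h t) u.
    have := kern_box_le t u kW h0 M0 WM.
    by rewrite !indicE (_ : (t \in box h u) = (u \in box h t))//;
      apply/idP/idP; rewrite !inE box_sym.
  have i2 : (\1_(box h t) u : R) = (\1_(box h t) u) ^+ 2.
    by rewrite indicE; case: (_ \in _); rewrite ?expr1n ?expr0n.
  by rewrite i2 -exprMn lerXn2r ?nnegrE// mulr_ge0 ?divr_ge0 ?exprn_ge0 ?(ltW v0).
rewrite ge0_integralZl//; last 2 first.
- by apply/measurable_EFinP; apply: measurable_indic; exact: measurable_boxh.
- by rewrite lee_fin sqr_ge0.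
rewrite integral_indic//; last exact: measurable_boxh.
rewrite setIT; apply: (@le_trans _ _ (((M ^+ d / vol h) ^+ 2)%:E * (B * vol h)%:E)%E).
  by apply: lee_wpmul2l; rewrite ?lee_fin ?sqr_ge0.
by rewrite -EFinM lee_fin le_eqVlt; apply/orP; left; apply/eqP; field; rewrite gt_eqF.
Qed.

End kernel.

Section kernel_sums.
Context {R : realType} {d n : nat}.
Variables (W : 'I_d -> R -> R) (h : d.-tuple R) (Cw : R).
Hypothesis kW : forall i, kernel_class (W i).
Hypothesis h0 : forall i, 0 < tnth h i.
Hypothesis n0 : (0 < n)%N.
Local Notation T := (d.-tuple R).
Local Notation K := (kern W h).
Local Notation V := (vol h).
Hypothesis KV : forall t u, `|K t u| <= Cw / V.
Hypothesis KI : forall u,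
  (\int[cube_measure R d]_t (`|K t u|)%:E <= (Cw * 2 ^+ d)%:E)%E.
Hypothesis Cw0 : 0 < Cw.
Variables (mu : probability T R) (Q : probability (n.-tuple T) R).
Hypothesis QL : iid_law mu Q.

Let V0 : 0 < V := vol_gt0 h0.
Let CV0 : 0 < Cw / V. Proof. by rewrite divr_gt0. Qed.
Let n0R : 0 < n%:R :> R. Proof. by rewrite ltr0n. Qed.

Definition kern_mean t : R := \int[mu]_u K t u.
Definition kern_sqmean t : R := \int[mu]_u (K t u ^+ 2).
Definition deviation t (x : n.-tuple T) : R :=
  kernel_estimator W h x t - kern_mean t.
(** The integrand behind [Lambda_hat], the empirical and unbiased version of [kern_sqmean]. *)
Definition kern_sqavg t (x : n.-tuple T) : R :=
  n%:R^-1 * \sum_(j < n) K t (tnth x j) ^+ 2.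

Lemma measurable_kern_r t : measurable_fun setT (K t).
Proof.
exact: measurable_kern.
Qed.

Lemma measurable_kern_l u : measurable_fun setT (K ^~ u).
Proof.
exact: measurable_kern.
Qed.

Let iK t := bounded_integrable (probability_lty mu) (measurable_kern_r t) (KV t).

Lemma kern_mean_le t : `|kern_mean t| <= Cw / V.
Proof.
apply: (le_trans (le_normr_Rintegral measurableT (iK t))).
rewrite -[leRHS](Rintegral_probability_cst mu).
apply: le_Rintegral => //; first exact: (integrable_norm (iK t)).
exact: finite_measure_integrable_cst.
Qed.

Let mK2 t : measurable_fun setT (fun u => K t u ^+ 2).
Proof. by apply: measurable_funX; exact: measurable_kern_r. Qed.

Let K2V t u : `|K t u ^+ 2| <= (Cw / V) ^+ 2.
Proof. by rewrite normrX lerXn2r ?nnegrE// ltW. Qed.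

Let iK2 t := bounded_integrable (probability_lty mu) (mK2 t) (K2V t).

Lemma kern_sqmean_ge0 t : 0 <= kern_sqmean t.
Proof. by apply: Rintegral_ge0 => u _; exact: sqr_ge0. Qed.

Definition kern_centred t u : R := K t u - kern_mean t.

Let mY t : measurable_fun setT (kern_centred t).
Proof. by apply: measurable_funB => //; exact: measurable_kern_r. Qed.

Let YV t u : `|kern_centred t u| <= 2 * (Cw / V).
Proof.
rewrite /kern_centred (le_trans (ler_normB _ _))// mulr2n mulrDl !mul1r.
by rewrite lerD// kern_mean_le.
Qed.

Let iY t := bounded_integrable (probability_lty mu) (mY t) (YV t).

Let mY2 t : measurable_fun setT (fun u => kern_centred t u ^+ 2).
Proof. by apply: measurable_funX; exact: mY. Qed.

Let Y2V t u : `|kern_centred t u ^+ 2| <= (2 * (Cw / V)) ^+ 2.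
Proof. by rewrite normrX lerXn2r ?nnegrE// mulr_ge0// ltW. Qed.

Let iY2 t := bounded_integrable (probability_lty mu) (mY2 t) (Y2V t).

Lemma kern_centred_mean t : \int[mu]_u kern_centred t u = 0.
Proof.
rewrite RintegralB//; last exact: finite_measure_integrable_cst.
by rewrite Rintegral_probability_cst subrr.
Qed.

Lemma kern_centred_sq t :
  \int[mu]_u (kern_centred t u ^+ 2) <= kern_sqmean t.
Proof.
set m := kern_mean t.
have -> : \int[mu]_u (kern_centred t u ^+ 2) =
    kern_sqmean t - \int[mu]_u (2 * m * kern_centred t u + m ^+ 2).
  rewrite /kern_sqmean -RintegralB//; last first.
    rewrite (_ : _ \o _ = ((fun u => (2 * m)%:E * (kern_centred t u)%:E) \+
      (fun=> (m ^+ 2)%:E))%E); last by apply/funext => u /=; rewrite EFinD EFinM.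
    apply: integrableD => //; last exact: finite_measure_integrable_cst.
    exact: (integrableZl measurableT (2 * m) (iY t)).
  by apply: eq_Rintegral => u _; rewrite /kern_centred -/m; ring.
rewrite RintegralD//; last 2 first.
- exact: (integrableZl measurableT (2 * m) (iY t)).
- exact: finite_measure_integrable_cst.
rewrite RintegralZl// kern_centred_mean mulr0 add0r Rintegral_probability_cst.
by rewrite lerBlDr lerDl sqr_ge0.
Qed.

Lemma deviationE t x :
  deviation t x = n%:R^-1 * \sum_(j < n) kern_centred t (tnth x j).
Proof.
rewrite /deviation /kernel_estimator /kern_centred sumrB mulrBr; congr (_ - _).
by rewrite sumr_const card_ord -[X in _ * X]mulr_natl mulKf// gt_eqF.
Qed.

(** Bernstein's bound. A centred kernel is at most [2 Cw / V], so the range imposed on [lam] is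
    exactly what keeps each summand below [1/2], as [mgf_le] requires. *)
Lemma deviation_mgf lam t : `|lam| <= n%:R * V / (4 * Cw) ->
  (\int[Q]_x (expR (lam * deviation t x))%:E <=
   (expR (2 * lam ^+ 2 * kern_sqmean t / n%:R))%:E)%E.
Proof.
move=> laml; pose Y u := lam / n%:R * kern_centred t u.
have mYY : measurable_fun setT Y by exact: measurable_funM.
have YY2 u : `|Y u| <= 1 / 2.
  rewrite /Y normrM normf_div (gtr0_norm n0R).
  apply: (@le_trans _ _ ((n%:R * V / (4 * Cw)) / n%:R * (2 * (Cw / V)))).
    by apply: ler_pM => //; rewrite ?divr_ge0 ?ler_wpM2r ?invr_ge0// ltW.
  by rewrite le_eqVlt; apply/orP; left; apply/eqP; field; rewrite !gt_eqF.
have -> : (\int[Q]_x (expR (lam * deviation t x))%:E =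
    \int[Q]_x (\prod_(j < n) expR (Y (tnth x j)))%:E)%E.
  apply: eq_integral => x _; rewrite deviationE mulrA big_distrr/=.
  by rewrite expR_sum.
rewrite (iid_law_prod1 (g := fun u => expR (Y u)) QL); last 2 first.
- exact: measurableT_comp.
- by move=> u; exact: expR_ge0.
have mexpY : measurable_fun setT (fun u => expR (Y u)) by exact: measurableT_comp.
have expY u : `|expR (Y u)| <= expR (1 / 2).
  by rewrite ger0_norm ?expR_ge0// ler_expR (le_trans (ler_norm _)).
have := @mgf_le _ _ _ mu Y _ mYY YY2 (fun u => le_trans (ler_norm _) (YY2 u)).
rewrite RintegralZl// kern_centred_mean mulr0 add0r.
rewrite -(EFin_Rintegral (probability_lty mu) mexpY expY) lee_fin => H.
rewrite -EFin_expe lee_fin.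
have Hm : 2 * \int[mu]_u (Y u ^+ 2) <= 2 * lam ^+ 2 * kern_sqmean t / n%:R ^+ 2.
  rewrite /Y; under eq_Rintegral do rewrite exprMn.
  rewrite RintegralZl// exprMn exprVn.
  have := kern_centred_sq t => hc.
  have l0 : 0 <= 2 * (lam ^+ 2 / n%:R ^+ 2) by rewrite mulr_ge0// divr_ge0// sqr_ge0.
  have := ler_wpM2l l0 hc; lra.
apply: (@le_trans _ _ (expR (2 * lam ^+ 2 * kern_sqmean t / n%:R ^+ 2) ^+ n)).
  rewrite lerXn2r ?nnegrE ?expR_ge0//; last by rewrite (le_trans H)// ler_expR.
  by apply: Rintegral_ge0 => u _; exact: expR_ge0.
rewrite -expRM_natl ler_expR le_eqVlt; apply/orP; left; apply/eqP; field.
by rewrite gt_eqF.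
Qed.

Lemma expR_normr_le (y : R) : expR `|y| <= expR y + expR (- y).
Proof.
have [y0|y0] := leP 0 y; first by rewrite ger0_norm// lerDl expR_ge0.
by rewrite ltr0_norm// lerDr expR_ge0.
Qed.

Lemma measurable_deviation :
  measurable_fun setT (fun z : T * n.-tuple T => deviation z.1 z.2).
Proof.
apply: measurable_funB.
  apply: measurable_funM => //; apply: measurable_sum => j.
  apply: measurable_kern => //.
  exact: (measurableT_comp (measurable_tnth j)).
apply: (@measurableT_comp _ _ _ _ _ _ kern_mean) => //.
(* Measurability of a partial integral is available for nonnegative functions, so the kernel is
   shifted by its bound. *)
have mKp : measurable_fun setT (fun z : T * T => K z.2 z.1 + Cw / V).
  apply: measurable_funD => //.
  exact: measurable_kern.
have KpV (z : T * T) : 0 <= K z.2 z.1 + Cw / V <= 2 * (Cw / V).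
  have := KV z.2 z.1; rewrite ler_norml => /andP[]; lra.
rewrite (_ : kern_mean = fun t => \int[mu]_u (K t u + Cw / V) - Cw / V).
  apply: measurable_funB => //.
  exact: (measurable_Rintegral_l mu mKp KpV).
apply/funext => t; rewrite RintegralD//; last exact: finite_measure_integrable_cst.
by rewrite Rintegral_probability_cst addrK.
Qed.

Lemma deviation_le t x : `|deviation t x| <= 2 * (Cw / V).
Proof.
rewrite deviationE normrM gtr0_norm ?invr_gt0//.
rewrite mulrC ler_pdivrMr//.
apply: (le_trans (ler_norm_sum _ _ _)).
apply: (@le_trans _ _ (\sum_(j < n) 2 * (Cw / V))); first by apply: ler_sum.
by rewrite sumr_const card_ord mulr_natr.
Qed.

Lemma deviation_abs_mgf lam t : `|lam| <= n%:R * V / (4 * Cw) ->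
  (\int[Q]_x (expR `|lam * deviation t x|)%:E <=
   (2 * expR (2 * lam ^+ 2 * kern_sqmean t / n%:R))%:E)%E.
Proof.
move=> laml.
have mdev : measurable_fun setT (deviation t).
  exact: (measurable_section_r measurable_deviation t).
have mexp (c : R) : measurable_fun setT (fun x => (expR (c * deviation t x))%:E).
  apply/measurable_EFinP; apply: measurableT_comp => //.
  exact: measurable_funM.
apply: (@le_trans _ _ (\int[Q]_x ((expR (lam * deviation t x))%:E +
    (expR (- lam * deviation t x))%:E))%E).
  apply: ge0_le_integral_nonmeasurable => x _; first by rewrite lee_fin expR_ge0.
  by rewrite -EFinD lee_fin mulNr; exact: expR_normr_le.
rewrite ge0_integralD//.
rewrite mulr2n mulrDl mul1r EFinD leeD//; first exact: deviation_mgf.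
have := @deviation_mgf (- lam) t; rewrite normrN sqrrN; exact.
Qed.

Lemma deviation_second_moment t :
  (\int[Q]_x (deviation t x ^+ 2)%:E <= (kern_sqmean t / n%:R)%:E)%E.
Proof.
have mdev : measurable_fun [set: n.-tuple T]
    (fun x => \sum_(j < n) kern_centred t (tnth x j)).
  apply: measurable_sum => j; apply: (measurableT_comp (mY t)).
  exact: measurable_tnth.
have -> : (\int[Q]_x (deviation t x ^+ 2)%:E = ((n%:R^-1) ^+ 2)%:E *
    \int[Q]_x ((\sum_(j < n) kern_centred t (tnth x j)) ^+ 2)%:E)%E.
  rewrite -ge0_integralZl//.
  - by apply: eq_integral => x _; rewrite deviationE exprMn EFinM.
  - by apply/measurable_EFinP; exact: measurable_funX.
  - by move=> x _; rewrite lee_fin sqr_ge0.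
rewrite (iid_second_moment QL (mY t) (YV t) (kern_centred_mean t)).
rewrite -(EFin_Rintegral (probability_lty mu) (mY2 t) (Y2V t)) -!EFinM lee_fin.
apply: (@le_trans _ _ (n%:R^-1 ^+ 2 * (n%:R * kern_sqmean t))).
  by do 2 (rewrite ler_wpM2l ?sqr_ge0 ?(ltW n0R)//); exact: kern_centred_sq.
by rewrite le_eqVlt; apply/orP; left; apply/eqP; field; rewrite gt_eqF.
Qed.

Lemma measurable_kern_sqavg :
  measurable_fun setT (fun z : T * n.-tuple T => kern_sqavg z.1 z.2).
Proof.
apply: measurable_funM => //; apply: measurable_sum => j.
apply: measurable_funX; apply: measurable_kern => //.
exact: (measurableT_comp (measurable_tnth j)).
Qed.

Lemma kern_sqavg_itv t x : 0 <= kern_sqavg t x <= (Cw / V) ^+ 2.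
Proof.
apply/andP; split.
  by rewrite mulr_ge0 ?invr_ge0 ?(ltW n0R)// sumr_ge0// => j _; exact: sqr_ge0.
rewrite /kern_sqavg mulrC ler_pdivrMr//.
apply: (@le_trans _ _ (\sum_(j < n) (Cw / V) ^+ 2)).
  by apply: ler_sum => j _; exact: le_trans (ler_norm _) (K2V _ _).
by rewrite sumr_const card_ord mulr_natr.
Qed.

(** The summands [Y] lie between [0] and [1/2], hence [Y^2 <= Y / 2]: the quadratic term of [mgf_le]
    is absorbed by the mean and no fourth moment of the kernel appears. *)
Lemma kern_sqavg_mgf lam t : 0 <= lam <= n%:R * V ^+ 2 / (2 * Cw ^+ 2) ->
  (\int[Q]_x (expR (lam * kern_sqavg t x))%:E <=
   (expR (2 * lam * kern_sqmean t))%:E)%E.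
Proof.
move=> /andP[lam0 laml]; pose Y u := lam / n%:R * K t u ^+ 2.
have mYY : measurable_fun setT Y by exact: measurable_funM.
have Y0 u : 0 <= Y u by rewrite mulr_ge0 ?sqr_ge0// divr_ge0// ltW.
have YY2 u : Y u <= 1 / 2.
  apply: (@le_trans _ _ ((n%:R * V ^+ 2 / (2 * Cw ^+ 2)) / n%:R * (Cw / V) ^+ 2)).
    apply: ler_pM => //; rewrite ?divr_ge0 ?sqr_ge0 ?(ltW n0R)//.
      by rewrite ler_wpM2r ?invr_ge0// ltW.
    exact: le_trans (ler_norm _) (K2V _ _).
  by rewrite le_eqVlt; apply/orP; left; apply/eqP; field; rewrite !gt_eqF.
have aYY2 u : `|Y u| <= 1 / 2 by rewrite ger0_norm.
have -> : (\int[Q]_x (expR (lam * kern_sqavg t x))%:E =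
    \int[Q]_x (\prod_(j < n) expR (Y (tnth x j)))%:E)%E.
  apply: eq_integral => x _; rewrite /kern_sqavg mulrA big_distrr/=.
  by rewrite expR_sum.
rewrite (iid_law_prod1 (g := fun u => expR (Y u)) QL); last 2 first.
- exact: measurableT_comp.
- by move=> u; exact: expR_ge0.
have mexpY : measurable_fun setT (fun u => expR (Y u)) by exact: measurableT_comp.
have expY u : `|expR (Y u)| <= expR (1 / 2).
  by rewrite ger0_norm ?expR_ge0// ler_expR.
have := @mgf_le _ _ _ mu Y _ mYY aYY2 YY2.
rewrite -(EFin_Rintegral (probability_lty mu) mexpY expY) lee_fin => H.
rewrite -EFin_expe lee_fin.
have iYY := bounded_integrable (probability_lty mu) mYY aYY2.
have mYYs : measurable_fun setT (fun u => Y u ^+ 2) by exact: measurable_funX.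
have YYsV u : `|Y u ^+ 2| <= (1 / 2) ^+ 2.
  by rewrite normrX lerXn2r ?nnegrE.
have iYYs := bounded_integrable (probability_lty mu) mYYs YYsV.
have Hm : \int[mu]_u Y u + 2 * \int[mu]_u (Y u ^+ 2) <= 2 * lam * kern_sqmean t / n%:R.
  have h2 : \int[mu]_u (Y u ^+ 2) <= \int[mu]_u (1 / 2 * Y u).
    apply: le_Rintegral => //.
      exact: (integrableZl measurableT (1 / 2) iYY).
    by move=> u _; rewrite expr2 ler_wpM2r.
  rewrite RintegralZl// in h2.
  have -> : 2 * lam * kern_sqmean t / n%:R = 2 * \int[mu]_u Y u.
    by rewrite /Y RintegralZl//; rewrite -/(kern_sqmean t); ring.
  lra.
apply: (@le_trans _ _ (expR (2 * lam * kern_sqmean t / n%:R) ^+ n)).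
  rewrite lerXn2r ?nnegrE ?expR_ge0//; last by rewrite (le_trans H)// ler_expR.
  by apply: Rintegral_ge0 => u _; exact: expR_ge0.
rewrite -expRM_natl ler_expR le_eqVlt; apply/orP; left; apply/eqP; field.
by rewrite gt_eqF.
Qed.

Lemma sum_tnth_difference (G : T -> R) (x y : n.-tuple T) (i : 'I_n) :
  (forall j, j != i -> tnth x j = tnth y j) ->
  \sum_(j < n) G (tnth x j) - \sum_(j < n) G (tnth y j) =
  G (tnth x i) - G (tnth y i).
Proof.
move=> xy; rewrite -sumrB (bigD1 i)//= big1 ?addr0// => j ji.
by rewrite xy// subrr.
Qed.

Let KI' u : \int[cube_prob]_t `|K t u| <= Cw * 2 ^+ d.
Proof.
rewrite -lee_fin (EFin_Rintegral (probability_lty cube_prob) (M := Cw / V)).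
- exact: KI.
- by apply: measurableT_comp => //; exact: measurable_kern_l.
- by move=> t; rewrite normr_id.
Qed.

Let iKn u : (@cube_prob R d).-integrable setT (EFin \o (fun t => `|K t u|)).
Proof.
apply: (bounded_integrable (probability_lty cube_prob) (M := Cw / V)).
  by apply: measurableT_comp => //; exact: measurable_kern_l.
by move=> t; rewrite normr_id.
Qed.

Lemma cube_difference_le (a : R) (g : T -> R) u v (B : R) : 0 <= a ->
  measurable_fun setT g -> (forall t, `|g t| <= B) ->
  (forall t, g t <= a * (`|K t u| + `|K t v|)) ->
  \int[cube_prob]_t g t <= a * (2 * (Cw * 2 ^+ d)).
Proof.
move=> a0 mg gB ga.
have ig := bounded_integrable (probability_lty cube_prob) mg gB.
have iD : (@cube_prob R d).-integrable setT (EFin \o (fun t => `|K t u| + `|K t v|)).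
  by rewrite (_ : _ \o _ = ((EFin \o (fun t => `|K t u|%R)) \+
    (EFin \o (fun t => `|K t v|%R)))%E)//; exact: integrableD.
apply: (@le_trans _ _ (\int[cube_prob]_t (a * (`|K t u| + `|K t v|)))).
  apply: le_Rintegral => //; exact: (integrableZl measurableT a iD).
rewrite RintegralZl// RintegralD// ler_wpM2l//.
have := KI' u; have := KI' v; lra.
Qed.

Lemma deviation_bounded_difference c (x y : n.-tuple T) (i : 'I_n) :
  (forall j, j != i -> tnth x j = tnth y j) ->
  \int[cube_prob]_t `| `|c * deviation t x| - `|c * deviation t y| | <=
  `|c| / n%:R * (2 * (Cw * 2 ^+ d)).
Proof.
move=> xy.
have mdev z : measurable_fun setT (fun t => `|c * deviation t z|).
  apply: measurableT_comp => //; apply: measurable_funM => //.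
  exact: (measurable_section_l measurable_deviation z).
have dz z t : `|c * deviation t z| <= `|c| * (2 * (Cw / V)).
  by rewrite normrM ler_wpM2l// deviation_le.
apply: (@cube_difference_le _ _ (tnth x i) (tnth y i)
   (`|c| * (2 * (Cw / V)) + `|c| * (2 * (Cw / V)))).
- by rewrite divr_ge0// ltW.
- by apply: measurableT_comp => //; exact: measurable_funB.
- move=> t; rewrite normr_id (le_trans (ler_normB _ _))// !normr_id.
  exact: lerD.
- move=> t; apply: (le_trans (ler_dist_dist _ _)); rewrite -mulrBr normrM.
  rewrite -mulrA ler_wpM2l// !deviationE -mulrBr normrM gtr0_norm ?invr_gt0//.
  rewrite ler_wpM2l ?invr_ge0 ?(ltW n0R)// (sum_tnth_difference _ xy).
  rewrite /kern_centred opprB addrA subrK ler_normB//.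
Qed.

(** The bound [K^2 <= (Cw / V) |K|] reduces the squares to the L_1 bound of the kernel. *)
Lemma kern_sqavg_bounded_difference c (x y : n.-tuple T) (i : 'I_n) : 0 <= c ->
  (forall j, j != i -> tnth x j = tnth y j) ->
  \int[cube_prob]_t `|c * kern_sqavg t x - c * kern_sqavg t y| <=
  c * (Cw / V) / n%:R * (2 * (Cw * 2 ^+ d)).
Proof.
move=> c0 xy.
have mdev z : measurable_fun setT (fun t => c * kern_sqavg t z).
  apply: measurable_funM => //.
  exact: (measurable_section_l measurable_kern_sqavg z).
have dz z t : `|c * kern_sqavg t z| <= c * (Cw / V) ^+ 2.
  have /andP[h1 h2] := kern_sqavg_itv t z.
  by rewrite normrM !ger0_norm// ler_wpM2l.
apply: (@cube_difference_le _ _ (tnth x i) (tnth y i)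
   (c * (Cw / V) ^+ 2 + c * (Cw / V) ^+ 2)).
- by rewrite divr_ge0 ?(ltW n0R)// mulr_ge0// ltW.
- by apply: measurableT_comp => //; exact: measurable_funB.
- move=> t; rewrite normr_id (le_trans (ler_normB _ _))//.
  exact: lerD.
- move=> t; rewrite -mulrBr normrM (ger0_norm c0).
  rewrite [leRHS](_ : _ = c * (n%:R^-1 *
    (Cw / V * (`|K t (tnth x i)| + `|K t (tnth y i)|)))); last by ring.
  rewrite ler_wpM2l// /kern_sqavg -mulrBr normrM gtr0_norm ?invr_gt0//.
  rewrite ler_wpM2l ?invr_ge0 ?(ltW n0R)//.
  rewrite (sum_tnth_difference (fun u => K t u ^+ 2) xy).
  apply: (le_trans (ler_normB _ _)); rewrite !normrX mulrDr.
  by apply: lerD; rewrite expr2 ler_wpM2r.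
Qed.

End kernel_sums.

(** * Concentration of kernel sums *)

Section scaled_concentration.
Context {R : realType}.

(** Only [theta * v] has a bounded exponential moment for the small [theta] at hand. The powers are
    homogeneous, so [local_concentration] is applied with tolerance [theta^s * delta]; Tonelli's
    theorem then writes the mean as an integral of pointwise moments. *)
Lemma scaled_concentration (s delta b C0 theta : R) :
  1 <= s -> 0 < delta -> 0 < b -> 0 < C0 -> 0 < theta ->
  exists2 C : R, 0 < C &
  forall (n : nat), (2 <= n)%N ->
  forall d1 d2 (S : measurableType d1) (T : measurableType d2)
    (nu : probability S R) (mu : probability T R)
    (Q : probability (n.-tuple T) R) (v : S * n.-tuple T -> R) (M D : R),
  iid_law mu Q -> measurable_fun setT v -> (forall z, 0 <= v z <= M) ->
  (forall t, (\int[Q]_x (expR (theta * v (t, x)))%:E <= C0%:E)%E) ->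
  (forall (x y : n.-tuple T) (i : 'I_n),
    (forall j, j != i -> tnth x j = tnth y j) ->
    \int[nu]_t `|theta * v (t, x) - theta * v (t, y)| <= D) ->
  n%:R * D ^+ 2 <= C0 * expR (- Num.sqrt (ln n%:R)) ->
  exists Bad : set (n.-tuple T),
    [/\ measurable Bad, (Q Bad <= (C * expR (- b * ln n%:R))%:E)%E &
      forall x, ~ Bad x ->
        (\int[nu]_t (v (t, x) `^ s)%:E <=
          \int[nu]_t \int[Q]_y (v (t, y) `^ s)%:E + delta%:E)%E /\
        (\int[nu]_t \int[Q]_y (v (t, y) `^ s)%:E <=
          \int[nu]_t (v (t, x) `^ s)%:E + delta%:E)%E].
Proof.
move=> s1 delta0 b0 C00 theta0.
have s0 : 0 < s by lra.
have ts0 : 0 < theta `^ s by exact: powR_gt0.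
have [C C1 H] := local_concentration s1 (mulr_gt0 ts0 delta0) b0 C00.
exists C => // n n2 d1 d2 S T nu mu Q v M D QL mv vM vmgf vD nD.
have v0 z : 0 <= v z by have /andP[] := vM z.
have tv0 z : 0 <= theta * v z by rewrite mulr_ge0// ltW.
have mtv : measurable_fun setT (fun z => theta * v z) by exact: measurable_funM.
have tvM z : 0 <= theta * v z <= theta * M.
  by rewrite tv0 ler_wpM2l ?(ltW theta0)//; have /andP[] := vM z.
have [Bad [mB QB hB]] := H n n2 d1 d2 S T nu mu Q (fun z => theta * v z)
  (theta * M) D QL mtv tvM vmgf vD nD.
exists Bad; split => // x /hB {hB}.
have mvs : measurable_fun setT (fun z => v z `^ s).
  exact: (measurableT_comp (measurable_powR s)).
have vsM z : 0 <= v z `^ s <= M `^ s.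
  by rewrite powR_ge0/= ler_powRl ?(ltW s0)//; have /andP[] := vM z.
have vsM' z : `|v z `^ s| <= M `^ s by rewrite ger0_norm ?powR_ge0//; have /andP[] := vsM z.
pose I y := \int[nu]_t (v (t, y) `^ s).
have mI : measurable_fun setT I := measurable_Rintegral_l nu mvs vsM.
have IM y : `|I y| <= M `^ s.
  by have /andP[h1 h2] := Rintegral_l_itv nu mvs vsM y; rewrite ger0_norm.
have ts y : \int[nu]_t ((theta * v (t, y)) `^ s) = theta `^ s * I y.
  rewrite -RintegralZl//.
    by apply: eq_Rintegral => t _; rewrite powRM// ltW.
  apply: (bounded_integrable (probability_lty nu) (M := M `^ s)) => //.
  exact: (measurable_section_l mvs y).
have -> : \int[Q]_y \int[nu]_t ((theta * v (t, y)) `^ s) =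
    theta `^ s * \int[Q]_y I y.
  rewrite -RintegralZl//; first by apply: eq_Rintegral => y _; exact: ts.
  exact: (bounded_integrable (probability_lty Q) mI IM).
rewrite ts -mulrBr normrM (gtr0_norm ts0) ler_pM2l// ler_norml => /andP[h1 h2].
rewrite -(EFin_Rintegral_l nu mvs vsM) -(Rintegral_fubini_E nu Q mvs vsM).
by rewrite -!EFinD !lee_fin; rewrite -/(I x) -/I; split; lra.
Qed.

End scaled_concentration.

Section kernel_concentration.
Context {R : realType} {d : nat}.
Variables (W : 'I_d -> R -> R) (M : R).
Hypothesis kW : forall i, kernel_class (W i).
Hypothesis M1 : 1 <= M.
Hypothesis WM : forall i x, `|W i x| <= M.
Local Notation T := (d.-tuple R).
Local Notation Cw := (M ^+ d).

(* The only consequences of [bandwidths] that the probabilistic estimates use;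
   the bound on [vol h] is [hmax ^ d <= hmax]. *)
Definition admissible (n : nat) (c : R) (h : T) : Prop :=
  [/\ forall i, 0 < tnth h i, vol h <= expR (- Num.sqrt (ln n%:R)) &
      ln n%:R `^ c <= n%:R * vol h].

Definition rate (n : nat) (h : T) : R := (Num.sqrt (n%:R * vol h))^-1.

Let M0 : 0 <= M. Proof. by rewrite (le_trans _ M1). Qed.
Let Cw0 : 0 < Cw. Proof. by rewrite exprn_gt0// (lt_le_trans _ M1). Qed.

Lemma rate_gt0 n h : (0 < n)%N -> (forall i, 0 < tnth h i) -> 0 < rate n h.
Proof.
by move=> n0 h0; rewrite invr_gt0 sqrtr_gt0 mulr_gt0 ?ltr0n// vol_gt0.
Qed.

Lemma rate_sq n h : (0 < n)%N -> (forall i, 0 < tnth h i) ->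
  rate n h ^+ 2 = (n%:R * vol h)^-1.
Proof.
move=> n0 h0; rewrite exprVn sqr_sqrtr// mulr_ge0// ltW// vol_gt0//.
Qed.

(** A lower bound on [n V] that does not depend on [n]; it allows the scale [theta] of the
    exponential moments to be fixed once and for all. *)
Lemma admissible_ge n c h : 0 <= c -> (2 <= n)%N -> admissible n c h ->
  ln 2 `^ c <= n%:R * vol h.
Proof.
move=> c0 n2 [h0 _ hc]; apply: le_trans hc; apply: ler_powRl => //.
  by rewrite ln_ge0// ler1n.
by rewrite ler_ln ?posrE ?ltr0n// ?ler_nat// (leq_trans _ n2).
Qed.

Let kappa0 (c : R) : 0 < ln (2 : R) `^ c.
Proof. by rewrite powR_gt0// ln_gt0// ltr1n. Qed.

Variable B : R.

Lemma kern_sqmean_le (mu : probability T R) h t : (forall i, 0 < tnth h i) ->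
  (forall t, mu (box h t) <= (B * vol h)%:E)%E ->
  vol h * kern_sqmean W h mu t <= Cw ^+ 2 * B.
Proof.
move=> h0 muB; have v0 := vol_gt0 h0.
have := kern_sq_integral_r kW h0 M0 WM (muB t).
rewrite -(EFin_Rintegral (probability_lty mu) (M := (Cw / vol h) ^+ 2)).
- by rewrite lee_fin -/(kern_sqmean W h mu t) ler_pdivlMr// mulrC.
- by apply: measurable_funX; exact: measurable_kern_r.
- move=> u; rewrite normrX lerXn2r ?nnegrE// ?divr_ge0 ?(ltW v0) ?(ltW Cw0)//.
  exact: kern_le.
Qed.

Lemma deviation_concentration (s delta b c : R) :
  1 <= s -> 0 < delta -> 0 < b -> 0 < c ->
  exists2 C : R, 0 < C &
  forall (n : nat) (h : T) (mu : probability T R) (Q : probability (n.-tuple T) R),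
  (2 <= n)%N -> admissible n c h ->
  (forall t, mu (box h t) <= (B * vol h)%:E)%E -> iid_law mu Q ->
  exists Bad : set (n.-tuple T),
    [/\ measurable Bad, (Q Bad <= (C * expR (- b * ln n%:R))%:E)%E &
      forall x, ~ Bad x ->
        (\int[cube_prob]_t ((`|(rate n h)^-1 * deviation W h mu t x|) `^ s)%:E <=
          \int[cube_prob]_t
            \int[Q]_y ((`|(rate n h)^-1 * deviation W h mu t y|) `^ s)%:E + delta%:E)%E].
Proof.
move=> s1 delta0 b0 c0.
pose kap := ln (2 : R) `^ c.
have kap0 : 0 < kap by exact: kappa0.
(* [deviation_abs_mgf] asks for [theta * sqrt (n V) <= n V / (4 Cw)], which holds since
   [n V >= kap]. *)
pose theta := Num.sqrt kap / (4 * Cw).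
have theta0 : 0 < theta by rewrite divr_gt0 ?sqrtr_gt0// mulr_gt0.
pose C0 := 2 * expR (2 * theta ^+ 2 * (Cw ^+ 2 * B)) + 4 * theta ^+ 2 * (Cw * 2 ^+ d) ^+ 2.
have C00 : 0 < C0.
  by rewrite ltr_wpDr ?mulr_gt0 ?expR_gt0// mulr_ge0 ?sqr_ge0// mulr_ge0 ?sqr_ge0.
have [C C1 H] := scaled_concentration s1 delta0 b0 C00 theta0.
exists C => // n h mu Q n2 adm muB QL.
have n0 : (0 < n)%N by exact: leq_trans n2.
have n0R : 0 < n%:R :> R by rewrite ltr0n.
have [h0 hV _] := adm; have v0 := vol_gt0 h0.
have nV0 : 0 < n%:R * vol h by rewrite mulr_gt0.
have r0 := rate_gt0 n0 h0.
have rsq := rate_sq n0 h0.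
have ri0 : 0 < (rate n h)^-1 by rewrite invr_gt0.
have nVkap := admissible_ge (ltW c0) n2 adm.
have KV t u : `|kern W h t u| <= Cw / vol h by exact: kern_le.
have KI u := kern_abs_integral u kW h0 M0 WM.
pose v (z : T * n.-tuple T) := `|(rate n h)^-1 * deviation W h mu z.1 z.2|.
have mv : measurable_fun setT v.
  apply: measurableT_comp => //; apply: measurable_funM => //.
  exact: measurable_deviation.
have vM z : 0 <= v z <= (rate n h)^-1 * (2 * (Cw / vol h)).
  rewrite normr_ge0/= /v normrM (gtr0_norm ri0).
  by rewrite ler_wpM2l ?(ltW ri0)//; exact: deviation_le.
have thv t x : theta * v (t, x) = `|theta / rate n h * deviation W h mu t x|.
  by rewrite /v/= -[in LHS](gtr0_norm theta0) -normrM mulrA.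
have lam_le : `|theta / rate n h| <= n%:R * vol h / (4 * Cw).
  have -> : theta / rate n h = Num.sqrt kap * Num.sqrt (n%:R * vol h) / (4 * Cw).
    by rewrite /theta /rate invrK; ring.
  rewrite ger0_norm; last by rewrite divr_ge0 ?mulr_ge0 ?sqrtr_ge0 ?(ltW Cw0).
  have c4 : 0 <= (4 * Cw)^-1 by rewrite invr_ge0 mulr_ge0// ltW.
  rewrite ler_wpM2r//.
  rewrite -[leRHS]sqr_sqrtr ?(ltW nV0)// expr2.
  by rewrite ler_wpM2r ?sqrtr_ge0// ler_wsqrtr.
have lam_sq : (theta / rate n h) ^+ 2 = theta ^+ 2 * (n%:R * vol h).
  by rewrite exprMn exprVn rsq invrK.
have [|||Bad [mB QB hB]] := H n n2 _ _ _ _ cube_prob mu Q v _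
  (`|theta / rate n h| / n%:R * (2 * (Cw * 2 ^+ d))) QL mv vM.
- move=> t; under eq_integral do rewrite thv.
  apply: (le_trans (deviation_abs_mgf kW h0 n0 KV Cw0 QL t lam_le)).
  rewrite lee_fin; apply: ler_wpDr.
    by rewrite mulr_ge0 ?sqr_ge0// mulr_ge0 ?sqr_ge0.
  rewrite ler_wpM2l// ler_expR lam_sq.
  have -> : 2 * (theta ^+ 2 * (n%:R * vol h)) * kern_sqmean W h mu t / n%:R =
     2 * theta ^+ 2 * (vol h * kern_sqmean W h mu t) by field; rewrite gt_eqF.
  apply: ler_wpM2l; first by rewrite mulr_ge0 ?sqr_ge0.
  exact: kern_sqmean_le.
- move=> x y i xy; under eq_Rintegral do rewrite !thv.
  exact: (deviation_bounded_difference kW n0 KV KI mu _ xy).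
(* Here [n D^2] is a constant times [vol h]; the upper bound on the bandwidths supplies the decay
   [exp (- sqrt (ln n))]. *)
- rewrite exprMn exprMn (exprMn 2) real_normK ?num_real// lam_sq.
  have -> : n%:R * (theta ^+ 2 * (n%:R * vol h) * n%:R^-1 ^+ 2 * (2 ^+ 2 * (Cw * 2 ^+ d) ^+ 2))
    = 4 * theta ^+ 2 * (Cw * 2 ^+ d) ^+ 2 * vol h by field; rewrite gt_eqF.
  rewrite /C0 [leRHS]mulrDl; apply: ler_wpDl.
    by rewrite mulr_ge0 ?expR_ge0// mulr_ge0 ?expR_ge0.
  by rewrite ler_wpM2l// mulr_ge0 ?sqr_ge0// mulr_ge0 ?sqr_ge0.
by exists Bad; split => // x /hB[].
Qed.

Lemma kern_sqavg_concentration (s delta b c : R) :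
  1 <= s -> 0 < delta -> 0 < b -> 0 < c ->
  exists2 C : R, 0 < C &
  forall (n : nat) (h : T) (mu : probability T R) (Q : probability (n.-tuple T) R),
  (2 <= n)%N -> admissible n c h ->
  (forall t, mu (box h t) <= (B * vol h)%:E)%E -> iid_law mu Q ->
  exists Bad : set (n.-tuple T),
    [/\ measurable Bad, (Q Bad <= (C * expR (- b * ln n%:R))%:E)%E &
      forall x, ~ Bad x ->
        (\int[cube_prob]_t ((vol h * kern_sqavg W h t x) `^ s)%:E <=
          \int[cube_prob]_t
            \int[Q]_y ((vol h * kern_sqavg W h t y) `^ s)%:E + delta%:E)%E /\
        (\int[cube_prob]_t
            \int[Q]_y ((vol h * kern_sqavg W h t y) `^ s)%:E <=
          \int[cube_prob]_t ((vol h * kern_sqavg W h t x) `^ s)%:E + delta%:E)%E].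
Proof.
move=> s1 delta0 b0 c0.
pose kap := ln (2 : R) `^ c.
have kap0 : 0 < kap by exact: kappa0.
pose theta := kap / (2 * Cw ^+ 2).
have theta0 : 0 < theta by rewrite divr_gt0// mulr_gt0// exprn_gt0.
pose C0 := expR (2 * theta * (Cw ^+ 2 * B)) +
  (theta * Cw * (2 * (Cw * 2 ^+ d))) ^+ 2 * expR 1.
have C00 : 0 < C0 by rewrite ltr_wpDr ?expR_gt0// mulr_ge0 ?sqr_ge0 ?expR_ge0.
have [C C1 H] := scaled_concentration s1 delta0 b0 C00 theta0.
exists C => // n h mu Q n2 adm muB QL.
have n0 : (0 < n)%N by exact: leq_trans n2.
have n0R : 0 < n%:R :> R by rewrite ltr0n.
have [h0 hV _] := adm; have v0 := vol_gt0 h0.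
have nV0 : 0 < n%:R * vol h by rewrite mulr_gt0.
have nVkap := admissible_ge (ltW c0) n2 adm.
have KV t u : `|kern W h t u| <= Cw / vol h by exact: kern_le.
have KI u := kern_abs_integral u kW h0 M0 WM.
pose v (z : T * n.-tuple T) := vol h * kern_sqavg W h z.1 z.2.
have mv : measurable_fun setT v.
  apply: measurable_funM => //; exact: measurable_kern_sqavg.
have vM z : 0 <= v z <= vol h * (Cw / vol h) ^+ 2.
  have /andP[h1 h2] := kern_sqavg_itv h0 n0 KV Cw0 z.1 z.2.
  by rewrite mulr_ge0 ?(ltW v0)//= ler_wpM2l// ltW.
have thv t x : theta * v (t, x) = theta * vol h * kern_sqavg W h t x.
  by rewrite mulrA.
have lam_le : 0 <= theta * vol h <= n%:R * vol h ^+ 2 / (2 * Cw ^+ 2).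
  rewrite mulr_ge0 ?(ltW theta0) ?(ltW v0)//= /theta.
  rewrite mulrAC ler_wpM2r ?invr_ge0 ?mulr_ge0 ?exprn_ge0 ?(ltW Cw0)//.
  by rewrite expr2 mulrA ler_wpM2r// ltW.
have [|||Bad [mB QB hB]] := H n n2 _ _ _ _ cube_prob mu Q v _
  (theta * vol h * (Cw / vol h) / n%:R * (2 * (Cw * 2 ^+ d))) QL mv vM.
- move=> t; under eq_integral do rewrite thv.
  apply: (le_trans (kern_sqavg_mgf kW h0 n0 KV Cw0 QL t lam_le)).
  rewrite lee_fin; apply: ler_wpDr; first by rewrite mulr_ge0 ?sqr_ge0 ?expR_ge0.
  rewrite ler_expR.
  have -> : 2 * (theta * vol h) * kern_sqmean W h mu t =
     2 * theta * (vol h * kern_sqmean W h mu t) by ring.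
  apply: ler_wpM2l; first by rewrite mulr_ge0 ?(ltW theta0).
  exact: kern_sqmean_le.
- move=> x y i xy; under eq_Rintegral do rewrite !thv.
  apply: (kern_sqavg_bounded_difference kW h0 n0 KV KI Cw0 _ xy).
  by rewrite mulr_ge0 ?(ltW theta0) ?(ltW v0).
(* Here [n D^2] is a constant times [1/n], and [1/n <= e * exp (- sqrt (ln n))], whence the factor
   [expR 1] in [C0]. *)
- have -> : n%:R * (theta * vol h * (Cw / vol h) / n%:R * (2 * (Cw * 2 ^+ d))) ^+ 2 =
    (theta * Cw * (2 * (Cw * 2 ^+ d))) ^+ 2 * n%:R^-1.
    by field; rewrite !gt_eqF.
  rewrite /C0 [leRHS]mulrDl; apply: ler_wpDl; first by rewrite mulr_ge0 ?expR_ge0.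
  rewrite -[leRHS]mulrA; apply: ler_wpM2l; first exact: sqr_ge0.
  rewrite -{1}[n%:R]lnK ?posrE// -expRN -expRD ler_expR.
  set L := ln n%:R; have L0 : 0 <= L by rewrite ln_ge0// ler1n.
  have := sqr_sqrtr L0; set y := Num.sqrt L => yL.
  have := sqr_ge0 (y - 1 / 2); nra.
by exists Bad; split => // x /hB[].
Qed.

End kernel_concentration.

(** * Norms and moments *)

Section norms.
Context {R : realType}.

(** The tangent of the power function at the mean [m] is integrated; its linear term has mean
    zero. *)
Lemma Rintegral_jensen d (T : measurableType d) (P : probability T R)
    (y : T -> R) (s M : R) : 1 <= s -> measurable_fun setT y ->
  (forall x, 0 <= y x <= M) ->
  (\int[P]_x y x) `^ s <= \int[P]_x (y x `^ s).
Proof.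
move=> s1 my yM; have s0 : 0 <= s by lra.
have y0 x : 0 <= y x by have /andP[] := yM x.
have yM' x : `|y x| <= M by rewrite ger0_norm//; have /andP[] := yM x.
have iy := bounded_integrable (probability_lty P) my yM'.
have mys : measurable_fun setT (fun x => y x `^ s).
  exact: (measurableT_comp (measurable_powR s)).
have ysM x : `|y x `^ s| <= M `^ s.
  by rewrite ger0_norm ?powR_ge0// ler_powRl//; have /andP[] := yM x.
have iys := bounded_integrable (probability_lty P) mys ysM.
set m := \int[P]_x y x.
have m0 : 0 <= m by exact: Rintegral_ge0.
have icst (c : R) : P.-integrable setT (EFin \o (fun=> c)).
  exact: finite_measure_integrable_cst.
have iym : P.-integrable setT (EFin \o (fun x => y x - m)).
  by rewrite (_ : _ \o _ = ((EFin \o y) \- (EFin \o (fun=> m)))%E)//; exact: integrableB.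
have isym := integrableZl measurableT (s * m `^ (s - 1)) iym.
apply: (@le_trans _ _ (\int[P]_x (m `^ s + s * m `^ (s - 1) * (y x - m)))).
  rewrite RintegralD// RintegralZl// RintegralB// !Rintegral_probability_cst -/m.
  by rewrite subrr mulr0 addr0.
apply: le_Rintegral => //; last by move=> x _; exact: powR_tangent.
rewrite (_ : _ \o _ = ((EFin \o (fun=> (m `^ s)%R)) \+
   (EFin \o (fun x => s * m `^ (s - 1) * (y x - m))%R))%E)//; exact: integrableD.
Qed.

Lemma norm_cubeE d (p M : R) (g : d.-tuple R -> R) :
  measurable_fun setT g -> (forall t, `|g t| <= M) -> 0 < p ->
  norm_cube p (fun t => (g t)%:E) =
  ((\int[cube_prob]_t (`|g t| `^ p)) `^ p^-1)%:E.
Proof.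
move=> mg gM p0; rewrite /norm_cube unlock.
under eq_integral do rewrite abse_EFin poweR_EFin.
rewrite -poweR_EFin (EFin_Rintegral (probability_lty cube_prob) (M := M `^ p))//.
  apply: (measurableT_comp (measurable_powR p)); exact: measurableT_comp.
move=> t; rewrite ger0_norm ?powR_ge0// ler_powRl// ltW//.
Qed.

Lemma norm_cube_le2 d (p M : R) (g : d.-tuple R -> R) :
  measurable_fun setT g -> (forall t, `|g t| <= M) -> 1 <= p <= 2 ->
  (norm_cube p (fun t => (g t)%:E) <=
   (Num.sqrt (\int[cube_prob]_t (g t ^+ 2)))%:E)%E.
Proof.
move=> mg gM /andP[p1 p2].
have p0 : 0 < p by lra.
rewrite (norm_cubeE mg gM p0) lee_fin.
have mgp : measurable_fun setT (fun t => `|g t| `^ p).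
  apply: (measurableT_comp (measurable_powR p)); exact: measurableT_comp.
have gpM t : 0 <= `|g t| `^ p <= M `^ p by rewrite powR_ge0/= ler_powRl// ltW.
have s1 : 1 <= 2 / p by rewrite ler_pdivlMr// mul1r.
have := @Rintegral_jensen _ _ cube_prob _ _ _ s1 mgp gpM.
set I := \int[cube_prob]_t `|g t| `^ p.
have -> : \int[cube_prob]_t ((`|g t| `^ p) `^ (2 / p)) = \int[cube_prob]_t (g t ^+ 2).
  apply: eq_Rintegral => t _; rewrite -powRrM mulrCA divff ?gt_eqF// mulr1.
  by rewrite powR_mulrn// real_normK ?num_real.
move=> h; have I0 : 0 <= I by apply: Rintegral_ge0 => t _; exact: powR_ge0.
have -> : I `^ p^-1 = Num.sqrt ((I `^ (2 / p))).
  by rewrite -powR12_sqrt ?powR_ge0// -powRrM; congr (_ `^ _); field; rewrite gt_eqF.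
exact: ler_wsqrtr.
Qed.

Lemma powR_prod (I : Type) (r : seq I) (P : pred I) (a : I -> R) (p : R) :
  (forall i, 0 <= a i) ->
  (\prod_(i <- r | P i) a i) `^ p = \prod_(i <- r | P i) (a i `^ p).
Proof.
move=> a0; elim: r => [|i r IH]; first by rewrite !big_nil powR1.
rewrite !big_cons; case: ifP => // _.
by rewrite powRM ?IH// prodr_ge0.
Qed.

End norms.

Section kernel_norms.
Context {R : realType} {d : nat}.
Variables (W : 'I_d -> R -> R) (M : R).
Hypothesis kW : forall i, kernel_class (W i).
Hypothesis M1 : 1 <= M.
Hypothesis WM : forall i x, `|W i x| <= M.

Let G (u : d.-tuple R) := \prod_(i < d) W i (tnth u i).

Lemma measurable_kernel_prod : measurable_fun setT G.
Proof.
apply: measurable_prod => i _; have [mW _ _ _] := kW i.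
apply: (measurableT_comp mW); exact: measurable_tnth.
Qed.

Lemma kernel_prod_le u : `|G u| <= M ^+ d.
Proof.
rewrite /G normr_prod -[d in leRHS]card_ord -prodr_const.
by apply: ler_prod => i _; rewrite normr_ge0 WM.
Qed.

Definition kernel_pnorm (p : R) : R := \int[cube_prob]_u (`|G u| `^ p).

Lemma norm_kernelE (p : R) : 0 < p ->
  norm_kernel p W = (kernel_pnorm p `^ p^-1)%:E.
Proof. exact: (norm_cubeE measurable_kernel_prod kernel_prod_le). Qed.

(** Each factor has integral one, so [|W_i|] has integral at least one, and Bernoulli's inequality
    [1 + p (|W_i| - 1) <= |W_i|^p] is integrated. This supplies the margin into which additive
    errors are absorbed. *)
Lemma kernel_pnorm_ge1 (p : R) : 1 <= p -> 1 <= kernel_pnorm p.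
Proof.
move=> p1; have p0 : 0 < p by lra.
have mGp : measurable_fun setT (fun u => `|G u| `^ p).
  apply: (measurableT_comp (measurable_powR p)); apply: measurableT_comp => //.
  exact: measurable_kernel_prod.
rewrite -lee_fin (EFin_Rintegral (probability_lty cube_prob) mGp (M := (M ^+ d) `^ p)); last first.
  by move=> u; rewrite ger0_norm ?powR_ge0// ler_powRl ?(ltW p0)//; exact: kernel_prod_le.
have GE u : `|G u| `^ p = \prod_(i < d) (`|W i (tnth u i)| `^ p).
  by rewrite /G normr_prod powR_prod.
under eq_integral do rewrite GE.
rewrite (cube_prod (g := fun i x => `|W i x| `^ p)); last 2 first.
- move=> i; apply: (measurableT_comp (measurable_powR p)); apply: measurableT_comp => //.
  by have [] := kW i.
- by move=> i x; exact: powR_ge0.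
apply: (@le_trans _ _ (\prod_(i < d) 1%E)%E); first by rewrite big1.
apply: lee_prod_ge0 => i //.
have [mW _ _ W1] := kW i.
have m01 : measurable (`[0%R, 1%R]%classic : set R) by [].
have fin01 : ((@lebesgue_measure R) `[0%R, 1%R]%classic < +oo)%E.
  by rewrite lebesgue_measure_itv/= lte_fin ltr01 oppr0 adde0 ltry.
have bdi (g : R -> R) (B : R) : measurable_fun setT g -> (forall x, `|g x| <= B) ->
    lebesgue_measure.-integrable `[0%R, 1%R]%classic (EFin \o g).
  move=> mg gB; apply: measurable_bounded_integrable => //.
    exact: measurable_funTS.
  by exists B; split; [exact: num_real|move=> z Bz y _; exact: le_trans (gB y) (ltW Bz)].
have iW := bdi _ _ mW (WM i).
have iWn : lebesgue_measure.-integrable `[0%R, 1%R]%classic (EFin \o (fun x => p * (`|W i x| - 1))).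
  apply: (bdi _ (p * (M + 1))).
    apply: measurable_funM => //; apply: measurable_funB => //.
    exact: measurableT_comp.
  move=> x; rewrite normrM (gtr0_norm p0) ler_wpM2l ?(ltW p0)//.
  by rewrite (le_trans (ler_normB _ _))// normr_id normr1 lerD.
have iWa : lebesgue_measure.-integrable `[0%R, 1%R]%classic (EFin \o (fun x => `|W i x| - 1)).
  apply: (bdi _ (M + 1)).
    apply: measurable_funB => //; exact: measurableT_comp.
  by move=> x; rewrite (le_trans (ler_normB _ _))// normr_id normr1 lerD.
have icst (c : R) : lebesgue_measure.-integrable `[0%R, 1%R]%classic (EFin \o (fun=> c)).
  apply: (bdi _ `|c|) => //.
have leb01 : (@lebesgue_measure R) `[0%R, 1%R]%classic = 1%E.
  by rewrite lebesgue_measure_itv/= lte_fin ltr01 oppr0 adde0.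
have nW1 : 1 <= \int[lebesgue_measure]_(x in `[0%R, 1%R]) `|W i x|.
  have := @le_normr_Rintegral _ _ R (@lebesgue_measure R) _ _ m01 iW.
  by rewrite {1}/Rintegral W1 normr1.
apply: (@le_trans _ _ (\int[lebesgue_measure]_(x in `[0%R, 1%R]) (1 + p * (`|W i x| - 1))%R%:E)%E).
  under eq_integral do rewrite EFinD.
  rewrite integralD//=.
  rewrite [X in (X + _)%E](_ : _ = 1%E); last first.
    by transitivity (1 * (@lebesgue_measure R) `[0%R, 1%R]%classic)%E;
      [exact: integral_cst|rewrite leb01 mule1].
  have -> : (\int[lebesgue_measure]_(x in `[0%R, 1%R]) (p * (`|W i x| - 1))%:E =
     (p * (\int[lebesgue_measure]_(x in `[0%R, 1%R]) `|W i x| - 1))%:E)%E.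
    under eq_integral do rewrite EFinM.
    rewrite integralZl// [RHS]EFinM; congr (_ * _)%E.
    under eq_integral do rewrite EFinB.
    have iWn' := integrable_norm iW.
    set r := Rintegral _ _ _.
    have Hr : (\int[lebesgue_measure]_(x in `[0%R, 1%R]) `|W i x|%:E = r%:E)%E.
      by rewrite /r /Rintegral fineK//; apply: integrable_fin_num.
    have H1 : (\int[@lebesgue_measure R]_(x in `[0%R, 1%R]) (1 : R)%:E = (1 : R)%:E)%E.
      by transitivity (1 * (@lebesgue_measure R) `[0%R, 1%R]%classic)%E;
        [exact: integral_cst|rewrite leb01 mule1].
    transitivity (r%:E - 1%:E)%E; last by [].
    have HB := @integralB _ _ R (@lebesgue_measure R) _ m01 _ _ iWn' (icst 1).
    apply: (etrans HB); exact: (f_equal2 (fun a b => a - b)%E Hr H1).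
  by rewrite -EFinD lee_fin lerDl mulr_ge0 ?(ltW p0)// subr_ge0.
  exact: (icst 1).
apply: (@le_integral _ _ R (@lebesgue_measure R)) => //.
- apply: (bdi (fun x => 1 + p * (`|W i x| - 1)) (1 + p * (M + 1))).
    apply: measurable_funD => //; apply: measurable_funM => //.
    by apply: measurable_funB => //; exact: measurableT_comp.
  move=> x; rewrite (le_trans (ler_normD _ _))// normr1 lerD2l.
  rewrite normrM (gtr0_norm p0) ler_wpM2l ?(ltW p0)//.
  by rewrite (le_trans (ler_normB _ _))// normr_id normr1 lerD.
- apply: (bdi (fun x => `|W i x| `^ p) (M `^ p)).
    apply: (measurableT_comp (measurable_powR p)); exact: measurableT_comp.
  by move=> x; rewrite ger0_norm ?powR_ge0// ler_powRl// ltW.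
- by move=> x _; rewrite lee_fin; exact: powR_bernoulli.
Qed.

End kernel_norms.

Section iid_marginal.
Context d (T : measurableType d) (R : realType).

Lemma iid_marginal (mu : probability T R) n (Q : probability (n.-tuple T) R)
    (g : T -> R) (j : 'I_n) :
  iid_law mu Q -> measurable_fun setT g -> (forall x, 0 <= g x) ->
  (\int[Q]_x (g (tnth x j))%:E = \int[mu]_u (g u)%:E)%E.
Proof.
move=> QL mg g0.
pose G (i : 'I_n) u := if i == j then g u else 1.
transitivity (\int[Q]_x (\prod_(i < n) G i (tnth x i))%:E)%E.
  apply: eq_integral => x _; congr EFin.
  rewrite (bigD1 j)//= {1}/G eqxx big1 ?mulr1// => i ij.
  by rewrite /G (negbTE ij).
rewrite (iid_law_prod QL); last 2 first.
- move=> i; have [ij|ij] := boolP (i == j).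
    by rewrite (_ : G i = g)//; apply/funext => u; rewrite /G ij.
  by rewrite (_ : G i = cst 1)//; apply/funext => u; rewrite /G (negbTE ij).
- by move=> i x; rewrite /G; case: ifP.
rewrite (bigD1 j)//= [X in (X * _)%E](_ : _ = \int[mu]_u (g u)%:E)%E; last first.
  by apply: eq_integral => u _; rewrite /G eqxx.
rewrite big1 ?mule1// => i ij; rewrite -[RHS](integral_probability_cst mu).
by apply: eq_integral => u _; rewrite /G (negbTE ij).
Qed.

End iid_marginal.

Section kernel_moments.
Context {R : realType} {d : nat}.
Variables (W : 'I_d -> R -> R) (M : R).
Hypothesis kW : forall i, kernel_class (W i).
Hypothesis M1 : 1 <= M.
Hypothesis WM : forall i x, `|W i x| <= M.
Local Notation T := (d.-tuple R).
Local Notation Cw := (M ^+ d).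

Let M0 : 0 <= M. Proof. by rewrite (le_trans _ M1). Qed.
Let Cw0 : 0 < Cw. Proof. by rewrite exprn_gt0// (lt_le_trans _ M1). Qed.

Variables (n : nat) (h : T) (mu : probability T R) (Q : probability (n.-tuple T) R).
Hypothesis n0 : (0 < n)%N.
Hypothesis h0 : forall i, 0 < tnth h i.
Hypothesis QL : iid_law mu Q.

Let V0 : 0 < vol h := vol_gt0 h0.
Let n0R : 0 < n%:R :> R. Proof. by rewrite ltr0n. Qed.
Let KV t u : `|kern W h t u| <= Cw / vol h.
Proof. exact: kern_le. Qed.
Let CV0 : 0 <= Cw / vol h. Proof. by rewrite divr_ge0// ltW. Qed.

Let mK2 t : measurable_fun setT (fun u => kern W h t u ^+ 2).
Proof. by apply: measurable_funX; exact: measurable_kern_r. Qed.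

Let K2V t u : `|kern W h t u ^+ 2| <= (Cw / vol h) ^+ 2.
Proof. by rewrite normrX lerXn2r ?nnegrE. Qed.

Let mS t : measurable_fun [set: n.-tuple T] (kern_sqavg W h t).
Proof.
apply: measurable_funM => //; apply: measurable_sum => j.
by apply: (measurableT_comp (mK2 t)); exact: measurable_tnth.
Qed.

Let S_itv t (x : n.-tuple T) : 0 <= kern_sqavg W h t x <= (Cw / vol h) ^+ 2.
Proof. exact: kern_sqavg_itv. Qed.

Lemma EFin_kern_sqmean t :
  ((kern_sqmean W h mu t)%:E = \int[mu]_u (kern W h t u ^+ 2)%:E)%E.
Proof. exact: (EFin_Rintegral (probability_lty mu) (mK2 t) (K2V t)). Qed.

Lemma kern_sqavg_mean t :
  \int[Q]_x kern_sqavg W h t x = kern_sqmean W h mu t.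
Proof.
apply: EFin_inj.
rewrite (EFin_Rintegral (probability_lty Q) (M := (Cw / vol h) ^+ 2)); last 2 first.
- exact: mS.
- by move=> x; have /andP[h1 h2] := S_itv t x; rewrite ger0_norm.
rewrite EFin_kern_sqmean.
transitivity (\int[Q]_x ((n%:R^-1)%:E * \sum_(j < n) (kern W h t (tnth x j) ^+ 2)%:E))%E.
  by apply: eq_integral => x _; rewrite sumEFin -EFinM.
have mj j : measurable_fun [set: n.-tuple T] (fun x => (kern W h t (tnth x j) ^+ 2)%:E).
  by apply/measurable_EFinP; apply: (measurableT_comp (mK2 t)); exact: measurable_tnth.
have ge0 (j : 'I_n) (x : n.-tuple T) : setT x -> (0 <= (kern W h t (tnth x j) ^+ 2)%:E)%E.
  by move=> _; rewrite lee_fin sqr_ge0.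
rewrite ge0_integralZl//; last 2 first.
- exact: emeasurable_sum.
- by move=> x _; apply: sume_ge0 => j _; rewrite lee_fin sqr_ge0.
rewrite ge0_integral_sum//.
have K20 u : 0 <= kern W h t u ^+ 2 by exact: sqr_ge0.
under eq_bigr => j _ do rewrite (iid_marginal j QL (mK2 t) K20).
rewrite -EFin_kern_sqmean sumEFin sumr_const card_ord -EFinM; congr EFin.
by rewrite -[X in _ * X]mulr_natl mulKf// gt_eqF.
Qed.

Lemma kern_sqmean_jensen s t : 1 <= s ->
  (((vol h * kern_sqmean W h mu t) `^ s)%:E <=
   \int[Q]_x ((vol h * kern_sqavg W h t x) `^ s)%:E)%E.
Proof.
move=> s1; have s0 : 0 < s by lra.
have mVS : measurable_fun [set: n.-tuple T] (fun x => vol h * kern_sqavg W h t x).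
  by apply: measurable_funM => //; exact: mS.
have SV (x : n.-tuple T) : 0 <= vol h * kern_sqavg W h t x <= vol h * (Cw / vol h) ^+ 2.
  have /andP[h1 h2] := S_itv t x.
  by rewrite mulr_ge0 ?(ltW V0)//= ler_wpM2l// ltW.
have := Rintegral_jensen Q s1 mVS SV.
rewrite RintegralZl//; last first.
  apply: (bounded_integrable (probability_lty Q) (M := (Cw / vol h) ^+ 2)).
    exact: mS.
  by move=> x; have /andP[h1 h2] := S_itv t x; rewrite ger0_norm.
rewrite kern_sqavg_mean -lee_fin => /le_trans; apply.
rewrite (EFin_Rintegral (probability_lty Q) (M := (vol h * (Cw / vol h) ^+ 2) `^ s))//.
  exact: (measurableT_comp (measurable_powR s)).
move=> x; have /andP[h1 h2] := SV x.
by rewrite ger0_norm ?powR_ge0// ler_powRl// ltW.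
Qed.

(* [kap] keeps the exponent [lam] of the exponential moment in its admissible
   range at the points where the second moment of the kernel vanishes. *)
Lemma deviation_moment p kap t : 1 <= p -> 0 < kap ->
  Num.sqrt (p / kap) / 2 <= n%:R * vol h * rate n h / (4 * Cw) ->
  (\int[Q]_x ((`|(rate n h)^-1 * deviation W h mu t x|) `^ p)%:E <=
   (2 * (2 * Num.sqrt p) `^ p *
     (vol h * kern_sqmean W h mu t + kap) `^ (p / 2))%:E)%E.
Proof.
move=> p1 kap0 hk; have p0 : 0 < p by lra.
have r0 := rate_gt0 n0 h0; have rsq := rate_sq n0 h0.
have m0 : 0 <= vol h * kern_sqmean W h mu t.
  by rewrite mulr_ge0 ?(ltW V0)//; exact: kern_sqmean_ge0.
set m := vol h * kern_sqmean W h mu t.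
have mk0 : 0 < m + kap by rewrite ltr_wpDl.
pose sg := Num.sqrt (m + kap).
have sg0 : 0 < sg by rewrite sqrtr_gt0.
have sp0 : 0 < Num.sqrt p by rewrite sqrtr_gt0.
(* The minimizer of [lam^(-p) exp (2 lam^2 (m + kap))]. It gives [p / lam = 2 sqrt p * sg], and an
   exponent at most [p / 2], which [exp (- p)] compensates. *)
pose lam := Num.sqrt p / (2 * sg).
have lam0 : 0 < lam by rewrite divr_gt0// mulr_gt0.
have lam_le : `|lam / rate n h| <= n%:R * vol h / (4 * Cw).
  rewrite gtr0_norm; last by rewrite divr_gt0.
  rewrite ler_pdivrMr// (le_trans _ (le_trans hk _))//.
    have -> : lam = Num.sqrt (p / (m + kap)) / 2.
      rewrite /lam /sg sqrtrM ?(ltW p0)// sqrtrV ?(ltW mk0)//.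
      by rewrite invfM mulrA mulrAC.
    rewrite ler_wpM2r// ler_wsqrtr// ler_wpM2l ?(ltW p0)//.
    by rewrite lef_pV2 ?posrE// lerDr.
  by rewrite le_eqVlt; apply/orP; left; apply/eqP; ring.
have mdev : measurable_fun setT (deviation W h mu t : n.-tuple T -> R).
  exact: (measurable_section_r (measurable_deviation kW KV mu) t).
apply: (@le_trans _ _ (\int[Q]_x (((p / lam) `^ p * expR (- p))%:E *
    (expR `|lam / rate n h * deviation W h mu t x|)%:E))%E).
  apply: ge0_le_integral_nonmeasurable => x _; first by rewrite lee_fin powR_ge0.
  rewrite -EFinM lee_fin -[leRHS]mulrA -expRD.
  have := powR_le_expR p0 lam0 (normr_ge0 ((rate n h)^-1 * deviation W h mu t x)).
  have -> : lam * `|(rate n h)^-1 * deviation W h mu t x| - p =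
     - p + `|lam / rate n h * deviation W h mu t x|.
    by rewrite -[in LHS](gtr0_norm lam0) -normrM mulrA addrC.
  exact.
rewrite ge0_integralZl//; last 2 first.
- apply/measurable_EFinP; apply: measurableT_comp => //; apply: measurableT_comp => //.
  exact: measurable_funM.
- by rewrite lee_fin mulr_ge0 ?powR_ge0 ?expR_ge0.
have := deviation_abs_mgf kW h0 n0 KV Cw0 QL t lam_le.
have pl0 : (0 <= ((p / lam) `^ p * expR (- p))%:E)%E.
  by rewrite lee_fin mulr_ge0 ?powR_ge0 ?expR_ge0.
move=> /(lee_wpmul2l pl0) /le_trans; apply.
have -> : 2 * (lam / rate n h) ^+ 2 * kern_sqmean W h mu t / n%:R = 2 * lam ^+ 2 * m.
  rewrite exprMn exprVn rsq invrK /m.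
  by field; rewrite !gt_eqF.
have -> : 2 * lam ^+ 2 * m = p / 2 * (m / (m + kap)).
  rewrite /lam exprMn exprVn exprMn !sqr_sqrtr ?(ltW mk0) ?(ltW p0)//.
  by field; rewrite gt_eqF.
have -> : p / lam = 2 * Num.sqrt p * sg.
  rewrite /lam -{1}(sqr_sqrtr (ltW p0)); field; by rewrite !gt_eqF.
have -> : (m + kap) `^ (p / 2) = sg `^ p.
  by rewrite /sg -powR12_sqrt ?(ltW mk0)// -powRrM mulrC.
rewrite powRM ?mulr_ge0 ?(ltW sg0) ?(ltW sp0)// -EFinM lee_fin.
set a := (2 * Num.sqrt p) `^ p; set b := sg `^ p.
have ab0 : 0 <= a * b by rewrite mulr_ge0 ?powR_ge0.
have -> : a * b * expR (- p) * (2 * expR (p / 2 * (m / (m + kap)))) =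
    2 * a * b * expR (- p + p / 2 * (m / (m + kap))) by rewrite expRD; ring.
rewrite ler_piMr//; first by rewrite -mulrA mulr_ge0.
have : m / (m + kap) <= 1 by rewrite ler_pdivrMr// mul1r lerDl ltW.
rewrite expR_le1; move: (m / (m + kap)) => z z1; nra.
Qed.

(** Uniform in [n] and [h]; it is what keeps the random majorant [M_hat] of the order of the
    deterministic rate when [p > 2]. *)
Lemma kern_sqavg_moment s theta t B : 0 < s -> 0 < theta ->
  theta <= n%:R * vol h / (2 * Cw ^+ 2) ->
  vol h * kern_sqmean W h mu t <= B ->
  (\int[Q]_x ((vol h * kern_sqavg W h t x) `^ s)%:E <=
   ((s / theta) `^ s * expR (2 * theta * B))%:E)%E.
Proof.
move=> s0 th0 thn mB.
have S0 (x : n.-tuple T) : 0 <= vol h * kern_sqavg W h t x.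
  by rewrite mulr_ge0 ?(ltW V0)//; have /andP[] := S_itv t x.
have lam_le : 0 <= theta * vol h <= n%:R * vol h ^+ 2 / (2 * Cw ^+ 2).
  rewrite mulr_ge0 ?(ltW th0) ?(ltW V0)//=.
  have := ler_wpM2r (ltW V0) thn => /le_trans; apply.
  by rewrite le_eqVlt; apply/orP; left; apply/eqP; ring.
apply: (@le_trans _ _ (\int[Q]_x (((s / theta) `^ s)%:E *
    (expR (theta * vol h * kern_sqavg W h t x))%:E))%E).
  apply: ge0_le_integral_nonmeasurable => x _; first by rewrite lee_fin powR_ge0.
  rewrite -EFinM lee_fin -mulrA (le_trans (powR_le_expR s0 th0 (S0 x)))//.
  by rewrite ler_wpM2l ?powR_ge0// ler_expR gerBl ltW.
rewrite ge0_integralZl//; last 2 first.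
- apply/measurable_EFinP; apply: measurableT_comp => //; exact: measurable_funM.
- by rewrite lee_fin powR_ge0.
have st0 : (0 <= ((s / theta) `^ s)%:E)%E by rewrite lee_fin powR_ge0.
apply: (le_trans (lee_wpmul2l st0 (kern_sqavg_mgf kW h0 n0 KV Cw0 QL t lam_le))).
rewrite -EFinM lee_fin ler_wpM2l ?powR_ge0// ler_expR.
have -> : 2 * (theta * vol h) * kern_sqmean W h mu t =
     2 * theta * (vol h * kern_sqmean W h mu t) by ring.
by rewrite ler_wpM2l// mulr_ge0// ltW.
Qed.

End kernel_moments.

(** * The good event *)

Section subcubes.
Context {R : realType} {d : nat}.
Local Notation leb := (lebesgue_tuple R d).
Local Notation cube := (@cube R d).

(** Superadditivity of the inverse power, [powR_addr_le] with exponent [1 / s]. *)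
Lemma powR_add_le (s x y : R) : 0 < s <= 1 -> 0 <= x -> 0 <= y ->
  (x + y) `^ s <= x `^ s + y `^ s.
Proof.
move=> /andP[s0 s1] x0 y0.
have si1 : 1 <= s^-1 by rewrite invf_ge1.
have sk z : 0 <= z -> (z `^ s) `^ s^-1 = z.
  by move=> z0; rewrite -powRrM mulfV ?gt_eqF// powRr1.
have := powR_addr_le si1 (powR_ge0 x s) (powR_ge0 y s).
rewrite !sk// => /(ler_powRl (ltW s0)).
by rewrite -powRrM mulVf ?gt_eqF// powRr1 ?addr_ge0 ?powR_ge0//; apply => //.
Qed.

Lemma powR_sum_le (I : Type) (r : seq I) (s : R) (a : I -> R) : 0 < s <= 1 ->
  (forall i, 0 <= a i) -> (\sum_(i <- r) a i) `^ s <= \sum_(i <- r) a i `^ s.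
Proof.
move=> s01 a0; elim: r => [|i r IH].
  by have /andP[s0 _] := s01; rewrite !big_nil powR0// gt_eqF.
rewrite !big_cons; apply: le_trans (lerD (lexx _) IH).
by apply: powR_add_le => //; exact: sumr_ge0.
Qed.

(** From [ln p = 2 ln (sqrt p) <= 2 sqrt p] follows [4 sqrt p * ln p <= 8 p], well below
    [14.7 p]. *)
Lemma Cstar_ge (p : R) : 2 < p -> 4 * Num.sqrt p <= Cstar p.
Proof.
move=> p2; have p0 : 0 < p by lra.
have sp0 : 0 < Num.sqrt p by rewrite sqrtr_gt0.
have lp0 : 0 < ln p by rewrite ln_gt0//; lra.
rewrite /Cstar ler_pdivlMr//.
have pE := sqr_sqrtr (ltW p0).
have : ln p <= 2 * Num.sqrt p.
  have -> : ln p = 2 * ln (Num.sqrt p) by rewrite -[in LHS]pE lnXn// mulr_natl.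
  rewrite ler_wpM2l//; have x1 : -1 < Num.sqrt p - 1 by lra.
  have := le_ln1Dx x1; rewrite (_ : 1 + (Num.sqrt p - 1) = Num.sqrt p); last by ring.
  lra.
move=> /(ler_wpM2l (ltW sp0)); rewrite mulrCA -expr2 pE => h.
have -> : 4 * Num.sqrt p * ln p = 4 * (Num.sqrt p * ln p) by ring.
lra.
Qed.

(** Bounding [x + y] by twice the larger term costs [2^(p/2)]. With the leading [2] this is
    [2^(1 + p/2) <= 2^p], which is exactly the passage from [2 sqrt p] to [4 sqrt p]. *)
Lemma moment_constant_le (p x y : R) : 2 < p -> 0 <= x -> 0 <= y ->
  2 * (2 * Num.sqrt p) `^ p * (x + y) `^ (p / 2) <=
  (4 * Num.sqrt p) `^ p * (x `^ (p / 2) + y `^ (p / 2)).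
Proof.
move=> p2 x0 y0; have p0 : 0 < p by lra.
have q0 : 0 <= p / 2 by lra.
have sp0 := sqrtr_ge0 p.
have -> : 4 * Num.sqrt p = 2 * (2 * Num.sqrt p) by ring.
rewrite [in leRHS]powRM ?mulr_ge0//.
have H : 2 * (x + y) `^ (p / 2) <= 2 `^ p * (x `^ (p / 2) + y `^ (p / 2)).
  have h1 : (x + y) `^ (p / 2) <= 2 `^ (p / 2) * (x `^ (p / 2) + y `^ (p / 2)).
    have [xy|xy] := leP x y.
      apply: (@le_trans _ _ ((2 * y) `^ (p / 2))).
        by apply: ler_powRl; rewrite ?addr_ge0//; lra.
      by rewrite powRM// ler_wpM2l ?powR_ge0// lerDr powR_ge0.
    apply: (@le_trans _ _ ((2 * x) `^ (p / 2))).
      by apply: ler_powRl; rewrite ?addr_ge0//; lra.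
    by rewrite powRM// ler_wpM2l ?powR_ge0// lerDl powR_ge0.
  have h2 : 2 * 2 `^ (p / 2) <= 2 `^ p :> R.
    rewrite -{1}[2]powRr1// -powRD ?pnatr_eq0 ?implybT// ler_powR ?ler1n//; lra.
  apply: (le_trans (ler_wpM2l _ h1)) => //.
  by rewrite mulrA ler_wpM2r// addr_ge0 ?powR_ge0.
have := ler_wpM2l (powR_ge0 (2 * Num.sqrt p) p) H.
move: ((2 * Num.sqrt p) `^ p) (2 `^ p) => a b'; nra.
Qed.

Lemma measurable_subcube (e : {ffun 'I_d -> bool}) : measurable (@subcube R d e).
Proof.
exact: (@measurable_box R d (fun i => `](e i)%:R / 2, (1 + (e i)%:R) / 2[%classic)).
Qed.

Lemma lebesgue_tuple_hyperplane (i : 'I_d) (a : R) :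
  leb [set t | tnth t i = a] = 0%E.
Proof.
pose A j : set R := if j == i then [set a] else setT.
have mA j : measurable (A j) by rewrite /A; case: ifP.
rewrite (_ : [set _ | _] = [set t | forall j, A j (tnth t j)]); last first.
  apply/seteqP; split => t /= ta.
    by move=> j; rewrite /A; case: eqP => [->|].
  by have := ta i; rewrite /A eqxx.
by rewrite (lebesgue_tuple_box mA) (bigD1 i)//= {1}/A eqxx lebesgue_measure_set1 mul0e.
Qed.

Lemma subcube_cube e : @subcube R d e `<=` cube.
Proof.
move=> t te i; have := te i; rewrite !in_itv/=; case: (e i) => /=; lra.
Qed.

(** The open subcubes miss only the hyperplanes on which some coordinate is [0], [1/2] or [1]. *)
Lemma cube_subcubes_ae : {ae leb, forall t, cube t ->
  exists e, @subcube R d e t}.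
Proof.
have N (i : 'I_d) (a : R) : leb.-negligible [set t | tnth t i = a].
  apply/negligibleP; last exact: lebesgue_tuple_hyperplane.
  rewrite (_ : [set _ | _] = (fun t : d.-tuple R => tnth t i) @^-1` [set a])//.
  by rewrite -[X in measurable X]setTI; exact: measurable_tnth.
have H : {ae leb, forall t i, [/\ tnth t i <> 0, tnth t i <> 2^-1 & tnth t i <> 1]}.
  apply/(@filter_forall _ _ _ _ (ae_filter_ringOfSetsType leb)) => i.
  apply: (negligibleS _ (negligibleU (N i 0) (negligibleU (N i 2^-1) (N i 1)))).
  move=> t /= H; apply: contrapT => /not_orP[n0 /not_orP[n1 n2]].
  by apply: H; split.
apply: filterS H => t tN tc.
exists [ffun i => 2^-1 < tnth t i] => i.
have [n0 n1 n2] := tN i; have := tc i.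
rewrite ffunE !in_itv/= => /andP[t0 t1].
have t0' : 0 < tnth t i by rewrite lt_neqAle t0 andbT eq_sym; apply/eqP.
have t1' : tnth t i < 1 by rewrite lt_neqAle t1 andbT; apply/eqP.
have [x1|x1] := ltP 2^-1 (tnth t i) => /=; first by apply/andP; split; lra.
have x1' : tnth t i < 2^-1 by rewrite lt_neqAle x1 andbT; apply/eqP.
by apply/andP; split; lra.
Qed.

Lemma integral_cube_le_subcubes (g : d.-tuple R -> \bar R) :
  measurable_fun [set: d.-tuple R] g -> (forall t, 0 <= g t)%E ->
  (\int[leb]_(t in cube) g t <=
   \sum_(e : {ffun 'I_d -> bool}) \int[leb]_(t in @subcube R d e) g t)%E.
Proof.
move=> mg g0; rewrite integral_mkcond.
under eq_bigr do rewrite integral_mkcond.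
have mr (D : set (d.-tuple R)) : measurable D -> measurable_fun setT (g \_ D).
  by move=> mD; apply/(measurable_restrictT g mD); exact: measurable_funTS.
have r0 (D : set (d.-tuple R)) t : (0 <= (g \_ D) t)%E.
  by rewrite patchE; case: ifP.
rewrite -ge0_integral_sum//; last by move=> e; apply: mr; exact: measurable_subcube.
apply: ae_ge0_le_integral => //.
- by apply: mr; exact: measurable_cube.
- by move=> t _; apply: sume_ge0.
- by apply: emeasurable_sum => e; apply: mr; exact: measurable_subcube.
apply: filterS cube_subcubes_ae => t tc _.
rewrite {1}patchE; case: ifPn => [/set_mem/tc [e te]|_]; last exact: sume_ge0.
rewrite (bigD1 e)//= {1}patchE mem_set// leeDl//; exact: sume_ge0.
Qed.

Section Lambda_hat_bounds.
Variables (W : 'I_d -> R -> R) (M : R).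
Hypothesis kW : forall i, kernel_class (W i).
Hypothesis M1 : 1 <= M.
Hypothesis WM : forall i x, `|W i x| <= M.

(** Relates the quantities per subcube to one integral over the whole cube: each is at most [lam] by
    monotonicity, and their sum is at least [lam] because the power [1/p] is subadditive. The first
    bound controls [M_hat] from above, the second from below. *)
Lemma Lambda_hat_bounds n (h : d.-tuple R) (p : R) (x : n.-tuple (d.-tuple R)) :
  (0 < n)%N -> (forall i, 0 < tnth h i) -> 2 < p ->
  let lam := (\int[cube_prob]_t ((vol h * kern_sqavg W h t x) `^ (p / 2))) `^ p^-1 in
  exists a : {ffun 'I_d -> bool} -> R,
    [/\ forall e, Lambda_hat x e W h p = (a e)%:E, forall e, 0 <= a e <= lam &
      lam <= \sum_e a e].
Proof.
move=> n0 h0 p2 lam.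
have p0 : 0 < p by lra.
have q0 : 0 <= p / 2 by lra.
have pi01 : 0 < p^-1 <= 1 by rewrite invr_gt0 p0/= invf_le1//; lra.
have V0 := vol_gt0 h0.
have Cw0 : 0 < M ^+ d by rewrite exprn_gt0// (lt_le_trans _ M1).
have M0 : 0 <= M by exact: le_trans M1.
have KV t u : `|kern W h t u| <= M ^+ d / vol h by exact: kern_le.
pose S t := kern_sqavg W h t x.
have mS : measurable_fun setT S.
  exact: (measurable_section_l (measurable_kern_sqavg (n := n) h kW) x).
have S_itv t : 0 <= S t <= (M ^+ d / vol h) ^+ 2 by exact: kern_sqavg_itv.
have S0 t : 0 <= S t by have /andP[] := S_itv t.
pose g t := S t `^ (p / 2).
have mg : measurable_fun setT g by exact: (measurableT_comp (measurable_powR _)).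
have mgE : measurable_fun setT (EFin \o g) by exact/measurable_EFinP.
have gG t : `|g t| <= ((M ^+ d / vol h) ^+ 2) `^ (p / 2).
  by rewrite ger0_norm ?powR_ge0// ler_powRl//; have /andP[] := S_itv t.
pose a0 := \int[cube_prob]_t g t.
have a0E : (\int[leb]_(t in cube) (g t)%:E = a0%:E)%E.
  rewrite (EFin_Rintegral (probability_lty cube_prob) mg gG) cube_probE.
  by rewrite ge0_integral_cube// => t; rewrite lee_fin powR_ge0.
have Ile e : (0 <= \int[leb]_(t in @subcube R d e) (g t)%:E <= a0%:E)%E.
  rewrite integral_ge0/=; last by move=> t _; rewrite lee_fin powR_ge0.
  rewrite -a0E; apply: ge0_subset_integral => //.
  - exact: measurable_subcube.
  - exact: measurable_cube.
  - exact: measurable_funTS.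
  - by move=> t _; rewrite lee_fin powR_ge0.
  - exact: subcube_cube.
pose r e := fine (\int[leb]_(t in @subcube R d e) (g t)%:E)%E.
have rE e : (\int[leb]_(t in @subcube R d e) (g t)%:E = (r e)%:E)%E.
  have /andP[h1 h2] := Ile e.
  by rewrite fineK// ge0_fin_numE// (le_lt_trans h2)// ltry.
have r_itv e : 0 <= r e <= a0 by have := Ile e; rewrite rE !lee_fin.
have ra : a0 <= \sum_e r e.
  rewrite -lee_fin -a0E -sumEFin; under eq_bigr do rewrite -rE.
  by apply: integral_cube_le_subcubes => // t; rewrite lee_fin powR_ge0.
have lamE : lam = Num.sqrt (vol h) * a0 `^ p^-1.
  rewrite /lam; under eq_Rintegral.
    move=> t _; rewrite -/(S t) powRM ?(ltW V0)//; over.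
  rewrite RintegralZl//; last first.
    exact: (bounded_integrable (probability_lty cube_prob) mg gG).
  rewrite powRM ?powR_ge0//; last by apply: Rintegral_ge0 => t _; exact: powR_ge0.
  rewrite -powRrM mulrAC mulfV ?gt_eqF// mul1r powR12_sqrt// ltW//.
exists (fun e => Num.sqrt (vol h) * r e `^ p^-1); split.
- by move=> e; rewrite /Lambda_hat -/(S _) [X in (_ * X `^ _)%E]rE poweR_EFin.
- move=> e; have /andP[h1 h2] := r_itv e.
  rewrite mulr_ge0 ?sqrtr_ge0 ?powR_ge0//= lamE ler_wpM2l ?sqrtr_ge0//.
  by rewrite ler_powRl// invr_ge0 ltW.
- rewrite lamE -mulr_sumr ler_wpM2l ?sqrtr_ge0//.
  apply: (le_trans _ (powR_sum_le _ pi01 _)); last by move=> e; have /andP[] := r_itv e.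
  apply: ler_powRl => //; first by rewrite invr_ge0 ltW.
  by apply: Rintegral_ge0 => t _; exact: powR_ge0.
Qed.

End Lambda_hat_bounds.

End subcubes.

Section good_event.
Context {R : realType} {d : nat}.
Variables (W : 'I_d -> R -> R) (M : R).
Hypothesis kW : forall i, kernel_class (W i).
Hypothesis M1 : 1 <= M.
Hypothesis WM : forall i x, `|W i x| <= M.
Local Notation T := (d.-tuple R).
Local Notation Cw := (M ^+ d).

Let M0 : 0 <= M. Proof. by rewrite (le_trans _ M1). Qed.
Let Cw0 : 0 < Cw. Proof. by rewrite exprn_gt0// (lt_le_trans _ M1). Qed.

(* The point [x] of the sample space does as well as the selection rule expects:
   the stochastic error is dominated by the random majorant, which itself is of
   the order of the deterministic rate. *)
Definition good_point (p tau CM : R) n (l : d.-tuple nat) (mu : probability T R)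
    (x : n.-tuple T) : Prop :=
  (norm_cube p (fun t => (deviation W (hexp R l) mu t x)%:E) <=
     (1 + tau)%:E * M_hat W p x l)%E /\
  (M_hat W p x l <= (CM * rate n (hexp R l))%:E)%E.

Lemma sum_cube_signs (a : R) :
  (\sum_(e : {ffun 'I_d -> bool}) a%:E = (2 ^+ d * a)%:E)%E.
Proof.
rewrite sumEFin sumr_const card_ffun card_bool card_ord.
by rewrite -[a *+ _]mulr_natl natrX.
Qed.

Lemma kernel_sqnormE : kernel_sqnorm W = (kernel_pnorm W 2)%:E.
Proof.
rewrite /kernel_pnorm (EFin_Rintegral (probability_lty cube_prob) (M := Cw `^ 2)).
- apply: eq_integral => u _; congr EFin.
  by rewrite powR_mulrn// real_normK// num_real.
- apply: (measurableT_comp (measurable_powR 2)); apply: measurableT_comp => //.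
  exact: measurable_kernel_prod.
- move=> u; rewrite ger0_norm ?powR_ge0// ler_powRl//.
  exact: kernel_prod_le.
Qed.

(* For [p <= 2] the L_p norm is bounded by the L_2 norm, whose mean has the
   variance bound; the slack [tau] pays for the fluctuation. *)
Lemma good_event_le2 (B p tau b c : R) : 1 <= p <= 2 -> 0 < tau -> 0 < b -> 0 < c ->
  exists C CM : R, [/\ 0 < C, 0 < CM &
  forall (n : nat) (l : d.-tuple nat) (mu : probability T R)
    (Q : probability (n.-tuple T) R),
  (2 <= n)%N -> admissible n c (hexp R l) ->
  (forall t, mu (box (hexp R l) t) <= (B * vol (hexp R l))%:E)%E -> iid_law mu Q ->
  exists Bad : set (n.-tuple T),
    [/\ measurable Bad, (Q Bad <= (C * expR (- b * ln n%:R))%:E)%E &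
      forall x, ~ Bad x -> good_point p tau CM l mu x]].
Proof.
move=> /andP[p1 p2] tau0 b0 c0; have p0 : 0 < p by lra.
pose k2 := kernel_pnorm W 2.
have k21 : 1 <= k2 by apply: (kernel_pnorm_ge1 kW WM); rewrite ler1n.
have k20 : 0 < k2 by exact: lt_le_trans ltr01 k21.
(* The tolerance is [tau] times the bound [2^d k2] on the mean of the normalized squared norm, so
   the total is [(1 + tau)] times that bound. *)
pose dd := 2 ^+ d * k2 * tau.
have dd0 : 0 < dd by rewrite !mulr_gt0// exprn_gt0.
have s2 : 1 <= 2 :> R by rewrite ler1n.
have [C C0 H] := deviation_concentration kW M1 WM B s2 dd0 b0 c0.
pose a := 2 `^ (- (d%:R * (2 - p) / (2 * p))) : R.
have a0 : 0 < a by exact: powR_gt0.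
pose CM := 2 ^+ d * (a * Num.sqrt k2).
have CM0 : 0 < CM by rewrite !mulr_gt0 ?exprn_gt0// sqrtr_gt0.
exists C, CM; split => // n l mu Q n2 adm muB QL.
have [Bad [mB QB hB]] := H n _ mu Q n2 adm muB QL.
exists Bad; split => // x /hB {hB}.
set h := hexp R l.
have n0 : (0 < n)%N by exact: leq_trans n2.
have n0R : 0 < n%:R :> R by rewrite ltr0n.
have [h0 hV _] := adm; have v0 := vol_gt0 h0.
have r0 : 0 < rate n h by exact: rate_gt0.
have rsq : rate n h ^+ 2 = (n%:R * vol h)^-1 by exact: rate_sq.
have KV t u : `|kern W h t u| <= Cw / vol h by exact: kern_le.
have ME : M_hat W p x l = (CM * rate n h)%:E.
  rewrite /M_hat /Gamma_hat p2 (norm_kernelE kW WM) ?ltr0n//.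
  rewrite -/k2 powR12_sqrt ?(ltW k20)// -EFinM sum_cube_signs -EFinM.
  by rewrite mulrC.
rewrite /good_point ME; move=> hx; split; last by [].
have mdev : measurable_fun setT (fun t => deviation W h mu t x).
  exact: (measurable_section_l (measurable_deviation kW KV mu) x).
have devM t : `|deviation W h mu t x| <= 2 * (Cw / vol h) by exact: deviation_le.
have p12 : 1 <= p <= 2 by rewrite p1.
apply: (le_trans (norm_cube_le2 mdev devM p12)).
rewrite -EFinM lee_fin.
have key : \int[cube_prob]_t (deviation W h mu t x ^+ 2) <=
    rate n h ^+ 2 * (2 ^+ d * k2 * (1 + tau)).
  have m2 : measurable_fun setT (fun t => deviation W h mu t x ^+ 2).
    exact: measurable_funX.
  have b2 t : `|deviation W h mu t x ^+ 2| <= (2 * (Cw / vol h)) ^+ 2.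
    by rewrite normrX lerXn2r ?nnegrE// (le_trans (normr_ge0 _) (devM t)).
  have sqE t (y : n.-tuple T) : `|(rate n h)^-1 * deviation W h mu t y| `^ 2 =
      (rate n h ^+ 2)^-1 * (deviation W h mu t y) ^+ 2.
    by rewrite powR_mulrn// real_normK ?num_real// exprMn exprVn.
  have r2i0 : 0 <= (rate n h ^+ 2)^-1 by rewrite invr_ge0 sqr_ge0.
  move: hx; under eq_integral do rewrite sqE EFinM.
  rewrite ge0_integralZl//; last 2 first.
  - exact/measurable_EFinP.
  - by move=> t _; rewrite lee_fin sqr_ge0.
  rewrite -(EFin_Rintegral (probability_lty cube_prob) m2 b2) => hx.
  have h2 : (\int[cube_prob]_t \int[Q]_y (`|(rate n h)^-1 * deviation W h mu t y| `^ 2)%:E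
     <= (2 ^+ d * k2)%:E)%E.
    apply: (@le_trans _ _ (\int[cube_prob]_t ((vol h)%:E *
        \int[mu]_u (kern W h t u ^+ 2)%:E))%E).
      apply: ge0_le_integral_nonmeasurable => t _.
        by apply: integral_ge0 => y _; rewrite lee_fin powR_ge0.
      under eq_integral do rewrite sqE EFinM.
      have mdev' : measurable_fun [set: n.-tuple T] (fun y => deviation W h mu t y).
        exact: (measurable_section_r (measurable_deviation kW KV mu) t).
      rewrite ge0_integralZl//; last 2 first.
      - by apply/measurable_EFinP; exact: measurable_funX.
      - by move=> y _; rewrite lee_fin sqr_ge0.
      have e1 : (0 <= ((rate n h ^+ 2)^-1)%:E)%E by rewrite lee_fin.
      apply: (le_trans (lee_wpmul2l e1 (deviation_second_moment kW h0 n0 KV Cw0 QL t))).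
      rewrite -(EFin_kern_sqmean kW M1 WM mu h0) -!EFinM lee_fin rsq invrK.
      by rewrite le_eqVlt; apply/orP; left; apply/eqP; field; rewrite gt_eqF.
    have mK2 : measurable_fun setT (fun z : T * T => (kern W h z.1 z.2 ^+ 2)%:E).
      by apply/measurable_EFinP; apply: measurable_funX; exact: measurable_kern.
    rewrite ge0_integralZl//; last 3 first.
    - apply: (measurable_fun_fubini_tonelli_F (m2 := mu)
        (fun z : T * T => (kern W h z.1 z.2 ^+ 2)%:E)) => //.
      by move=> z; rewrite lee_fin sqr_ge0.
    - by move=> t _; apply: integral_ge0 => u _; rewrite lee_fin sqr_ge0.
    - by rewrite lee_fin ltW.
    (* Integrating in [t] first brings out the kernel norm [k2], which is what [M_hat] contains, and
       keeps the unknown bound on the density out. *)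
    rewrite (fubini_tonelli (m1 := cube_prob) (m2 := mu)
      (fun z : T * T => (kern W h z.1 z.2 ^+ 2)%:E))//; last first.
      by move=> z; rewrite lee_fin sqr_ge0.
    apply: (@le_trans _ _ ((vol h)%:E * \int[mu]_u (2 ^+ d / vol h * k2)%:E)%E).
      apply: lee_wpmul2l; first by rewrite lee_fin ltW.
      apply: ge0_le_integral_nonmeasurable => u _.
        by apply: integral_ge0 => t _; rewrite lee_fin sqr_ge0.
      have := kern_sq_integral u kW h0; rewrite kernel_sqnormE -EFinM; exact.
    rewrite integral_probability_cst -EFinM lee_fin.
    by rewrite le_eqVlt; apply/orP; left; apply/eqP; field; rewrite gt_eqF.
  have := le_trans hx (leeD2r _ h2); rewrite -EFinM -EFinD lee_fin => h3.
  have r20 : 0 < rate n h ^+ 2 by rewrite exprn_gt0.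
  rewrite -ler_pdivrMl//; apply: (le_trans h3).
  by rewrite le_eqVlt; apply/orP; left; apply/eqP; rewrite /dd; ring.
apply: (@le_trans _ _ (Num.sqrt (rate n h ^+ 2 * (2 ^+ d * k2 * (1 + tau))))).
  exact: ler_wsqrtr.
have t1 : 0 <= 1 + tau by lra.
rewrite sqrtrM ?sqr_ge0// sqrtr_sqr gtr0_norm//.
have -> : (1 + tau) * (CM * rate n h) = rate n h * (CM * (1 + tau)) by ring.
rewrite ler_wpM2l ?(ltW r0)//.
rewrite sqrtrM ?mulr_ge0 ?exprn_ge0 ?(ltW k20)//.
apply: ler_pM; rewrite ?sqrtr_ge0//; last first.
  rewrite -[leRHS]ger0_norm// -sqrtr_sqr ler_wsqrtr// expr2 ler_peMl//; lra.
rewrite sqrtrM ?exprn_ge0// /CM mulrA ler_wpM2r ?sqrtr_ge0//.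
(* The factor [2^(d/2)] coming from the two-sided kernel bound faces [2^d] subcubes times
   [2^(-d(2-p)/(2p))]; the exponents differ by [d (p - 1) / p], which is nonnegative. *)
rewrite -powR12_sqrt ?exprn_ge0// -powR_mulrn// -powRrM /a.
rewrite -powRD; last by rewrite pnatr_eq0 implybT.
rewrite ler_powR ?ler1n//.
have d0 : 0 <= d%:R :> R by rewrite ler0n.
rewrite -subr_ge0.
have -> : d%:R + - (d%:R * (2 - p) / (2 * p)) - d%:R / 2 =
   d%:R * ((p - 1) / p) by field; rewrite gt_eqF.
by rewrite mulr_ge0// divr_ge0 ?(ltW p0)// subr_ge0.
Qed.

End good_event.

Section good_event_gt2.
Context {R : realType} {d : nat}.
Variables (W : 'I_d -> R -> R) (M : R).
Hypothesis kW : forall i, kernel_class (W i).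
Hypothesis M1 : 1 <= M.
Hypothesis WM : forall i x, `|W i x| <= M.
Local Notation T := (d.-tuple R).
Local Notation Cw := (M ^+ d).

Let M0 : 0 <= M. Proof. by rewrite (le_trans _ M1). Qed.
Let Cw0 : 0 < Cw. Proof. by rewrite exprn_gt0// (lt_le_trans _ M1). Qed.

(* The constant [4 sqrt p] must not exceed [Cstar p]. *)
Lemma mean_deviation_moment_le (p : R) n (h : T) (mu : probability T R)
    (Q : probability (n.-tuple T) R) : 2 < p -> (0 < n)%N ->
  (forall i, 0 < tnth h i) -> iid_law mu Q ->
  let kap := (1 / 3) `^ (2 / p) in
  Num.sqrt (p / kap) / 2 <= n%:R * vol h * rate n h / (4 * Cw) ->
  (\int[cube_prob]_t \int[Q]_y ((`|(rate n h)^-1 * deviation W h mu t y|) `^ p)%:E <=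
   ((4 * Num.sqrt p) `^ p)%:E *
    (\int[cube_prob]_t \int[Q]_y ((vol h * kern_sqavg W h t y) `^ (p / 2))%:E + (1 / 3)%:E))%E.
Proof.
move=> p2 n0 h0 QL kap hk; have p0 : 0 < p by lra.
have p1 : 1 <= p by lra.
have q1 : 1 <= p / 2 by lra.
have kap0 : 0 < kap by rewrite powR_gt0//; lra.
have kapE : kap `^ (p / 2) = 1 / 3.
  rewrite /kap -powRrM (_ : 2 / p * (p / 2) = 1); last by field; rewrite gt_eqF.
  by rewrite powRr1// divr_ge0.
have V0 := vol_gt0 h0.
have KV t u : `|kern W h t u| <= Cw / vol h by exact: kern_le.
set cp := (4 * Num.sqrt p) `^ p.
have cp0 : 0 <= cp by exact: powR_ge0.
have mVS : measurable_fun setT (fun z : T * n.-tuple T =>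
    ((vol h * kern_sqavg W h z.1 z.2) `^ (p / 2))%:E).
  apply/measurable_EFinP; apply: (measurableT_comp (measurable_powR _)).
  apply: measurable_funM => //; exact: measurable_kern_sqavg.
have mI : measurable_fun setT
    (fun t => \int[Q]_y ((vol h * kern_sqavg W h t y) `^ (p / 2))%:E)%E.
  apply: (measurable_fun_fubini_tonelli_F (m2 := Q)
    (fun z : T * n.-tuple T => ((vol h * kern_sqavg W h z.1 z.2) `^ (p / 2))%:E)) => //.
  by move=> z; rewrite lee_fin powR_ge0.
have I0 t : (0 <= \int[Q]_y ((vol h * kern_sqavg W h t y) `^ (p / 2))%:E)%E.
  by apply: integral_ge0 => y _; rewrite lee_fin powR_ge0.
apply: (@le_trans _ _ (\int[cube_prob]_t (cp%:E *
   (\int[Q]_y ((vol h * kern_sqavg W h t y) `^ (p / 2))%:E + (1 / 3)%:E)))%E).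
  apply: ge0_le_integral_nonmeasurable => t _.
    by apply: integral_ge0 => y _; rewrite lee_fin powR_ge0.
  apply: (le_trans (deviation_moment kW M1 WM n0 h0 QL t p1 kap0 hk)).
  have m0 : 0 <= vol h * kern_sqmean W h mu t.
    by rewrite mulr_ge0 ?(ltW V0)//; exact: kern_sqmean_ge0.
  have J := kern_sqmean_jensen kW M1 WM n0 h0 QL t q1.
  apply: (@le_trans _ _ (cp%:E * ((((vol h * kern_sqmean W h mu t) `^ (p / 2)))%:E + (1 / 3)%:E))%E).
    rewrite -EFinD -EFinM lee_fin -kapE.
    exact: (moment_constant_le p2 m0 (ltW kap0)).
  by apply: lee_wpmul2l; [rewrite lee_fin|exact: leeD2r].
rewrite ge0_integralZl//; last 2 first.
- by apply: emeasurable_funD => //.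
- by move=> t _; rewrite adde_ge0// lee_fin; lra.
apply: lee_wpmul2l; first by rewrite lee_fin.
by rewrite ge0_integralD// integral_probability_cst.
Qed.

(** Three errors of [1/3] arise: the regularization [kap] and the two concentration steps. Together
    they fit into [v], the p-th power of the kernel norm, which is at least one. *)
Let slack (z u v : R) : 1 <= z -> 1 <= v ->
  z * (u + 1 / 3 + 1 / 3) + 1 / 3 <= z * (u + v).
Proof. by move=> z1 v1; nra. Qed.

Lemma good_event_gt2 (B p tau b c : R) : 2 < p -> 0 < tau -> 0 < b -> 0 < c ->
  exists C CM : R, [/\ 0 < C, 0 < CM &
  forall (n : nat) (l : d.-tuple nat) (mu : probability T R)
    (Q : probability (n.-tuple T) R),
  (2 <= n)%N -> admissible n c (hexp R l) ->
  (forall t, mu (box (hexp R l) t) <= (B * vol (hexp R l))%:E)%E -> iid_law mu Q ->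
  exists Bad : set (n.-tuple T),
    [/\ measurable Bad, (Q Bad <= (C * expR (- b * ln n%:R))%:E)%E &
      forall x, ~ Bad x -> good_point W p tau CM l mu x]].
Proof.
move=> p2 tau0 b0 c0; have p0 : 0 < p by lra.
have p1 : 1 <= p by lra.
have q1 : 1 <= p / 2 by lra.
have q0 : 0 < p / 2 by lra.
have t3 : 0 < 1 / 3 :> R by lra.
have [C1 C10 H1] := deviation_concentration kW M1 WM B p1 t3 b0 c0.
have [C2 C20 H2] := kern_sqavg_concentration kW M1 WM B q1 t3 b0 c0.
pose kap := (1 / 3) `^ (2 / p) : R.
have kap0 : 0 < kap by rewrite powR_gt0.
(* The hypothesis of [deviation_moment] amounts to [rho <= sqrt (n V)]. Since [n V >= (ln n)^c], it
   holds as soon as [ln n >= L1]. *)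
pose rho := 2 * Cw * Num.sqrt (p / kap).
have rho0 : 0 < rho by rewrite !mulr_gt0// sqrtr_gt0 divr_gt0.
pose L1 := (rho ^+ 2) `^ c^-1.
pose theta := ln 2 `^ c / (2 * Cw ^+ 2) : R.
have theta0 : 0 < theta.
  by rewrite divr_gt0 ?powR_gt0 ?ln_gt0 ?ltr1n// mulr_gt0// exprn_gt0.
pose Bd := (p / 2 / theta) `^ (p / 2) * expR (2 * theta * (Cw ^+ 2 * B)).
have Bd0 : 0 <= Bd by rewrite mulr_ge0 ?powR_ge0 ?expR_ge0.
pose kp := kernel_pnorm W p.
have kp1 : 1 <= kp by exact: (kernel_pnorm_ge1 kW WM).
have kp0 : 0 <= kp by exact: le_trans kp1.
have pi01 : 0 < p^-1 <= 1 by rewrite invr_gt0 p0/= invf_le1.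
pose np := kp `^ p^-1.
have np0 : 0 <= np by exact: powR_ge0.
have Cs := Cstar_ge p2; have sp0 : 0 < Num.sqrt p by rewrite sqrtr_gt0.
have Cs0 : 0 < Cstar p by apply: lt_le_trans Cs; rewrite mulr_gt0.
pose CM := 2 ^+ d * (Cstar p * ((Bd + 1 / 3) `^ p^-1 + 2 * np)).
have CM0 : 0 < CM.
  rewrite mulr_gt0 ?exprn_gt0// mulr_gt0// ltr_pwDl ?powR_gt0 ?mulr_ge0//; lra.
exists (C1 + C2 + expR (b * L1)), CM.
split => //; first by rewrite !addr_gt0// expR_gt0.
move=> n l mu Q n2 adm muB QL.
have n0 : (0 < n)%N by exact: leq_trans n2.
have n0R : 0 < n%:R :> R by rewrite ltr0n.
have lnn0 : 0 <= ln n%:R :> R by rewrite ln_ge0// ler1n.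
(* For [ln n < L1] the bad event is everything, which [C] is large enough for. *)
have [small|big] := ltP (ln n%:R : R) L1.
  exists setT; split => //; last by move=> x [].
  rewrite (_ : Q setT = 1%E); last exact: probability_setT.
  rewrite lee_fin mulrDl ler_wpDl//.
    by rewrite mulr_ge0 ?expR_ge0// addr_ge0// ltW.
  by rewrite -expRD -{1}expR0 ler_expR mulNr -mulrBr mulr_ge0 ?(ltW b0)// subr_ge0 ltW.
have [Bad1 [mB1 QB1 hB1]] := H1 n _ mu Q n2 adm muB QL.
have [Bad2 [mB2 QB2 hB2]] := H2 n _ mu Q n2 adm muB QL.
exists (Bad1 `|` Bad2); split; first exact: measurableU.
  apply: (le_trans (measureU2 _ mB1 mB2)).
  apply: (le_trans (leeD QB1 QB2)).
  rewrite -EFinD lee_fin -mulrDl ler_wpM2r ?expR_ge0//.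
  by rewrite lerDl expR_ge0.
move=> x /not_orP[/hB1 {hB1}D1 /hB2 [{hB2}E2a Ea2]].
set h := hexp R l in adm muB D1 E2a Ea2 *.
have [h0 hV hc] := adm; have v0 := vol_gt0 h0.
have r0 : 0 < rate n h by exact: rate_gt0.
have nV0 : 0 < n%:R * vol h by rewrite mulr_gt0.
have hk : Num.sqrt (p / kap) / 2 <= n%:R * vol h * rate n h / (4 * Cw).
  have nVr : rho ^+ 2 <= n%:R * vol h.
    apply: le_trans hc.
    have := ler_powRl (ltW c0) (powR_ge0 _ _) big.
    by rewrite -powRrM mulVf ?gt_eqF// powRr1 ?sqr_ge0.
  have : rho <= Num.sqrt (n%:R * vol h).
    by rewrite -(gtr0_norm rho0) -sqrtr_sqr ler_wsqrtr.
  have -> : n%:R * vol h * rate n h = Num.sqrt (n%:R * vol h).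
    rewrite /rate -{1}(sqr_sqrtr (ltW nV0)) expr2 mulfK// gt_eqF// sqrtr_gt0//.
  by rewrite ler_pdivlMr ?mulr_gt0// /rho => /(le_trans _); apply; rewrite le_eqVlt; apply/orP; left; apply/eqP; field.
pose a := \int[cube_prob]_t ((vol h * kern_sqavg W h t x) `^ (p / 2)).
have a0 : 0 <= a by apply: Rintegral_ge0 => t _; exact: powR_ge0.
have KV t u : `|kern W h t u| <= Cw / vol h by exact: kern_le.
have aE : (\int[cube_prob]_t ((vol h * kern_sqavg W h t x) `^ (p / 2))%:E = a%:E)%E.
  rewrite (EFin_Rintegral (probability_lty cube_prob) (M := (vol h * (Cw / vol h) ^+ 2) `^ (p / 2)))//.
    apply: (measurableT_comp (measurable_powR _)); apply: measurable_funM => //.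
    exact: (measurable_section_l (measurable_kern_sqavg (n := n) h kW) x).
  move=> t; have /andP[s0 s1] := kern_sqavg_itv h0 n0 KV Cw0 t x.
  rewrite ger0_norm ?powR_ge0//; apply: (ler_powRl (ltW q0)).
    by rewrite mulr_ge0 ?(ltW v0).
  by rewrite ler_wpM2l ?(ltW v0).
rewrite aE in E2a Ea2.
(* The empirical integral is at most its mean plus [1/3], which bounds [M_hat] from above; the
   reverse direction [Ea2] is used for the stochastic error. *)
have aBd : a <= Bd + 1 / 3.
  rewrite -lee_fin EFinD; apply: (le_trans E2a); rewrite leeD2r//.
  rewrite -[leRHS](integral_probability_cst (@cube_prob R d)).
  apply: ge0_le_integral_nonmeasurable => t _.
    by apply: integral_ge0 => y _; rewrite lee_fin powR_ge0.
  apply: (kern_sqavg_moment kW M1 WM n0 h0 QL q0 theta0).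
    rewrite ler_wpM2r ?invr_ge0 ?mulr_ge0 ?exprn_ge0//.
    exact: (admissible_ge (ltW c0) n2 adm).
  exact: kern_sqmean_le.
pose lam := a `^ p^-1.
have [as_ [LE as_itv lam_le]] := Lambda_hat_bounds kW M1 WM x n0 h0 p2.
rewrite -/a -/lam in as_itv lam_le.
pose sa := \sum_e as_ e.
have ME : M_hat W p x l = (rate n h * (Cstar p * (sa + 2 ^+ d * (2 * np))))%:E.
  rewrite /M_hat /Gamma_hat leNgt p2/= (norm_kernelE kW WM)// -/kp -/np.
  have GE e : ((Cstar p)%:E * (Lambda_hat x e W (hexp R l) p + 2%:E * np%:E) =
      (Cstar p * (as_ e + 2 * np))%:E)%E by rewrite LE.
  under eq_bigr do rewrite GE.
  rewrite sumEFin -EFinM; congr (_ * _)%:E.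
  rewrite -mulr_sumr; congr (_ * _); rewrite big_split/= -/sa; congr (_ + _).
  by apply: EFin_inj; rewrite -sumEFin sum_cube_signs.
have mdev : measurable_fun setT (fun t => deviation W h mu t x).
  exact: (measurable_section_l (measurable_deviation kW KV mu) x).
have devM t : `|deviation W h mu t x| <= 2 * (Cw / vol h) by exact: deviation_le.
pose Dp := \int[cube_prob]_t (`|(rate n h)^-1 * deviation W h mu t x| `^ p).
have mDp : measurable_fun setT (fun t => `|deviation W h mu t x| `^ p).
  by apply: (measurableT_comp (measurable_powR _)); exact: measurableT_comp.
have DpM t : `| `|deviation W h mu t x| `^ p | <= (2 * (Cw / vol h)) `^ p.
  by rewrite ger0_norm ?powR_ge0// ler_powRl// ltW.
have ri0 : 0 <= (rate n h)^-1 by rewrite invr_ge0 ltW.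
have sE t : `|(rate n h)^-1 * deviation W h mu t x| `^ p =
    (rate n h)^-1 `^ p * `|deviation W h mu t x| `^ p.
  by rewrite normrM ger0_norm// powRM.
have DpE : Dp = (rate n h)^-1 `^ p * \int[cube_prob]_t (`|deviation W h mu t x| `^ p).
  rewrite /Dp; under eq_Rintegral do rewrite sE.
  by rewrite RintegralZl//; exact: (bounded_integrable (probability_lty cube_prob) mDp DpM).
set cp := (4 * Num.sqrt p) `^ p.
have cp1 : 1 <= cp.
  have sp1 : 1 <= Num.sqrt p by rewrite -{1}sqrtr1 ler_wsqrtr.
  apply: (@le_trans _ _ (1 `^ p)); first by rewrite powR1.
  by apply: (ler_powRl (ltW p0) ler01); apply: mulr_ege1; rewrite ?ler1n.
have Dple : Dp <= cp * (a + kp).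
  have := mean_deviation_moment_le p2 n0 h0 QL hk.
  rewrite -/cp => E1.
  have cpe : (0 <= cp%:E)%E by rewrite lee_fin; exact: le_trans ler01 cp1.
  have := le_trans D1 (leeD2r _ (le_trans E1 (lee_wpmul2l cpe (leeD2r _ Ea2)))).
  have -> : (\int[cube_prob]_t (`|(rate n h)^-1 * deviation W h mu t x| `^ p)%:E = Dp%:E)%E.
    under eq_integral do rewrite sE.
    rewrite /Dp; under eq_Rintegral do rewrite sE.
    rewrite (EFin_Rintegral (probability_lty cube_prob) (M := (rate n h)^-1 `^ p * (2 * (Cw / vol h)) `^ p))//.
      exact: measurable_funM.
    by move=> t; rewrite normrM ger0_norm ?powR_ge0// ler_wpM2l ?powR_ge0.
  have -> : (cp%:E * (a%:E + (1 / 3)%:E + (1 / 3)%:E) + (1 / 3)%:E =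
    (cp * (a + 1 / 3 + 1 / 3) + 1 / 3)%:E)%E by [].
  rewrite lee_fin => /le_trans; apply.
  exact: slack.
rewrite /good_point ME; split; last first.
  rewrite lee_fin mulrC ler_wpM2r ?(ltW r0)// /CM.
  rewrite [leRHS]mulrCA ler_wpM2l ?(ltW Cs0)// mulrDr lerD2r.
  apply: (@le_trans _ _ (\sum_(e : {ffun 'I_d -> bool}) lam)).
    by apply: ler_sum => e _; have /andP[] := as_itv e.
  have -> : \sum_(e : {ffun 'I_d -> bool}) lam = 2 ^+ d * lam.
    by apply: EFin_inj; rewrite -sumEFin sum_cube_signs.
  rewrite ler_wpM2l ?exprn_ge0// ler_powRl// invr_ge0 ltW//.
rewrite (norm_cubeE mdev devM p0) -EFinM lee_fin.
have -> : \int[cube_prob]_t (`|deviation W h mu t x| `^ p) = rate n h `^ p * Dp.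
  rewrite DpE mulrA -powRM ?(ltW r0)// mulfV ?gt_eqF// powR1 mul1r//.
have Dp0 : 0 <= Dp by apply: Rintegral_ge0 => t _; exact: powR_ge0.
rewrite powRM ?powR_ge0// -powRrM mulfV ?gt_eqF// powRr1 ?(ltW r0)//.
rewrite mulrCA ler_wpM2l ?(ltW r0)//.
(* The p-th root is subadditive, so the root of [a + kp] is at most [lam + np], and [4 sqrt p] is
   replaced by [Cstar p]. *)
apply: (@le_trans _ _ (Cstar p * (lam + np))).
  apply: (@le_trans _ _ ((cp * (a + kp)) `^ p^-1)).
    by rewrite ler_powRl// invr_ge0 ltW.
  have ak0 : 0 <= a + kp := addr_ge0 a0 kp0.
  rewrite powRM ?powR_ge0// /cp -powRrM mulfV ?gt_eqF// powRr1 ?mulr_ge0 ?(ltW sp0)//.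
  apply: ler_pM => //; rewrite ?powR_ge0 ?mulr_ge0 ?(ltW sp0)//.
  exact: (powR_add_le pi01 a0 kp0).
have np2 : np <= 2 ^+ d * (2 * np).
  rewrite mulrA ler_peMl// mulr_ege1 ?exprn_ege1 ?ler1n//.
have X0 : 0 <= Cstar p * (sa + 2 ^+ d * (2 * np)).
  rewrite mulr_ge0 ?(ltW Cs0)// addr_ge0 ?mulr_ge0 ?exprn_ge0//.
  by apply: sumr_ge0 => e _; have /andP[] := as_itv e.
have X1 : Cstar p * (lam + np) <= Cstar p * (sa + 2 ^+ d * (2 * np)).
  by rewrite ler_wpM2l ?(ltW Cs0)// lerD.
by apply: (le_trans X1); rewrite ler_peMl// lerDl ltW.
Qed.

Lemma good_event (B p tau b c : R) : 1 <= p -> 0 < tau -> 0 < b -> 0 < c ->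
  exists C CM : R, [/\ 0 < C, 0 < CM &
  forall (n : nat) (l : d.-tuple nat) (mu : probability T R)
    (Q : probability (n.-tuple T) R),
  (2 <= n)%N -> admissible n c (hexp R l) ->
  (forall t, mu (box (hexp R l) t) <= (B * vol (hexp R l))%:E)%E -> iid_law mu Q ->
  exists Bad : set (n.-tuple T),
    [/\ measurable Bad, (Q Bad <= (C * expR (- b * ln n%:R))%:E)%E &
      forall x, ~ Bad x -> good_point W p tau CM l mu x]].
Proof.
move=> p1; have [p2|p2] := leP p 2; last exact: good_event_gt2.
by apply: (good_event_le2 kW M1 WM); rewrite p1.
Qed.

End good_event_gt2.

(** * Oracle inequality *)

Section cube_norm_triangle.
Context {R : realType} {d : nat}.
Implicit Types f g h : d.-tuple R -> R.

Lemma norm_cubeBC p f g :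
  norm_cube p (fun t => (f t - g t)%:E) = norm_cube p (fun t => (g t - f t)%:E).
Proof.
rewrite /norm_cube -[RHS]oppe_Lnorm; congr Lnorm.
apply/funext => t; have e : f t - g t = - (g t - f t) by rewrite opprB.
exact: (congr1 EFin e).
Qed.

Lemma norm_cube_triangle p g f h : 1 <= p -> measurable_fun setT f ->
  measurable_fun setT g -> measurable_fun setT h ->
  (norm_cube p (fun t => (f t - h t)%:E) <=
   norm_cube p (fun t => (f t - g t)%:E) + norm_cube p (fun t => (g t - h t)%:E))%E.
Proof.
move=> p1 mf mg mh.
have := @minkowski_EFin _ _ R (cube_measure R d) (f \- g) (g \- h) p
  (measurable_funB mf mg) (measurable_funB mg mh) p1.
rewrite (_ : ((f \- g) \+ (g \- h)) = f \- h)//.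
by apply/funext => t /=; rewrite addrA subrK.
Qed.

Lemma norm_cube_ge0 p (u : d.-tuple R -> \bar R) : (0 <= norm_cube p u)%E.
Proof. exact: Lnorm_ge0. Qed.

Lemma lee_poweR (r : R) (x y : \bar R) : 0 <= r -> (0 <= x)%E -> (x <= y)%E ->
  (x `^ r <= y `^ r)%E.
Proof.
by move=> r0 x0 xy; apply: gt0_ler_poweR; rewrite // in_itv/= leey andbT// (le_trans x0).
Qed.

Lemma norm_cube_le_ae (p B : R) f : 1 <= p -> 0 <= B -> measurable_fun setT f ->
  {ae cube_measure R d, forall t, `|f t| <= B} ->
  (norm_cube p (fun t => (f t)%:E) <= B%:E)%E.
Proof.
move=> p1 B0 mf fB; have p0 : 0 < p by lra.
rewrite /norm_cube unlock.
have -> : B%:E = ((B `^ p)%:E `^ p^-1)%E.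
  by rewrite poweR_EFin -powRrM mulfV ?gt_eqF// powRr1.
apply: lee_poweR; first by rewrite invr_ge0 ltW.
  by apply: integral_ge0 => t _; exact: poweR_ge0.
rewrite -[leRHS](integral_probability_cst (@cube_prob R d)) cube_probE.
apply: ae_ge0_le_integral => //.
- by move=> t _; exact: poweR_ge0.
- under eq_fun do rewrite abse_EFin poweR_EFin.
  apply/measurable_EFinP; apply: (measurableT_comp (measurable_powR p)).
  exact: measurableT_comp.
- by move=> t _; rewrite lee_fin powR_ge0.
apply: filterS fB => t tB _.
by rewrite abse_EFin poweR_EFin lee_fin ler_powRl// ltW.
Qed.

End cube_norm_triangle.

Section multi_index.
Context {R : realType} {d : nat}.
Implicit Types l : d.-tuple nat.

Lemma iminC l l' : imin l l' = imin l' l.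
Proof. by apply: eq_from_tnth => i; rewrite !tnth_mktuple minnC. Qed.

Lemma tnth_hexp l i : tnth (hexp R l) i = expR (- (tnth l i)%:R).
Proof. by rewrite tnth_mktuple. Qed.

Lemma hexp_gt0 l i : 0 < tnth (hexp R l) i.
Proof. by rewrite tnth_hexp expR_gt0. Qed.

Lemma hexp_le1 l i : tnth (hexp R l) i <= 1.
Proof. by rewrite tnth_hexp expR_le1 oppr_le0 ler0n. Qed.

Lemma vol_imin l l' : vol (hexp R l) <= vol (hexp R (imin l l')).
Proof.
apply: ler_prod => i _; rewrite ltW ?hexp_gt0//= !tnth_hexp ler_expR lerN2.
by rewrite tnth_mktuple ler_nat geq_minl.
Qed.

Lemma rate_imin n l l' : (0 < n)%N ->
  rate n (hexp R (imin l l')) <= rate n (hexp R l).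
Proof.
move=> n0; have v0 l1 := vol_gt0 (hexp_gt0 l1).
rewrite /rate lef_pV2 ?posrE ?sqrtr_gt0 ?mulr_gt0 ?ltr0n//.
by rewrite ler_wsqrtr// ler_wpM2l ?ler0n// vol_imin.
Qed.

(** Taking minima of indices enlarges the bandwidths, so the lower bound on the volume persists; the
    upper bound persists because each bandwidth is still one of the two given ones. *)
Lemma Lani_imin n (c : R) l l' :
  Lani n c l -> Lani n c l' -> Lani n c (imin l l').
Proof.
move=> [hl nl] [hl' nl']; split => [i|].
  rewrite tnth_hexp tnth_mktuple; have := hl i; have := hl' i.
  by rewrite !tnth_hexp /minn; case: ifP.
by apply: (le_trans nl); rewrite ler_wpM2l ?ler0n// vol_imin.
Qed.

Lemma Lani_admissible n (c : R) l : (1 <= d)%N -> Lani n c l ->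
  admissible n c (hexp R l).
Proof.
move=> d1 [hl nl]; split => //; first exact: hexp_gt0.
pose i0 : 'I_d := Ordinal d1.
rewrite /vol (bigD1 i0)//=.
have := hl i0; rewrite in_itv/= => /andP[_ h1].
apply: (le_trans _ h1); rewrite ler_piMr ?(ltW (hexp_gt0 _ _))//.
by apply: prodr_ile1 => i _; rewrite (ltW (hexp_gt0 _ _)) hexp_le1.
Qed.

Lemma vol_hexp_le1 l : vol (hexp R l) <= 1.
Proof. by apply: prodr_ile1 => i _; rewrite (ltW (hexp_gt0 _ _)) hexp_le1. Qed.

(** Keeps the oracle above [1/n], which absorbs the contribution of the bad event to the risk. *)
Lemma rate_ge n l : (0 < n)%N -> n%:R^-1 <= rate n (hexp R l).
Proof.
move=> n0; have v0 := vol_gt0 (hexp_gt0 l).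
have n1 : 1 <= n%:R :> R by rewrite ler1n.
rewrite /rate lef_pV2 ?posrE ?sqrtr_gt0 ?mulr_gt0 ?ltr0n//.
rewrite -[leRHS]ger0_norm// -sqrtr_sqr ler_wsqrtr// expr2 ler_wpM2l//.
exact: le_trans (vol_hexp_le1 l) n1.
Qed.

End multi_index.

Section oracle_chain.
Context {R : realType} {d : nat}.
Variables (W : 'I_d -> R -> R) (M : R).
Hypothesis kW : forall i, kernel_class (W i).
Hypothesis M1 : 1 <= M.
Hypothesis WM : forall i x, `|W i x| <= M.
Local Notation T := (d.-tuple R).

Variables (n : nat) (mu : probability T R) (x : n.-tuple T) (p tau c CM : R).
Hypothesis n0 : (0 < n)%N.
Hypothesis p1 : 1 <= p.
Hypothesis tau0 : 0 < tau.
Hypothesis good : forall l, Lani n c l -> good_point W p tau CM l mu x.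
Variable f : T -> R.
Hypothesis mf : measurable_fun setT f.
Local Notation N g := (norm_cube p (fun t => (g t)%:E)).
Local Notation F l := (fhat W l x).
Local Notation m l := (kern_mean W (hexp R l) mu).
Local Notation S l :=
  (ereal_sup [set N (fun t => m l' t - m (imin l l') t) | l' in Lani n c]).

Let M0 : 0 <= M. Proof. exact: le_trans M1. Qed.

Let mF l : measurable_fun setT (F l).
Proof.
apply: measurable_funM => //; apply: measurable_sum => j.
by apply: measurable_kern.
Qed.

Let mm l : measurable_fun setT (m l).
Proof.
have KV t u : `|kern W (hexp R l) t u| <= M ^+ d / vol (hexp R l).
  by apply: kern_le => //; exact: hexp_gt0.
rewrite (_ : (kern_mean _ _ _ : T -> R) =
    fun t => F l t - deviation W (hexp R l) mu t x).
  apply: measurable_funB; first exact: mF.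
  exact: (measurable_section_l (measurable_deviation kW KV mu) x).
by apply/funext => t; rewrite /deviation subKr.
Qed.

Let t1 : 0 < 1 + tau. Proof. by rewrite addr_gt0. Qed.

Let Mhat_fin l : Lani n c l ->
  exists2 a : R, M_hat W p x l = a%:E & 0 <= a <= CM * rate n (hexp R l).
Proof.
move=> /good[h1 h2].
have Mh0 : (0 <= M_hat W p x l)%E.
  have := le_trans (norm_cube_ge0 _ _) h1.
  by rewrite pmule_rge0// lte_fin.
exists (fine (M_hat W p x l)).
  by rewrite fineK// ge0_fin_numE// (le_lt_trans h2)// ltry.
by rewrite -!lee_fin fineK ?Mh0// ge0_fin_numE// (le_lt_trans h2)// ltry.
Qed.

Let N_dev l : Lani n c l ->
  (N (fun t => F l t - m l t) <= (1 + tau)%:E * M_hat W p x l)%E.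
Proof. by case/good. Qed.

Let B_le l l' : Lani n c l' -> forall a : R, M_hat2 W p x l l' = a%:E ->
  (N (fun t => F (imin l l') t - F l' t) <=
   B_hat c tau W p x l + (1 + tau)%:E * a%:E)%E.
Proof.
move=> Ll' a aE; rewrite -leeBlDr//.
apply: (@le_trans _ _ (maxe (N (fun t => F (imin l l') t - F l' t) -
   (1 + tau)%:E * M_hat2 W p x l l')%E 0%E)).
  by rewrite aE le_max lexx.
by apply: ereal_sup_ubound; exists l'.
Qed.

(** At a good point the subtracted majorants dominate the stochastic errors of both estimators in
    the difference, so only the distance between their means remains. *)
Let B_ge l : Lani n c l -> (B_hat c tau W p x l <= S l)%E.
Proof.
move=> Ll; apply: ge_ereal_sup => _ [l' Ll' <-].
have SN : (N (fun t => m l' t - m (imin l l') t) <= S l)%E.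
  by apply: ereal_sup_ubound; exists l'.
move: (S l) SN => s SN.
rewrite ge_max; apply/andP; split; last exact: le_trans (norm_cube_ge0 _ _) SN.
have Lm := Lani_imin Ll Ll'.
have [a aE _] := Mhat_fin Ll'; have [b bE _] := Mhat_fin Lm.
rewrite /M_hat2 aE bE leeBlDr//.
have D1 := N_dev Ll'; have D2 := N_dev Lm; rewrite aE in D1; rewrite bE in D2.
apply: (le_trans (norm_cube_triangle (g := m (imin l l')) p1 (mF _) (mm _) (mF _))).
apply: (@le_trans _ _ ((1 + tau)%:E * b%:E + (s + (1 + tau)%:E * a%:E))%E).
  apply: leeD => //.
  apply: (le_trans (norm_cube_triangle (g := m l') p1 (mm _) (mm _) (mF _))).
  apply: leeD; last by rewrite norm_cubeBC; exact: D1.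
  by rewrite norm_cubeBC; exact: SN.
have e1 : (1 + tau) * (a + b) = (1 + tau) * b + (1 + tau) * a by ring.
rewrite (_ : ((1 + tau)%:E * (a%:E + b%:E) = (1 + tau)%:E * b%:E + (1 + tau)%:E * a%:E)%E).
  by rewrite addeCA.
exact: (congr1 EFin e1).
Qed.

Let chain_real (be b e be' a v s r : R) : 0 < r -> 0 <= CM -> be <= s -> 0 <= s -> 0 <= v ->
  be' + (1 + tau) * b <= be + (1 + tau) * a -> a <= CM * r -> e <= CM * r ->
  be + (1 + tau) * (b + e) + (be' + (1 + tau) * (a + e) + ((1 + tau) * a + v)) <=
  (2 + 5 * (1 + tau) * CM) * (v + s + r).
Proof.
move=> r0 CM0 bs s0 v0 h ha he.
have ha' := ler_wpM2l (ltW t1) ha; have he' := ler_wpM2l (ltW t1) he.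
have X0 : 0 <= (1 + tau) * CM by rewrite mulr_ge0// ltW.
have X1 : 0 <= (1 + tau) * CM * (v + s) by rewrite mulr_ge0// addr_ge0.
have -> : (2 + 5 * (1 + tau) * CM) * (v + s + r) =
  2 * (v + s + r) + 5 * ((1 + tau) * CM * (v + s)) + 5 * ((1 + tau) * (CM * r)) by ring.
rewrite !(mulrDr (1 + tau)).
move: ((1 + tau) * CM * (v + s)) X1 => X X1.
move: ((1 + tau) * (CM * r)) ha' he' => Y ha' he'.
move: ((1 + tau) * b) ((1 + tau) * e) ((1 + tau) * a) h ha' he' => b' e' a' h ha' he'.
lra.
Qed.

(* The Goldenshluger-Lepski comparison: from [lh] to [l] through [imin l lh],
   each of the two steps being controlled by one of the two criteria. *)
Lemma oracle_chain l lh : Lani n c l -> argmin_set c tau W p x lh ->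
  (N (fun t => F lh t - f t) <=
   (2 + 5 * (1 + tau) * CM)%:E *
   (N (fun t => m l t - f t) + S l + (rate n (hexp R l))%:E))%E.
Proof.
move=> Ll [Lh /(_ _ Ll) crit].
have Lm := Lani_imin Ll Lh.
have [a aE /andP[a0 ar]] := Mhat_fin Ll; have [b bE /andP[b0 br]] := Mhat_fin Lh.
have [e eE /andP[e0 er]] := Mhat_fin Lm.
have r0 : 0 < rate n (hexp R l) by apply: rate_gt0 => //; exact: hexp_gt0.
have CM0 : 0 <= CM by rewrite -(pmulr_lge0 _ r0) (le_trans a0 ar).
have er' : e <= CM * rate n (hexp R l).
  by rewrite (le_trans er)// ler_wpM2l// rate_imin.
set r := rate _ _ in r0 ar er' *.
set s := S l; set v := N (fun t => m l t - f t).
have s0 : (0 <= s)%E.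
  apply: le_trans (norm_cube_ge0 _ _) (ereal_sup_ubound _); last by exists l.
have v0 : (0 <= v)%E by exact: norm_cube_ge0.
have K0 : 0 < 2 + 5 * (1 + tau) * CM.
  by rewrite ltr_pwDl// mulr_ge0// mulr_ge0// ltW.
have Kinf : ((2 + 5 * (1 + tau) * CM)%:E * +oo = +oo)%E by rewrite gt0_muley.
(* An infinite bias term makes the claim trivial; otherwise all quantities are real numbers and
   [chain_real] concludes. *)
have [->|soo] := eqVneq s +oo%E.
  by rewrite addey -?ltNye ?(lt_le_trans _ v0)// addye// Kinf leey.
have [->|voo] := eqVneq v +oo%E.
  by rewrite addye -?ltNye ?(lt_le_trans _ s0)// addye// Kinf leey.
have [sr sE] : exists sr, s = sr%:E by exists (fine s); rewrite fineK// ge0_fin_numE// ltey.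
have [vr vE] : exists vr, v = vr%:E by exists (fine v); rewrite fineK// ge0_fin_numE// ltey.
have B0 l1 : (0 <= B_hat c tau W p x l1)%E.
  apply: le_trans (ereal_sup_ubound _); last by exists l.
  by rewrite le_max lexx orbT.
have := B_ge Ll; rewrite -/s sE => Bl.
have [be beE] : exists be, B_hat c tau W p x l = be%:E.
  exists (fine (B_hat c tau W p x l)); rewrite fineK// ge0_fin_numE//.
  by rewrite (le_lt_trans Bl)// ltry.
move: crit; rewrite /criterion beE aE bE -!EFinM -EFinD => crit.
have Bh : (B_hat c tau W p x lh <= (be + (1 + tau) * a)%:E)%E.
  by apply: le_trans crit; rewrite leeDl// lee_fin mulr_ge0// ltW.
have [be' beE'] : exists be', B_hat c tau W p x lh = be'%:E.
  exists (fine (B_hat c tau W p x lh)); rewrite fineK// ge0_fin_numE//.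
  by rewrite (le_lt_trans Bh)// ltry.
have H1 := @B_le l lh Lh (b + e); rewrite /M_hat2 bE eE beE in H1.
have H2 := @B_le lh l Ll (a + e); rewrite /M_hat2 [imin lh l]iminC aE eE beE' in H2.
apply: (le_trans (norm_cube_triangle (g := F (imin l lh)) p1 (mF _) (mF _) mf)).
apply: (@le_trans _ _ ((be + (1 + tau) * (b + e)) + ((be' + (1 + tau) * (a + e)) +
   ((1 + tau) * a + vr)))%:E).
  rewrite norm_cubeBC [leRHS]EFinD; apply: leeD; first exact: H1.
  apply: (le_trans (norm_cube_triangle (g := F l) p1 (mF _) (mF _) mf)).
  rewrite [leRHS]EFinD; apply: leeD; first exact: H2.
  apply: (le_trans (norm_cube_triangle (g := m l) p1 (mF _) (mm _) mf)).
  rewrite [leRHS]EFinD; apply: leeD; last by rewrite -vE.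
  by have := N_dev Ll; rewrite aE.
rewrite vE -!EFinD -EFinM lee_fin.
move: crit Bl; rewrite beE' beE -EFinD !lee_fin => crit Bl.
have v0r : 0 <= vr by rewrite -lee_fin -vE.
have s0r : 0 <= sr by rewrite -lee_fin -sE.
apply: chain_real => //; lra.
Qed.

End oracle_chain.

(** * From the sample to the law of the data *)

Section image_law.
Context {R : realType} d1 d2 (T : measurableType d1) (T' : measurableType d2).
Variables (P : probability T R) (Y : T -> T').
Hypothesis mY : measurable_fun setT Y.

Lemma image_law : exists Q : probability T' R,
  [/\ forall A, Q A = P (Y @^-1` A),
      forall g : T' -> \bar R, measurable_fun setT g -> (forall y, 0 <= g y)%E ->
        (\int[Q]_y g y = \int[P]_w g (Y w))%E &
      forall (g : T' -> R) (B : R), measurable_fun setT g -> (forall y, `|g y| <= B) ->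
        (\int[Q]_y (g y)%:E = \int[P]_w (g (Y w))%:E)%E].
Proof.
pose Ym : {mfun T >-> T'} := mfun_Sub (mem_set mY).
exists (distribution P Ym); split => [A|g mg g0|g B mg gB].
- by [].
- by rewrite (ge0_integral_distribution Ym mg g0).
- rewrite (@integral_distribution _ _ _ _ _ _ Ym (EFin \o g))//.
    exact/measurable_EFinP.
  apply: (bounded_integrable (probability_lty P) (M := B)) => //.
  exact: (measurableT_comp mg).
Qed.

End image_law.

Section sample_law.
Context {R : realType} {d n : nat} disp (T : measurableType disp).
Variables (P : probability T R) (X : 'I_n -> T -> d.-tuple R).
Variables (f : d.-tuple R -> R) (Finf : R).
Hypothesis n0 : (0 < n)%N.
Hypothesis iidX : iid_sample P f X.
Hypothesis df : density f.
Hypothesis F0 : 0 < Finf.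
Hypothesis fF : ('N[cube_measure R d]_+oo[EFin \o f] <= Finf%:E)%E.

Lemma measurable_data : measurable_fun setT (data X).
Proof.
apply/measurable_fun_tnthP => j; have [mX _ _ _] := iidX.
rewrite (_ : _ \o _ = X j)//.
by apply/funext => w; rewrite /= /data tnth_mktuple.
Qed.

Lemma data_in_cube w : data_cube (data X w).
Proof. by have [_ cX _ _] := iidX; move=> j; rewrite tnth_mktuple. Qed.

Lemma density_ae_le : {ae cube_measure R d, forall t, `|f t| <= Finf}.
Proof.
have := ess_sup_ge (cube_measure R d) (fun t => `|(f t)%:E|%E).
apply: filterS => t ht.
rewrite -lee_fin -abse_EFin; apply: (le_trans ht).
(* The sup norm unfolds to the essential supremum under a guard asking for positive total mass. *)
move: fF; rewrite unlock /=; case: ifPn => //.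
by rewrite cube_measureT lte01.
Qed.

(** Translates the sampling model into the form used by the estimates. The law [mu] is that of one
    observation, shared by all the others since the density prescribes it; the constant [Finf * 2^d]
    is the bound on the density times the ratio of the measure of a box to [vol h]. *)
Lemma sample_law : exists (mu : probability (d.-tuple R) R)
    (Q : probability (n.-tuple (d.-tuple R)) R),
  [/\ iid_law mu Q,
      forall A, Q A = P (data X @^-1` A),
      forall h u, (forall i, 0 < tnth h i) ->
        (mu (box h u) <= (Finf * 2 ^+ d * vol h)%:E)%E &
      forall W l t, (forall i, kernel_class (W i)) ->
        mean_fhat P X W l t = (kern_mean W (hexp R l) mu t)%:E].
Proof.
have [mX cX lX indX] := iidX.
pose j0 : 'I_n := Ordinal n0.
have [mu [muE mu0 muB]] := image_law P (mX j0).
have [Q [QE Q0 QB]] := image_law P measurable_data.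
exists mu, Q; split => //.
- move=> A mA; rewrite QE.
  rewrite (_ : _ @^-1` _ = [set w | forall j, A j (X j w)]); last first.
    by apply/seteqP; split => w /= Aw j; have := Aw j; rewrite tnth_mktuple.
  rewrite indX//; apply: eq_bigr => j _; rewrite muE.
  by rewrite !lX.
- move=> h u h0; rewrite muE lX; last exact: measurable_boxh.
  have mb : measurable (box h u `&` @cube R d).
    by apply: measurableI; [exact: measurable_boxh|exact: measurable_cube].
  have [mf f0 _] := df.
  have fae : {ae lebesgue_tuple R d, forall t, (box h u `&` @cube R d) t -> ((f t)%:E <= Finf%:E)%E}.
    have [N [mN N0 NF]] := density_ae_le.
    exists (N `&` @cube R d); split => //.
      by apply: measurableI => //; exact: measurable_cube.
    move=> t /= /not_implyP[[_ ct] ft]; split => //; apply: NF => /= tF; apply: ft.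
    by rewrite lee_fin (le_trans (ler_norm _)).
  apply: (@le_trans _ _ (\int[lebesgue_tuple R d]_(t in box h u `&` @cube R d) Finf%:E)%E).
    apply: ae_ge0_le_integral => //.
    - by move=> t [_ ct]; rewrite lee_fin f0.
    - by apply/measurable_EFinP; exact: measurable_funTS.
    - by move=> t _; rewrite lee_fin ltW.
  rewrite integral_cst// -[leRHS]/(_%:E) -mulrA EFinM lee_pmul2l// -(lebesgue_tuple_boxh u h0).
  apply: le_measure; rewrite ?inE//; exact: measurable_boxh.
- move=> W l t kW; rewrite /mean_fhat unlock.
  have [M M1 WM] := kernel_bounded kW.
  have M0 : 0 <= M by exact: le_trans M1.
  have KV u : `|kern W (hexp R l) t u| <= M ^+ d / vol (hexp R l).
    by apply: kern_le => //; exact: hexp_gt0.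
  have mK : measurable_fun setT (kern W (hexp R l) t) by exact: measurable_kern_r.
  have iK j : P.-integrable setT (fun w => (kern W (hexp R l) t (X j w))%:E).
    apply: (bounded_integrable (probability_lty P) (M := M ^+ d / vol (hexp R l))) => //.
    exact: (measurableT_comp mK).
  have EK j : (\int[P]_w (kern W (hexp R l) t (X j w))%:E =
      (kern_mean W (hexp R l) mu t)%:E)%E.
    have [nu [nuE _ nuB]] := image_law P (mX j).
    rewrite -(nuB _ _ mK KV) /kern_mean (EFin_Rintegral (probability_lty mu) mK KV).
    have numu A : measurable A -> nu A = mu A by move=> mA; rewrite nuE muE !lX.
    by apply: eq_measure_integral => A mA _; exact: numu.
  transitivity (\int[P]_w ((n%:R^-1)%:E *
     \sum_(j < n) (kern W (hexp R l) t (X j w))%:E))%E.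
    apply: eq_integral => w _; rewrite /fhat /kernel_estimator EFinM sumEFin.
    by congr (_ * _%:E)%E; apply: eq_bigr => j _; rewrite tnth_mktuple.
  rewrite integralZl//; last exact: integrable_sum.
  rewrite integral_sum//; under eq_bigr do rewrite EK.
  rewrite sumEFin sumr_const card_ord -EFinM; congr EFin.
  by rewrite -[X in _ * X]mulr_natl mulKf// gt_eqF// ltr0n.
Qed.

End sample_law.

Lemma union_bound {R : realType} disp (T : measurableType disp) (Q : probability T R)
    (I : eqType) (s : seq I) (B : I -> set T) (a : R) :
  (forall i, measurable (B i)) -> (forall i, Q (B i) <= a%:E)%E ->
  exists U, [/\ measurable U, (Q U <= ((size s)%:R * a)%:E)%E &
    forall i, i \in s -> B i `<=` U].
Proof.
move=> mB QB; elim: s => [|i s [U [mU QU sU]]].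
  by exists set0; rewrite measure0 mul0r.
exists (B i `|` U); split; first exact: measurableU.
  apply: (le_trans (measureU2 _ (mB i) mU)); apply: (le_trans (leeD (QB i) QU)).
  by rewrite -EFinD lee_fin /= -natr1 mulrDl mul1r addrC.
move=> j; rewrite inE => /predU1P[->|js]; first exact: subsetUl.
exact: subset_trans (sU _ js) (@subsetUr _ _ _).
Qed.

(** * Uniformity over the grid and the risk *)

Section selection.
Context {R : realType} {d : nat}.
Variables (W : 'I_d -> R -> R) (M : R).
Hypothesis kW : forall i, kernel_class (W i).
Hypothesis M1 : 1 <= M.
Hypothesis WM : forall i x, `|W i x| <= M.
Hypothesis d1 : (1 <= d)%N.
Local Notation T := (d.-tuple R).
Local Notation Cw := (M ^+ d).

Let M0 : 0 <= M. Proof. exact: le_trans M1. Qed.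
Let Cw0 : 0 < Cw. Proof. by rewrite exprn_gt0// (lt_le_trans _ M1). Qed.

Let kap_gt0 c : 0 < ln (2 : R) `^ c.
Proof. by rewrite powR_gt0// ln_gt0// ltr1n. Qed.

Lemma vol_hexp_ge n (c : R) (l : d.-tuple nat) : 0 <= c -> (2 <= n)%N -> Lani n c l ->
  ln 2 `^ c / n%:R <= vol (hexp R l).
Proof.
move=> c0 n2 Ll; have n0 : (0 < n)%N by exact: leq_trans n2.
rewrite ler_pdivrMr ?ltr0n// mulrC.
exact: (admissible_ge c0 n2 (Lani_admissible d1 Ll)).
Qed.

(** The volume is at most [exp (- l_i)] and at least [(ln 2)^c / n], so
    [1 + l_i <= exp (l_i) <= A n]. Linear growth is crude, but a polynomial number of indices is
    enough for the union bound. *)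
Lemma Lani_bounded n (c : R) (A : nat) (l : d.-tuple nat) : 0 <= c -> (2 <= n)%N ->
  (ln 2 `^ c)^-1 <= A%:R :> R -> Lani n c l -> forall i, (tnth l i < A * n)%N.
Proof.
move=> c0 n2 hA Ll i; have n0 : (0 < n)%N by exact: leq_trans n2.
rewrite -(ltr_nat R) natrM.
have Vi : vol (hexp R l) <= expR (- (tnth l i)%:R).
  rewrite /vol (bigD1 i)//= -tnth_hexp ler_piMr ?(ltW (hexp_gt0 _ _))//.
  by apply: prodr_ile1 => j _; rewrite (ltW (hexp_gt0 _ _)) hexp_le1.
have := le_trans (vol_hexp_ge c0 n2 Ll) Vi.
rewrite expRN -[leLHS]invrK lef_pV2 ?posrE ?expR_gt0 ?invr_gt0 ?divr_gt0 ?ltr0n//.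
rewrite invf_div => he.
have := expR_ge1Dx ((tnth l i)%:R : R) => h1.
have h2 : n%:R / ln 2 `^ c <= A%:R * n%:R :> R.
  by rewrite mulrC ler_wpM2r// ler0n.
by have := le_trans h1 (le_trans he h2); lra.
Qed.

Lemma good_event_all (B p tau b c : R) : 1 <= p -> 0 < tau -> 0 < b -> 0 < c ->
  exists C CM : R, [/\ 0 < C, 0 < CM &
  forall (n : nat) (mu : probability T R) (Q : probability (n.-tuple T) R),
  (2 <= n)%N ->
  (forall h t : T, (forall i, 0 < tnth h i) -> (mu (box h t) <= (B * vol h)%:E)%E) ->
  iid_law mu Q ->
  exists Bad : set (n.-tuple T),
    [/\ measurable Bad, (Q Bad <= (C * expR (- b * ln n%:R))%:E)%E &
      forall x, ~ Bad x -> forall l, Lani n c l -> good_point W p tau CM l mu x]].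
Proof.
move=> p1 tau0 b0 c0.
(* The union over at most [(A n)^d] indices costs a factor [n^d], prepaid by the exponent
   [b + d]. *)
have bd0 : 0 < b + d%:R by rewrite ltr_wpDr// ler0n.
have [C [CM [C0 CM0 H]]] := good_event kW M1 WM B p1 tau0 bd0 c0.
pose A := Num.Def.archi_bound (ln 2 `^ c : R)^-1.
have hA : (ln 2 `^ c)^-1 <= A%:R :> R.
  by apply: ltW; apply: archi_boundP; rewrite invr_ge0 ltW.
have A0 : 0 < A%:R :> R by apply: lt_le_trans hA; rewrite invr_gt0.
exists (A%:R ^+ d * C), CM; split => //; first by rewrite mulr_gt0// exprn_gt0.
move=> n mu Q n2 muB QL.
have n0 : (0 < n)%N by exact: leq_trans n2.
have n0R : 0 < n%:R :> R by rewrite ltr0n.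
pose idx (u : {ffun 'I_d -> 'I_(A * n)}) : d.-tuple nat := [tuple nat_of_ord (u i) | i < d].
pose eta := C * expR (- (b + d%:R) * ln n%:R).
have eta0 : 0 <= eta by rewrite mulr_ge0 ?expR_ge0// ltW.
have ex u : exists Bad : set (n.-tuple T), [/\ measurable Bad, (Q Bad <= eta%:E)%E &
    Lani n c (idx u) -> forall x, ~ Bad x -> good_point W p tau CM (idx u) mu x].
  have [Lu|Lu] := pselect (Lani n c (idx u)); last first.
    by exists set0; rewrite measure0 lee_fin.
  have [|Bad [mB QB hB]] := H n (idx u) mu Q n2 (Lani_admissible d1 Lu) _ QL.
    by move=> t; apply: muB; exact: hexp_gt0.
  by exists Bad.
have [Bad hBad] := choice ex.
have [|| U [mU QU sU]] := @union_bound _ _ _ Q _ (enum {ffun 'I_d -> 'I_(A * n)}) Bad eta.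
- by move=> u; have [] := hBad u.
- by move=> u; have [] := hBad u.
exists U; split => //.
  apply: (le_trans QU); rewrite lee_fin -cardE card_ffun !card_ord /eta.
  rewrite natrX natrM exprMn mulrACA ler_wpM2l ?mulr_ge0 ?exprn_ge0 ?ler0n ?(ltW C0)//.
  rewrite -{1}[n%:R]lnK ?posrE// -expRM_natl -expRD ler_expR.
  by rewrite le_eqVlt; apply/orP; left; apply/eqP; ring.
move=> x Ux l Ll; have lb := Lani_bounded (ltW c0) n2 hA Ll.
pose u : {ffun 'I_d -> 'I_(A * n)} := [ffun i => Ordinal (lb i)].
have uE : idx u = l by apply: eq_from_tnth => i; rewrite tnth_mktuple ffunE.
have [_ _] := hBad u; rewrite uE => /(_ Ll); apply => Bx; apply: Ux.
by apply: (sU u) => //; rewrite mem_enum.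
Qed.

(** A kernel is at most [Cw / V], and [1 / V <= n / (ln 2)^c] on the grid; this covers the bad
    event, whatever index is selected there. *)
Lemma crude_bound n c p Finf (f : T -> R) (x : n.-tuple T) (l : d.-tuple nat) :
  0 <= c -> 1 <= p -> 0 < Finf -> (2 <= n)%N -> measurable_fun setT f ->
  {ae cube_measure R d, forall t, `|f t| <= Finf} -> Lani n c l ->
  (norm_cube p (fun t => (fhat W l x t - f t)%:E) <=
   ((Cw / ln 2 `^ c + Finf) * n%:R)%:E)%E.
Proof.
move=> c0 p1 F0 n2 mf fF Ll; have n0 : (0 < n)%N by exact: leq_trans n2.
have n0R : 0 < n%:R :> R by rewrite ltr0n.
have n1R : 1 <= n%:R :> R by rewrite ler1n.
have KV t u : `|kern W (hexp R l) t u| <= Cw / vol (hexp R l).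
  by apply: kern_le => //; exact: hexp_gt0.
have V0 := @vol_gt0 _ _ _ (@hexp_gt0 R d l).
apply: norm_cube_le_ae => //.
- by rewrite mulr_ge0 ?ler0n// addr_ge0 ?(ltW F0)// divr_ge0// ltW.
- apply: measurable_funB => //.
  apply: measurable_funM => //; apply: measurable_sum => j.
  by apply: measurable_kern.
apply: filterS fF => t ft.
apply: (le_trans (ler_normB _ _)); rewrite mulrDl; apply: lerD; last first.
  by apply: (le_trans ft); rewrite ler_peMr// ltW.
apply: (@le_trans _ _ (Cw / vol (hexp R l))).
  rewrite /fhat /kernel_estimator normrM ger0_norm ?invr_ge0 ?ler0n//.
  rewrite mulrC ler_pdivrMr//; apply: (le_trans (ler_norm_sum _ _ _)).
  apply: (@le_trans _ _ (\sum_(j < n) Cw / vol (hexp R l))); first exact: ler_sum.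
  by rewrite sumr_const card_ord mulr_natr.
rewrite -mulrA ler_wpM2l ?(ltW Cw0)// -[leRHS]invrK lef_pV2 ?posrE ?invr_gt0 ?mulr_gt0 ?invr_gt0//.
by rewrite invfM invrK; exact: vol_hexp_ge Ll.
Qed.

End selection.

Section risk_bound.
Context {R : realType} disp (T : measurableType disp) (P : probability T R).

Lemma risk_le (g : T -> \bar R) (E : set T) (q a b : R) :
  1 <= q -> 0 <= a -> 0 <= b -> measurable E -> (forall w, 0 <= g w)%E ->
  (forall w, ~ E w -> g w <= a%:E)%E -> (forall w, g w <= b%:E)%E ->
  (\int[P]_w (g w `^ q) <= (a `^ q)%:E + (b `^ q)%:E * P E)%E.
Proof.
move=> q1 a0 b0 mE g0 ga gb; have q0 : 0 <= q by lra.
apply: (@le_trans _ _ (\int[P]_w ((a `^ q)%:E + (b `^ q)%:E * (\1_E w)%:E))%E).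
  apply: ge0_le_integral_nonmeasurable => w _; first exact: poweR_ge0.
  have [Ew|Ew] := pselect (E w); rewrite indicE.
    rewrite mem_set// mule1; apply: (le_trans (lee_poweR q0 (g0 w) (gb w))).
    by rewrite poweR_EFin leeDr// lee_fin powR_ge0.
  rewrite memNset// mule0 adde0 -poweR_EFin; apply: lee_poweR => //; exact: ga.
have mind : measurable_fun setT (fun w => (\1_E w)%:E : \bar R).
  by apply/measurable_EFinP; exact: measurable_indic.
rewrite ge0_integralD//; last 3 first.
- by move=> w _; rewrite lee_fin powR_ge0.
- by move=> w _; rewrite mule_ge0// lee_fin// powR_ge0.
- exact: measurable_funeM.
rewrite integral_probability_cst leeD2l//.
rewrite ge0_integralZl//; last by rewrite lee_fin powR_ge0.
by rewrite integral_indic// setIT.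
Qed.

End risk_bound.

Theorem theorem1 (R : realType) (d : nat) (p q tau c Finf : R)
    (W : 'I_d -> R -> R) (d_ge1 : (1 <= d)%N) (p_ge1 : 1 <= p) (q_ge1 : 1 <= q)
    (tau_gt0 : 0 < tau) (c_gt0 : 0 < c)
    (kernelW : forall i, kernel_class (W i)) (Finf_gt0 : 0 < Finf) :
  exists K : R, 0 < K /\
    forall f : d.-tuple R -> R, density f ->
    ('N[cube_measure R d]_+oo[EFin \o f] <= Finf%:E)%E ->
    forall n : nat, (2 <= n)%N ->
    forall (disp : measure_display) (T : measurableType disp)
      (P : probability T R) (X : 'I_n -> T -> d.-tuple R),
    iid_sample P f X ->
    forall lhat : n.-tuple (d.-tuple R) -> d.-tuple nat,
    selection_rule c tau W p lhat ->
    (risk P X p q (fun x => fhat W (lhat x) x) f <=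
     K%:E * ereal_inf [set oracle P X c W p f l | l in Lani n c])%E.
Proof.
have q0 : 0 < q by lra.
have [M M1 WM] := kernel_bounded kernelW.
have Cw0 : 0 < M ^+ d by rewrite exprn_gt0// (lt_le_trans _ M1).
(* With probability [O(n^(-2q))], the bad event contributes [n^q * n^(-2q) = n^(-q)] to the q-th
   moment, at most the q-th power of the oracle. *)
have b0 : 0 < 2 * q by lra.
have [C [CM [C0 CM0 H]]] := good_event_all kernelW M1 WM d_ge1
  (Finf * 2 ^+ d) p_ge1 tau_gt0 b0 c_gt0.
pose K1 := 2 + 5 * (1 + tau) * CM.
pose K2 := M ^+ d / ln 2 `^ c + Finf.
have K10 : 0 < K1.
  by rewrite ltr_pwDl// mulr_ge0 ?(ltW CM0)// mulr_ge0// addr_ge0// ltW.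
have K20 : 0 < K2 by rewrite ltr_pwDr// divr_ge0 ?powR_ge0// ltW.
pose K3 := K1 `^ q + K2 `^ q * C.
have K30 : 0 < K3 by rewrite ltr_pwDl ?powR_gt0// mulr_ge0 ?powR_ge0// ltW.
pose K := K3 `^ q^-1.
have K0 : 0 < K by exact: powR_gt0.
exists K; split => // f df fF n n2 disp T P X iidX lhat [_ sel].
have n0 : (0 < n)%N by exact: leq_trans n2.
have n0R : 0 < n%:R :> R by rewrite ltr0n.
have [mf _ _] := df.
have [mu [Q [QL QE muB mean]]] := sample_law n0 iidX df Finf_gt0 fF.
have [Bad [mB QB good]] := H n mu Q n2 muB QL.
have fae := density_ae_le fF.
(* With [K] on the left, the infimum is tested one index at a time, and an empty grid needs no
   argument. *)
rewrite -lee_pdivrMl//; apply/ereal_infP => _ [l Ll <-].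
rewrite lee_pdivrMl//.
have -> : oracle P X c W p f l = (
  norm_cube p (fun t => (kern_mean W (hexp R l) mu t - f t)%:E) +
  ereal_sup [set norm_cube p (fun t => (kern_mean W (hexp R l') mu t -
      kern_mean W (hexp R (imin l l')) mu t)%:E) | l' in Lani n c] +
  (rate n (hexp R l))%:E)%E.
  have mE : mean_fhat P X W = fun l t => (kern_mean W (hexp R l) mu t)%:E.
    by apply/funext => l1; apply/funext => t; exact: mean.
  by rewrite /oracle mE.
set o := (_ + _ + _)%E.
have og : ((n%:R^-1)%:E <= o)%E.
  apply: (@le_trans _ _ (rate n (hexp R l))%:E); first by rewrite lee_fin rate_ge.
  rewrite leeDr// adde_ge0 ?norm_cube_ge0//.
  by apply: le_trans (norm_cube_ge0 _ _) (ereal_sup_ubound _); last by exists l.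
have [ooo|ofin] := eqVneq o +oo%E; first by rewrite ooo gt0_muley ?leey// lte_fin.
have [r oE] : exists r, o = r%:E.
  exists (fine o); rewrite fineK// ge0_fin_numE ?ltey//.
  by apply: le_trans og; rewrite lee_fin invr_ge0 ltW.
have rn : n%:R^-1 <= r by rewrite -lee_fin -oE.
have r0 : 0 < r by apply: lt_le_trans rn; rewrite invr_gt0.
pose E := data X @^-1` Bad.
have mE : measurable E.
  by rewrite -[X in measurable X]setTI; exact: (measurable_data iidX).
pose g w := norm_cube p (fun t => (fhat W (lhat (data X w)) (data X w) t - f t)%:E).
have ga w : ~ E w -> (g w <= (K1 * r)%:E)%E.
  move=> Ew; rewrite EFinM -oE.
  have sx := sel _ (data_in_cube iidX w).
  exact: (oracle_chain kernelW M1 WM n0 p_ge1 tau_gt0 (good _ Ew) mf Ll sx).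
have gb w : (g w <= (K2 * n%:R)%:E)%E.
  have [Lh _] := sel _ (data_in_cube iidX w).
  exact: (crude_bound kernelW M1 WM d_ge1 _ (ltW c_gt0) p_ge1 Finf_gt0 n2 mf fae Lh).
have R1 := risk_le P q_ge1 (mulr_ge0 (ltW K10) (ltW r0)) (mulr_ge0 (ltW K20) (ltW n0R))
  mE (fun w => norm_cube_ge0 _ _) ga gb.
have R2 : (\int[P]_w (g w `^ q) <= (K3 * r `^ q)%:E)%E.
  apply: (le_trans R1); rewrite -QE.
  apply: (@le_trans _ _ (((K1 * r) `^ q)%:E + ((K2 * n%:R) `^ q)%:E *
      (C * expR (- (2 * q) * ln n%:R))%:E)%E).
    by rewrite leeD2l// lee_wpmul2l// lee_fin powR_ge0.
  rewrite -EFinM -EFinD lee_fin /K3 [leRHS]mulrDl.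
  rewrite !powRM ?ler0n ?(ltW K10) ?(ltW K20) ?(ltW r0)//.
  rewrite lerD2l -!mulrA ler_wpM2l ?powR_ge0// mulrCA ler_wpM2l ?(ltW C0)//.
  apply: (@le_trans _ _ ((n%:R^-1) `^ q)); last by rewrite ler_powRl ?invr_ge0 ?(ltW q0) ?(ltW n0R).
  rewrite /powR !gt_eqF ?invr_gt0// -expRD ler_expR lnV ?posrE//.
  by rewrite le_eqVlt; apply/orP; left; apply/eqP; ring.
rewrite /risk -/g oE.
apply: (@le_trans _ _ ((K3 * r `^ q)%:E `^ q^-1)%E).
  apply: lee_poweR => //; first by rewrite invr_ge0 ltW.
  by apply: integral_ge0 => w _; exact: poweR_ge0.
rewrite poweR_EFin powRM ?powR_ge0 ?(ltW K30)//.
by rewrite -powRrM mulfV ?gt_eqF// powRr1 ?(ltW r0).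
Qed.
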